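(* Let $\mathcal{C}$ be a Grothendieck site and let $p\colon F\to G$ be a map of simplicial presheaves on $\mathcal{C}$. Then $p$ admits local liftings in every commutative square $$\begin{array}{ccc} \partial\Delta^n\otimes X & \to & F\\ \downarrow & & \downarrow p\\ \Delta^n\otimes X & \to & G\end{array}$$ (with $n\ge0$ and $X$ representable) if and only if $p$ is a local acyclic fibration.
   Context: A simplicial presheaf on $\mathcal{C}$ is a functor from $\mathcal{C}^{op}$ to simplicial sets. An object $X$ of $\mathcal{C}$ is identified with the presheaf it represents, and for a simplicial set $K$, $K\otimes X$ is the simplicial presheaf $U\mapsto K\times\mathrm{Hom}_{\mathcal{C}}(U,X)$, so maps $K\otimes X\to F$ correspond to maps $K\to F(X)$. By convention $\partial\Delta^0=\emptyset$. A commutative square from $K\otimes X\to L\otimes X$ to $F\to G$ ($X$ representable) has local liftings if there is a covering sieve of $X$ such that for each $U\to X$ in the sieve the square obtained by precomposing with $K\otimes U\to L\otimes U$ has a lift $L\otimes U\to F$ making both triangles commute (no compatibility for different $U$). A map $F\to G$ is a local-fibration if every square from $\Lambda^{n,k}\otimes X\to\Delta^n\otimes X$ ($X$ representable) to $F\to G$ has local liftings. For a pointed simplicial set $(K,x)$, $\pi_n(K,x)$ is the set of maps $(\Delta^n,\partial\Delta^n)\to(K,x)$ modulo the equivalence relation generated by simplicial homotopy relative to $\partial\Delta^n$. For $x\in F(X)_0$, $\pi_n(F,x)$ is the presheaf on $\mathcal{C}\downarrow X$ given by $(U\to X)\mapsto\pi_n(F(U),x|_U)$. $\mathrm{Ex}^\infty$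 is Kan's fibrant-replacement functor, applied objectwise. A map $f\colon F\to G$ is a local weak equivalence if (1) $\pi_0F\to\pi_0G$ becomes an isomorphism upon sheafification, and (2) for every $X\in\mathcal{C}$, every $x\in F(X)_0$ and every $n\ge1$ the map $\pi_n(\mathrm{Ex}^\infty F,x)\to\pi_n(\mathrm{Ex}^\infty G,fx)$ of presheaves on $\mathcal{C}\downarrow X$ becomes an isomorphism upon sheafification. A local acyclic fibration is a map that is both a local weak equivalence and a local-fibration. *)

(* Defs.v *)
From HB Require Import structures.
From mathcomp Require Import all_boot all_order.
From mathcomp Require Import boolp.
From Stdlib Require Import Relation_Operators.

Set Implicit Arguments.
Unset Strict Implicit.
Unset Printing Implicit Defensive.

Import Order.TTheory Order.DefaultSetSubsetOrder.

Declare Scope cat_scope.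
Local Open Scope cat_scope.

Lemma sig_eq (T : Type) (P : T -> Prop) (x y : {t : T | P t}) :
  proj1_sig x = proj1_sig y -> x = y.
Proof. by case: x y => [x xP] [y yP] /= E; exact: eq_exist. Qed.

Section Quotient.
Variables (T : Type) (R : T -> T -> Prop).

Definition gen_equiv : T -> T -> Prop := clos_refl_sym_trans T R.

Definition quot := {A : T -> Prop | exists x, A = gen_equiv x}.

Definition class (x : T) : quot := exist _ (gen_equiv x) (ex_intro _ x erefl).

Definition repr (q : quot) : T := projT1 (cid (proj2_sig q)).

Lemma reprK q : class (repr q) = q.
Proof.
by apply: sig_eq; rewrite /repr; case: cid => x /= ->.
Qed.

Lemma eq_class x y : gen_equiv x y -> class x = class y.
Proof.
move=> xy; apply: sig_eq; apply/funext => z; apply/propext; split=> h.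
- exact: rst_trans (rst_sym _ _ _ _ xy) h.
- exact: rst_trans xy h.
Qed.

Lemma class_eq x y : class x = class y -> gen_equiv x y.
Proof. by move=> [->]; exact: rst_refl. Qed.

Lemma quotW (P : quot -> Prop) : (forall x, P (class x)) -> forall q, P q.
Proof. by move=> h q; rewrite -(reprK q). Qed.

End Quotient.

Arguments class {T} R x.

Definition quot_map T T' (R : T -> T -> Prop) (R' : T' -> T' -> Prop)
    (f : T -> T') (_ : forall x y, R x y -> gen_equiv R' (f x) (f y))
    (q : quot R) : quot R' :=
  class R' (f (repr q)).

Lemma quot_mapE T T' (R : T -> T -> Prop) (R' : T' -> T' -> Prop) (f : T -> T')
    (fR : forall x y, R x y -> gen_equiv R' (f x) (f y)) x :
  quot_map fR (class R x) = class R' (f x).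
Proof.
have fE y z : gen_equiv R y z -> gen_equiv R' (f y) (f z).
  elim=> {y z} [y z /fR // | y | y z _ | y z t _ yz _ zt].
  - exact: rst_refl.
  - exact: rst_sym.
  - exact: rst_trans yz zt.
by apply/eq_class/fE/class_eq/reprK.
Qed.

Record Category := {
  Ob :> Type;
  Hom : Ob -> Ob -> Type;
  hid : forall X, Hom X X;
  hcomp : forall X Y Z, Hom Y Z -> Hom X Y -> Hom X Z;
  hcomp1 : forall X Y (f : Hom X Y), hcomp f (hid X) = f;
  hcomp1r : forall X Y (f : Hom X Y), hcomp (hid Y) f = f;
  hcompA : forall X Y Z W (h : Hom Z W) (g : Hom Y Z) (f : Hom X Y),
    hcomp h (hcomp g f) = hcomp (hcomp h g) f }.

Arguments Hom {_} _ _.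
Arguments hid {_} X.
Arguments hcomp {_} [X Y Z] _ _.
Notation "g ∘ f" := (hcomp g f) (at level 40, left associativity) : cat_scope.

Record Psh (C : Category) := {
  pob :> C -> Type;
  pact : forall U V (f : Hom V U), pob U -> pob V;
  pact1 : forall U (x : pob U), pact (hid U) x = x;
  pactM : forall U V W (f : Hom V U) (g : Hom W V) x,
    pact (f ∘ g) x = pact g (pact f x) }.

Arguments pact {C} P [U V] f x : rename.

Record PshMap (C : Category) (P Q : Psh C) := {
  pmap :> forall U, P U -> Q U;
  pmap_nat : forall U V (f : Hom V U) x, pmap (pact P f x) = pact Q f (pmap x) }.

Arguments pmap {C P Q} p [U] x : rename.

Section PresheafMaps.
Variable C : Category.
Implicit Types P Q R : Psh C.

Lemma PshMap_eq P Q (a b : PshMap P Q) : (forall U (x : P U), a U x = b U x) -> a = b.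
Proof.
case: a b => [a aN] [b bN] /= ab.
have {ab}E : a = b by apply: functional_extensionality_dep => U; apply/funext.
by subst b; congr Build_PshMap; apply: Prop_irrelevance.
Qed.

Definition pid P : PshMap P P.
Proof. by exists (fun U x => x). Defined.

Definition pcomp P Q R (b : PshMap Q R) (a : PshMap P Q) : PshMap P R.
Proof.
by exists (fun U x => b U (a U x)) => U V f x; rewrite !pmap_nat.
Defined.

Lemma pcomp1 P Q (a : PshMap P Q) : pcomp a (pid P) = a.
Proof. exact: PshMap_eq. Qed.

Lemma pcomp1r P Q (a : PshMap P Q) : pcomp (pid Q) a = a.
Proof. exact: PshMap_eq. Qed.

Lemma pcompA P Q R S (c : PshMap R S) (b : PshMap Q R) (a : PshMap P Q) :
  pcomp c (pcomp b a) = pcomp (pcomp c b) a.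
Proof. exact: PshMap_eq. Qed.

Definition is_iso P Q (a : PshMap P Q) : Prop :=
  exists b : PshMap Q P, pcomp b a = pid P /\ pcomp a b = pid Q.

Definition yoneda (X : C) : Psh C.
Proof.
exists (fun U => Hom U X) (fun U V f x => x ∘ f) => [U x | U V W f g x].
- exact: hcomp1.
- exact: hcompA.
Defined.

Definition pprod P Q : Psh C.
Proof.
exists (fun U => P U * Q U)%type (fun U V f x => (pact P f x.1, pact Q f x.2)).
- by move=> U [x y] /=; rewrite !pact1.
- by move=> U V W f g [x y] /=; rewrite !pactM.
Defined.

Definition pconst (T : Type) : Psh C.
Proof. by exists (fun=> T) (fun U V f x => x). Defined.

Section SequentialColimit.
Variables (P : nat -> Psh C) (u : forall i, PshMap (P i) (P i.+1)).

Definition seq_step U (a b : {i : nat & P i U}) : Prop :=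
  b = existT (fun i => P i U) (tag a).+1 (u (tag a) U (tagged a)).

Definition seq_act U V (f : Hom V U) (a : {i : nat & P i U}) : {i : nat & P i V} :=
  existT (fun i => P i V) (tag a) (pact (P (tag a)) f (tagged a)).

Lemma seq_act_step U V (f : Hom V U) a b :
  seq_step a b -> gen_equiv (@seq_step V) (seq_act f a) (seq_act f b).
Proof. by move=> ->; apply: rst_step; rewrite /seq_step /seq_act /= pmap_nat. Qed.

Definition seq_colim : Psh C.
Proof.
exists (fun U => quot (@seq_step U)) (fun U V f => quot_map (seq_act_step f)).
- by move=> U; apply: quotW => -[i x]; rewrite /= quot_mapE /seq_act /= pact1.
- move=> U V W f g; apply: quotW => -[i x].
  by rewrite /= !quot_mapE /seq_act /= pactM.
Defined.

Definition seq_incl i : PshMap (P i) seq_colim.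
Proof.
exists (fun U x => class (@seq_step U) (existT (fun i => P i U) i x)) => U V f x.
by rewrite /= quot_mapE.
Defined.

End SequentialColimit.

Section SequentialColimitMap.
Variables (P Q : nat -> Psh C).
Variables (u : forall i, PshMap (P i) (P i.+1)) (v : forall i, PshMap (Q i) (Q i.+1)).
Variables (a : forall i, PshMap (P i) (Q i)).
Hypothesis av : forall i, pcomp (a i.+1) (u i) = pcomp (v i) (a i).

Definition seq_app U (x : {i : nat & P i U}) : {i : nat & Q i U} :=
  existT (fun i => Q i U) (tag x) (a (tag x) U (tagged x)).

Lemma seq_app_step U x y :
  seq_step u x y -> gen_equiv (@seq_step _ v U) (seq_app x) (seq_app y).
Proof.
case: x => i x ->; apply: rst_step; rewrite /seq_step /seq_app /=.
by have := congr1 (fun c : PshMap _ _ => c U x) (av i); rewrite /= => ->.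
Qed.

Definition seq_colim_map : PshMap (seq_colim u) (seq_colim v).
Proof.
exists (fun U => quot_map (@seq_app_step U)) => U V f; apply: quotW => -[i x].
by rewrite /= !quot_mapE /seq_app /seq_act /= pmap_nat.
Defined.

End SequentialColimitMap.

End PresheafMaps.

Record SubPsh (C : Category) (P : Psh C) := {
  sub_mem :> forall U, P U -> Prop;
  sub_closed : forall U V (f : Hom V U) x, sub_mem x -> sub_mem (pact P f x) }.

Arguments sub_mem {C P} s [U] x : rename.

Section Subpresheaves.
Variables (C : Category) (P : Psh C).

Lemma SubPsh_eq (S T : SubPsh P) : (forall U (x : P U), S U x <-> T U x) -> S = T.
Proof.
case: S T => [S Sc] [T Tc] /= ST.
have {ST}E : S = T.
  by apply: functional_extensionality_dep => U; apply/funext => x; apply/propext.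
by subst T; congr Build_SubPsh; apply: Prop_irrelevance.
Qed.

Definition sub_psh (S : SubPsh P) : Psh C.
Proof.
exists (fun U => {x : P U | S U x})
       (fun U V f x => exist _ _ (sub_closed f (proj2_sig x))) => [U | U V W f g] [x Sx].
- by apply: sig_eq; rewrite /= pact1.
- by apply: sig_eq; rewrite /= pactM.
Defined.

Definition sub_incl (S : SubPsh P) : PshMap (sub_psh S) P.
Proof. by exists (fun U x => proj1_sig x). Defined.

End Subpresheaves.

Lemma omorph_eq d d' (T : preorderType d) (T' : preorderType d')
  (f g : {omorphism T -> T'}) : f =1 g -> f = g.
Proof.
case: f g => [f [[fP]]] [g [[gP]]] /= /funext E.
by subst g; rewrite (Prop_irrelevance fP gP).
Qed.

Definition omorph_id d (T : preorderType d) : {omorphism T -> T} := idfun.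

Definition omorph_comp d d' d'' (T : preorderType d) (T' : preorderType d')
    (T'' : preorderType d'') (g : {omorphism T' -> T''}) (f : {omorphism T -> T'}) :
  {omorphism T -> T''} := g \o f.

Definition omorph_mk d d' (T : preorderType d) (T' : preorderType d') (f : T -> T')
    (fP : {homo f : x y / (x <= y)%O}) : {omorphism T -> T'} :=
  HB.pack_for {omorphism T -> T'} f (Order.isOrderMorphism.Build d T d' T' f fP).

Definition omorph_const d d' (T : preorderType d) (T' : preorderType d') (t : T') :
  {omorphism T -> T'} := omorph_mk (fun x y (_ : (x <= y)%O) => lexx t).

(* The simplex category: the object n stands for [n] = {0 < ... < n}. *)
Definition Delta : Category.
Proof.
exists nat (fun m n => {omorphism 'I_m.+1 -> 'I_n.+1})
  (fun n => omorph_id 'I_n.+1) (fun l m n g f => omorph_comp g f);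
  by intros; apply: omorph_eq.
Defined.

Definition sSet := Psh Delta.
Definition sMap (K L : sSet) := PshMap K L.

Definition simplex (n : nat) : sSet := @yoneda Delta n.

Definition nerve d (T : porderType d) : sSet.
Proof.
exists (fun n : Delta => {omorphism 'I_n.+1 -> T}) (fun m n f x => omorph_comp x f);
  by intros; apply: omorph_eq.
Defined.

Definition nerve_map d d' (T : porderType d) (T' : porderType d')
  (a : {omorphism T -> T'}) : sMap (nerve T) (nerve T').
Proof.
exists (fun n (x : nerve T n) => omorph_comp a x) => m n f x; exact: omorph_eq.
Defined.

Definition cst (m n : nat) (i : 'I_n.+1) : simplex n m := omorph_const _ i.

(* The totally degenerate m-simplex at the vertex x. *)
Definition degen (K : sSet) (x : K 0) (m : Delta) : K m :=
  pact K (omorph_const _ ord0 : @Hom Delta m 0) x.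

Definition boundary (n : nat) : SubPsh (simplex n).
Proof.
exists (fun m (s : simplex n m) => exists j : 'I_n.+1, forall i, s i != j).
by move=> m l f s [j sj]; exists j => i; exact: sj.
Defined.

(* Union of the faces opposite to j != k; only meaningful for 0 < n, since it is
   empty for n = 0. *)
Definition horn (n : nat) (k : 'I_n.+1) : SubPsh (simplex n).
Proof.
exists (fun m (s : simplex n m) => exists2 j : 'I_n.+1, j != k & forall i, s i != j).
by move=> m l f s [j jk sj]; exists j => // i; exact: sj.
Defined.

Definition pi0_rel (K : sSet) (a b : K 0) : Prop :=
  exists e : K 1%N,
    pact K (cst 0 (ord0 : 'I_2)) e = a /\ pact K (cst 0 (ord_max : 'I_2)) e = b.

Definition pi0 (K : sSet) := quot (@pi0_rel K).

Lemma pi0_rel_map (K L : sSet) (f : sMap K L) a b :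
  pi0_rel a b -> gen_equiv (@pi0_rel L) (f _ a) (f _ b).
Proof.
move=> [e [<- <-]]; apply: rst_step.
by exists (f _ e); rewrite !pmap_nat.
Qed.

Definition pi0_map (K L : sSet) (f : sMap K L) : pi0 K -> pi0 L :=
  quot_map (@pi0_rel_map K L f).

(* Maps of pairs (Delta^n, boundary of Delta^n) -> (K, x). *)
Definition sphere (n : nat) (K : sSet) (x : K 0) :=
  {a : sMap (simplex n) K |
    forall m (s : simplex n m), boundary n m s -> a m s = degen x m}.

Definition rel_homotopic (n : nat) (K : sSet) (x : K 0) (a b : sphere n x) : Prop :=
  exists H : sMap (pprod (simplex n) (simplex 1)) K,
    [/\ forall m (s : simplex n m), H m (s, cst m ord0) = proj1_sig a m s,
        forall m (s : simplex n m), H m (s, cst m ord_max) = proj1_sig b m s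
      & forall m (s : simplex n m) (t : simplex 1 m),
          boundary n m s -> H m (s, t) = degen x m].

Definition pi (n : nat) (K : sSet) (x : K 0) := quot (@rel_homotopic n K x).

Lemma degen_map (K L : sSet) (f : sMap K L) x m : f m (degen x m) = degen (f _ x) m.
Proof. exact: pmap_nat. Qed.

Definition sphere_map n (K L : sSet) (f : sMap K L) (x : K 0) (y : L 0)
  (fx : f _ x = y) (a : sphere n x) : sphere n y.
Proof.
exists (pcomp f (proj1_sig a)) => m s sb.
by rewrite -fx -degen_map -(proj2_sig a m s sb).
Defined.

Lemma rel_homotopic_map n (K L : sSet) (f : sMap K L) x y (fx : f _ x = y) a b :
  @rel_homotopic n K x a b ->
  gen_equiv (@rel_homotopic n L y) (sphere_map fx a) (sphere_map fx b).
Proof.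
move=> [H [H0 H1 Hb]]; apply: rst_step; exists (pcomp f H); split=> m s /=.
- by rewrite H0.
- by rewrite H1.
- by move=> t sb; rewrite Hb // degen_map fx.
Qed.

Definition pi_map n (K L : sSet) (f : sMap K L) (x : K 0) (y : L 0)
    (fx : f _ x = y) : pi n x -> pi n y :=
  quot_map (@rel_homotopic_map n K L f x y fx).

Record nesub (n : nat) :=
  NeSub { nesub_val :> {set 'I_n.+1}; nesubP : nesub_val != set0 }.

HB.instance Definition _ n := [isSub for @nesub_val n].
HB.instance Definition _ n := [Choice of nesub n by <:].
HB.instance Definition _ n :=
  [SubChoice_isSubPOrder of nesub n by <: with Order.SetSubsetOrder.subset_display].

Lemma nesub_imageP m n (f : {omorphism 'I_m.+1 -> 'I_n.+1}) (A : nesub m) :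
  f @: (A : {set _}) != set0.
Proof. by rewrite imset_eq0 nesubP. Qed.

Lemma nesub_image_le m n (f : {omorphism 'I_m.+1 -> 'I_n.+1}) :
  {homo (fun A : nesub m => NeSub (nesub_imageP f A)) : A B / (A <= B)%O}.
Proof. by move=> A B; exact: imsetS. Qed.

Definition nesub_image m n (f : {omorphism 'I_m.+1 -> 'I_n.+1}) :
  {omorphism nesub m -> nesub n} := omorph_mk (@nesub_image_le m n f).

Definition nesub_max n (A : nesub n) : 'I_n.+1 :=
  \big[Order.max/ord0]_(i in (A : {set _})) i.

Lemma nesub_max_le n : {homo @nesub_max n : A B / (A <= B)%O}.
Proof. by move=> A B AB; apply: sub_bigmax => i; exact: (subsetP AB). Qed.

Definition last_vertex n : {omorphism nesub n -> 'I_n.+1} := omorph_mk (@nesub_max_le n).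

(* Barycentric subdivision of Delta^n, whose nondegenerate simplices are the
   nonempty subsets of [n]. *)
Definition sd (n : nat) : sSet := nerve (nesub n).

Definition sd_map m n (f : {omorphism 'I_m.+1 -> 'I_n.+1}) : sMap (sd m) (sd n) :=
  nerve_map (nesub_image f).

Definition Ex (K : sSet) : sSet.
Proof.
exists (fun n : Delta => sMap (sd n) K) (fun m n f a => pcomp a (sd_map f)).
- move=> n a; apply: PshMap_eq => m x /=; congr (a m _).
  apply: omorph_eq => i; apply: val_inj; exact: imset_id.
- move=> m n l f g a; apply: PshMap_eq => k x /=; congr (a k _).
  apply: omorph_eq => i; apply: val_inj; exact: imset_comp.
Defined.

Definition Ex_map (K L : sSet) (f : sMap K L) : sMap (Ex K) (Ex L).
Proof.
exists (fun n (a : Ex K n) => pcomp f a) => m n g a; exact: pcompA.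
Defined.

Lemma nesub_max_image m n (f : {omorphism 'I_m.+1 -> 'I_n.+1}) (A : nesub m) :
  nesub_max (nesub_image f A) = f (nesub_max A).
Proof.
apply/le_anti/andP; split.
- apply: bigmax_le => [|_ /imsetP[i iA ->]]; first exact: leq0n.
  by apply: omorph_le; exact: le_bigmax_cond.
- have /set0Pn[j jA] := nesubP A.
  have [//|i iA E] := @eq_bigmax _ _ _ ord0 j (mem (A : {set _})) id jA.
  rewrite [nesub_max A]E.
  exact: (@le_bigmax_cond _ _ _ ord0 (f i) (mem (f @: (A : {set _}))) id (imset_f f iA)).
Qed.

(* Precomposition of x : Delta^n -> K with the last vertex map sd n -> Delta^n;
   K n is identified with the maps Delta^n -> K. *)
Definition Ex_unit (K : sSet) : sMap K (Ex K).
Proof.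
unshelve eexists.
- move=> n x; exists (fun m (s : sd n m) =>
    pact K (omorph_comp (last_vertex n) s : @Hom Delta m n) x) => m l f s.
  by rewrite -pactM; congr (pact K _ x); exact: omorph_eq.
- move=> m n f x; apply: PshMap_eq => k s /=; rewrite -pactM.
  congr (pact K _ x); apply: omorph_eq => i /=.
  by rewrite [RHS]nesub_max_image.
Defined.

Fixpoint Ex_iter (i : nat) (K : sSet) : sSet :=
  if i is j.+1 then Ex (Ex_iter j K) else K.

Fixpoint Ex_iter_map (i : nat) (K L : sSet) (f : sMap K L) :
    sMap (Ex_iter i K) (Ex_iter i L) :=
  if i is j.+1 then Ex_map (Ex_iter_map j f) else f.

Definition ExInf (K : sSet) : sSet := seq_colim (fun i => Ex_unit (Ex_iter i K)).

Definition ExInf_unit (K : sSet) : sMap K (ExInf K) :=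
  seq_incl (fun i => Ex_unit (Ex_iter i K)) 0.

Lemma Ex_unit_nat (K L : sSet) (f : sMap K L) :
  pcomp (Ex_map f) (Ex_unit K) = pcomp (Ex_unit L) f.
Proof.
by apply: PshMap_eq => n x; apply: PshMap_eq => m s /=; rewrite pmap_nat.
Qed.

Definition ExInf_map (K L : sSet) (f : sMap K L) : sMap (ExInf K) (ExInf L) :=
  seq_colim_map (fun i => Ex_unit_nat (Ex_iter_map i f)).

Lemma Ex_iter_map1 i K : Ex_iter_map i (pid K) = pid (Ex_iter i K).
Proof.
elim: i => [//|i IH] /=; rewrite IH.
by apply: PshMap_eq => n a; apply: pcomp1r.
Qed.

Lemma Ex_iter_mapM i (K L M : sSet) (g : sMap L M) (f : sMap K L) :
  Ex_iter_map i (pcomp g f) = pcomp (Ex_iter_map i g) (Ex_iter_map i f).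
Proof.
elim: i => [//|i IH] /=; rewrite IH.
by apply: PshMap_eq => n a /=; rewrite pcompA.
Qed.

Lemma ExInf_map1 K : ExInf_map (pid K) = pid (ExInf K).
Proof.
apply: PshMap_eq => n; apply: quotW => -[i x].
by rewrite /= quot_mapE /seq_app /= Ex_iter_map1.
Qed.

Lemma ExInf_mapM (K L M : sSet) (g : sMap L M) (f : sMap K L) :
  ExInf_map (pcomp g f) = pcomp (ExInf_map g) (ExInf_map f).
Proof.
apply: PshMap_eq => n; apply: quotW => -[i x].
by rewrite /= !quot_mapE /seq_app /= Ex_iter_mapM.
Qed.

Lemma ExInf_unit_nat (K L : sSet) (f : sMap K L) :
  pcomp (ExInf_map f) (ExInf_unit K) = pcomp (ExInf_unit L) f.
Proof. by apply: PshMap_eq => n x; rewrite /= quot_mapE. Qed.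

(* A sieve on X is a subpresheaf of the presheaf represented by X. *)
Definition Sieve (C : Category) (X : C) := SubPsh (yoneda X).

Definition max_sieve (C : Category) (X : C) : Sieve X.
Proof. by exists (fun U f => True). Defined.

Definition pull_sieve (C : Category) (X Y : C) (f : Hom Y X) (S : Sieve X) : Sieve Y.
Proof.
exists (fun U (g : yoneda Y U) => S U (f ∘ g)) => U V h g Sg.
by have := sub_closed h Sg; rewrite /= hcompA.
Defined.

Record Site := {
  site_cat :> Category;
  covering : forall X : site_cat, Sieve X -> Prop;
  cov_max : forall X : site_cat, covering (max_sieve X);
  cov_pull : forall (X Y : site_cat) (f : Hom Y X) (S : Sieve X),
    covering S -> covering (pull_sieve f S);
  cov_trans : forall (X : site_cat) (S R : Sieve X), covering S ->
    (forall Y (f : Hom Y X), S Y f -> covering (pull_sieve f R)) -> covering R }.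

Arguments covering {s X} S : rename.

(* P^+(X) is the colimit, over the covering sieves S of X, of the sets of maps
   from S to P; the sheafification of P is P^++. *)
Section Plus.
Variable C : Site.

Record germ (P : Psh C) (X : C) := {
  germ_sieve : Sieve X;
  germ_cov : covering germ_sieve;
  germ_fam : PshMap (sub_psh germ_sieve) P }.

Definition germ_rel (P : Psh C) (X : C) (a b : germ P X) : Prop :=
  exists2 R : Sieve X, covering R &
    forall U (f : yoneda X U), R U f ->
      exists (fa : germ_sieve a U f) (fb : germ_sieve b U f),
        germ_fam a U (exist _ f fa) = germ_fam b U (exist _ f fb).

Definition pull_fam (P : Psh C) (X Y : C) (g : Hom Y X) (S : Sieve X)
  (s : PshMap (sub_psh S) P) : PshMap (sub_psh (pull_sieve g S)) P.
Proof.
exists (fun U (x : sub_psh (pull_sieve g S) U) =>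
          s U (exist _ (g ∘ proj1_sig x) (proj2_sig x))) => U V f [h Sh].
rewrite -pmap_nat /=; congr (s V _); apply: sig_eq; exact: hcompA.
Defined.

Definition pull_germ (P : Psh C) (X Y : C) (g : Hom Y X) (a : germ P X) : germ P Y :=
  {| germ_cov := cov_pull g (germ_cov a); germ_fam := pull_fam g (germ_fam a) |}.

Lemma pull_germ_rel (P : Psh C) (X Y : C) (g : Hom Y X) (a b : germ P X) :
  germ_rel a b -> gen_equiv (@germ_rel P Y) (pull_germ g a) (pull_germ g b).
Proof.
move=> [R Rc ab]; apply: rst_step; exists (pull_sieve g R); first exact: cov_pull.
by move=> U f /ab.
Qed.

Lemma germ_eq (P : Psh C) (X : C) (a b : germ P X) :
  (forall U f (fa : germ_sieve a U f), exists fb : germ_sieve b U f,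
     germ_fam a U (exist _ f fa) = germ_fam b U (exist _ f fb)) ->
  class (@germ_rel P X) a = class _ b.
Proof.
move=> ab; apply/eq_class/rst_step; exists (germ_sieve a); first exact: germ_cov.
by move=> U f fa; exists fa.
Qed.

Definition plus (P : Psh C) : Psh C.
Proof.
exists (fun X => quot (@germ_rel P X))
       (fun X Y g => quot_map (@pull_germ_rel P X Y g)).
- move=> X; apply: quotW => a; rewrite /= quot_mapE; apply: germ_eq => U f fa /=.
  have fb : germ_sieve a U f by move: fa; rewrite /= hcomp1r.
  by exists fb; congr (germ_fam a U _); apply: sig_eq; exact: hcomp1r.
- move=> X Y Z f g; apply: quotW => a; rewrite /= !quot_mapE; apply: germ_eq => U h ha /=.
  have hb : germ_sieve a U (f ∘ (g ∘ h)) by move: ha; rewrite /= hcompA.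
  by exists hb; congr (germ_fam a U _); apply: sig_eq; rewrite /= hcompA.
Defined.

Definition germ_map (P Q : Psh C) (f : PshMap P Q) (X : C) (a : germ P X) : germ Q X :=
  {| germ_cov := germ_cov a; germ_fam := pcomp f (germ_fam a) |}.

Lemma germ_map_rel (P Q : Psh C) (f : PshMap P Q) (X : C) (a b : germ P X) :
  germ_rel a b -> gen_equiv (@germ_rel Q X) (germ_map f a) (germ_map f b).
Proof.
move=> [R Rc ab]; apply: rst_step; exists R => // U g /ab[ga [gb E]].
by exists ga, gb; rewrite /= E.
Qed.

Definition plus_map (P Q : Psh C) (f : PshMap P Q) : PshMap (plus P) (plus Q).
Proof.
exists (fun X => quot_map (@germ_map_rel P Q f X)) => X Y g; apply: quotW => a.
by rewrite /= !quot_mapE; apply: germ_eq => U h ha; exists ha.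
Defined.

Definition sheafify (P : Psh C) : Psh C := plus (plus P).

Definition sheafify_map (P Q : Psh C) (f : PshMap P Q) :
    PshMap (sheafify P) (sheafify Q) :=
  plus_map (plus_map f).

Definition iso_on_sheafification (P Q : Psh C) (f : PshMap P Q) : Prop :=
  is_iso (sheafify_map f).

End Plus.

Section Slice.
Variables (C : Site) (X : C).

Record over := Over { dom : C; arr : Hom dom X }.

Definition over_hom (a b : over) := {h : Hom (dom a) (dom b) | arr b ∘ h = arr a}.

Definition over_id a : over_hom a a := exist _ (hid _) (hcomp1 (arr a)).

Definition over_comp a b c (g : over_hom b c) (f : over_hom a b) : over_hom a c.
Proof.
exists (proj1_sig g ∘ proj1_sig f).
by rewrite hcompA (proj2_sig g) (proj2_sig f).
Defined.

Definition slice : Category.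
Proof.
exists over over_hom over_id over_comp => *; apply: sig_eq => /=.
- exact: hcomp1.
- exact: hcomp1r.
- exact: hcompA.
Defined.

(* The arrow of C↓X from f ∘ h to f given by h. *)
Definition over_lift (a : over) (U : C) (h : Hom U (dom a)) :
    @Hom slice (Over (arr a ∘ h)) a :=
  exist _ h erefl.

(* The sieve on U corresponding to a sieve on f : U -> X; the latter covers in
   the slice exactly when the former covers in C. *)
Definition under_sieve (a : slice) (S : Sieve a) : Sieve (dom a).
Proof.
exists (fun U (h : yoneda (dom a) U) => S (Over (arr a ∘ h)) (over_lift h)).
move=> U V f h Sh.
pose k : @Hom slice (Over (arr a ∘ (h ∘ f))) (Over (arr a ∘ h)) :=
  exist _ f (esym (hcompA (arr a) h f)).
suff -> : over_lift (pact (yoneda (dom a)) f h) = over_lift h ∘ k.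
  exact: (sub_closed k Sh).
exact: sig_eq.
Defined.

Lemma under_sieveP (a : slice) (S : Sieve a) (b : slice) (h : Hom b a) :
  under_sieve S (dom b) (proj1_sig h) <-> S b h.
Proof.
by case: b h => [V g] [h hg]; rewrite /= in h hg *; subst g.
Qed.

Lemma under_pull_sieve (a b : slice) (f : Hom b a) (S : Sieve a) :
  under_sieve (pull_sieve f S) = pull_sieve (proj1_sig f) (under_sieve S).
Proof.
apply: SubPsh_eq => U h.
exact: iff_sym (@under_sieveP a S _ (f ∘ over_lift h)).
Qed.

Definition slice_site : Site.
Proof.
exists slice (fun a S => covering (under_sieve S)).
- move=> a; suff -> : under_sieve (max_sieve a) = max_sieve (dom a) by exact: cov_max.
  exact: SubPsh_eq.
- by move=> a b f S Sc; rewrite under_pull_sieve; exact: cov_pull.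
- move=> a S R Sc SR; apply: (cov_trans Sc) => U h Sh.
  by have := SR _ (over_lift h) Sh; rewrite under_pull_sieve.
Defined.

End Slice.

Record SPsh (C : Category) := {
  spob :> C -> sSet;
  spact : forall U V (f : Hom V U), sMap (spob U) (spob V);
  spact1 : forall U, spact (hid U) = pid (spob U);
  spactM : forall U V W (f : Hom V U) (g : Hom W V),
    spact (f ∘ g) = pcomp (spact g) (spact f) }.

Arguments spact {C} F [U V] f : rename.

Record SPshMap (C : Category) (F G : SPsh C) := {
  spmap :> forall U, sMap (F U) (G U);
  spmap_nat : forall U V (f : Hom V U),
    pcomp (spmap V) (spact F f) = pcomp (spact G f) (spmap U) }.

Section SimplicialPresheaves.
Variable C : Category.
Implicit Types F G H : SPsh C.

Lemma SPshMap_eq F G (a b : SPshMap F G) : (forall U, a U = b U) -> a = b.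
Proof.
case: a b => [a aN] [b bN] /= ab.
have {ab}E : a = b by apply: functional_extensionality_dep.
by subst b; congr Build_SPshMap; apply: Prop_irrelevance.
Qed.

Definition spcomp F G H (b : SPshMap G H) (a : SPshMap F G) : SPshMap F H.
Proof.
exists (fun U => pcomp (b U) (a U)) => U V f.
by rewrite -pcompA spmap_nat pcompA spmap_nat -pcompA.
Defined.

Definition tensor (K : sSet) (X : C) : SPsh C.
Proof.
unshelve eexists.
- by move=> U; exact: (pprod K (pconst _ (Hom U X))).
- by move=> U V f; exists (fun n x => (x.1, x.2 ∘ f)).
- by move=> U; apply: PshMap_eq => n [x h] /=; rewrite hcomp1.
- by move=> U V W f g; apply: PshMap_eq => n [x h] /=; rewrite hcompA.
Defined.

Definition tensor_map (K L : sSet) (i : sMap K L) (X Y : C) (f : Hom X Y) :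
  SPshMap (tensor K X) (tensor L Y).
Proof.
unshelve eexists.
- move=> U; exists (fun n (x : tensor K X U n) => (i n x.1, f ∘ x.2) : tensor L Y U n).
  by move=> m n g [x h] /=; rewrite pmap_nat.
- by move=> U V g; apply: PshMap_eq => n [x h] /=; rewrite hcompA.
Defined.

Definition pi0_psh F : Psh C.
Proof.
exists (fun U => pi0 (F U)) (fun U V f => pi0_map (spact F f)).
- by move=> U; apply: quotW => x; rewrite /pi0_map quot_mapE spact1.
- by move=> U V W f g; apply: quotW => x; rewrite /pi0_map !quot_mapE spactM.
Defined.

Definition pi0_psh_map F G (p : SPshMap F G) : PshMap (pi0_psh F) (pi0_psh G).
Proof.
exists (fun U => pi0_map (p U)) => U V f; apply: quotW => x.
rewrite /= /pi0_map !quot_mapE; congr class.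
exact: (congr1 (fun a : PshMap _ _ => a _ x) (spmap_nat p f)).
Defined.

Definition ExInf_psh F : SPsh C.
Proof.
exists (fun U => ExInf (F U)) (fun U V f => ExInf_map (spact F f)).
- by move=> U; rewrite spact1 ExInf_map1.
- by move=> U V W f g; rewrite spactM ExInf_mapM.
Defined.

Definition ExInf_psh_map F G (p : SPshMap F G) :
  SPshMap (ExInf_psh F) (ExInf_psh G).
Proof.
exists (fun U => ExInf_map (p U)) => U V f.
by rewrite /= -!ExInf_mapM spmap_nat.
Defined.

End SimplicialPresheaves.

Section Local.
Variable C : Site.
Implicit Types F G : SPsh C.

Lemma spact_over F (X : C) (x : F X 0) (a b : slice_site X) (h : Hom b a) :
  spact F (proj1_sig h) 0 (spact F (arr a) 0 x) = spact F (arr b) 0 x.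
Proof. by case: h => h /= <-; rewrite spactM. Qed.

Definition pi_psh (n : nat) F (X : C) (x : F X 0) : Psh (slice_site X).
Proof.
exists (fun a : slice_site X => pi n (spact F (arr a) 0 x))
       (fun a b h => pi_map (spact_over x h)).
- move=> a; apply: quotW => s; rewrite /pi_map quot_mapE; congr class.
  by apply: sig_eq; rewrite /= spact1 pcomp1r.
- move=> a b c f g; apply: quotW => s; rewrite /pi_map !quot_mapE; congr class.
  by apply: sig_eq; rewrite /= spactM pcompA.
Defined.

Lemma spmap_base F G (p : SPshMap F G) (X : C) (x : F X 0) (y : G X 0)
    (px : p X 0 x = y) (a : slice_site X) :
  p (dom a) 0 (spact F (arr a) 0 x) = spact G (arr a) 0 y.
Proof.
rewrite -px; exact: (congr1 (fun c : sMap (F X) (G (dom a)) => c 0 x) (spmap_nat p (arr a))).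
Qed.

Definition pi_psh_map (n : nat) F G (p : SPshMap F G) (X : C) (x : F X 0) (y : G X 0)
  (px : p X 0 x = y) : PshMap (pi_psh n x) (pi_psh n y).
Proof.
exists (fun a => pi_map (spmap_base px a)) => a b h; apply: quotW => s.
rewrite /= /pi_map !quot_mapE; congr class; apply: sig_eq => /=.
by rewrite !pcompA spmap_nat.
Defined.

Lemma ExInf_base F G (p : SPshMap F G) (X : C) (x : F X 0) :
  ExInf_psh_map p X 0 (ExInf_unit (F X) 0 x) = ExInf_unit (G X) 0 (p X 0 x).
Proof. exact: (congr1 (fun c : sMap (F X) (ExInf (G X)) => c 0 x) (ExInf_unit_nat (p X))). Qed.

Definition commutes (K L : sSet) (i : sMap K L) F G (p : SPshMap F G) (X : C)
    (a : SPshMap (tensor K X) F) (b : SPshMap (tensor L X) G) : Prop :=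
  spcomp p a = spcomp b (tensor_map i (hid X)).

Definition has_local_liftings (K L : sSet) (i : sMap K L) F G (p : SPshMap F G)
    (X : C) (a : SPshMap (tensor K X) F) (b : SPshMap (tensor L X) G) : Prop :=
  exists2 S : Sieve X, covering S &
    forall (U : C) (f : Hom U X), S U f ->
      exists l : SPshMap (tensor L U) F,
        spcomp l (tensor_map i (hid U)) = spcomp a (tensor_map (pid K) f) /\
        spcomp p l = spcomp b (tensor_map (pid L) f).

Definition lifts_locally (K L : sSet) (i : sMap K L) F G (p : SPshMap F G) : Prop :=
  forall (X : C) (a : SPshMap (tensor K X) F) (b : SPshMap (tensor L X) G),
    commutes i p a b -> has_local_liftings i p a b.

Definition local_fibration F G (p : SPshMap F G) : Prop :=
  forall (n : nat) (k : 'I_n.+1), (0 < n)%N -> lifts_locally (sub_incl (horn k)) p.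

Definition local_weak_equivalence F G (p : SPshMap F G) : Prop :=
  iso_on_sheafification (pi0_psh_map p : @PshMap C _ _) /\
  forall (X : C) (x : F X 0) (n : nat), (0 < n)%N ->
    iso_on_sheafification
      (pi_psh_map n (ExInf_base p x) : @PshMap (slice_site X) _ _).

Definition local_acyclic_fibration F G (p : SPshMap F G) : Prop :=
  local_weak_equivalence p /\ local_fibration p.

End Local.

(* Main.v *)
From HB Require Import structures.
From mathcomp Require Import all_boot all_order.
From mathcomp Require Import boolp zify.
From Stdlib Require Import Relation_Operators.
Require Import Defs.

Set Implicit Arguments.
Unset Strict Implicit.
Unset Printing Implicit Defensive.

Import Order.TTheory Order.DefaultSetSubsetOrder.
Local Open Scope cat_scope.

(* Local liftings against boundaries give local liftings against every inclusion
   of finite complexes, hence also for Ex p and Ex^oo p, so homotopy classes and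
   homotopies in Ex^oo G lift locally to Ex^oo F: this gives one implication.

   Conversely let p be a local acyclic fibration.  Local liftings against horns
   give local liftings against every inclusion S -> T whose missing chains admit
   an acyclic matching, since a matched pair is attached as a horn.  Three such
   inclusions are needed:
   - sd (horn) -> sd Delta^n, so that Ex preserves local fibrations;
   - T x Delta^1 u K x {e} -> K x Delta^1, for the homotopy lifting property;
   - the one for the mapping cylinder of sd Delta^n -> Delta^n relative to the
     boundary: it turns a lift of a square of p composed with F -> Ex F and
     G -> Ex G into a local lift of the square itself.
   By the last point it is enough to lift boundaries along q = Ex^oo p.  Now
   Ex^oo F is a Kan complex objectwise.  Contract a square to the last vertex, so
   that it becomes a sphere s in Ex^oo F, at a base point x, over a constant
   simplex.  Injectivity of q on homotopy bounds s in Ex^oo F by some simplex;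
   surjectivity on the next homotopy group gives a sphere at x with, after a
   homotopy, the same image as this simplex, and filling a horn subtracts it, so
   that s bounds over the constant simplex. *)

(** * Coverings and sheafification *)

(** Lifts over different arrows of a covering sieve need not be compatible, so nothing is glued over
    a cover in F or G. Every construction is a finite sequence of existence statements, each valid
    after one more refinement. This is why only finite complexes occur, and why an isomorphism of
    sheafifications is replaced by its two elementwise traces, local injectivity and local
    surjectivity.

    Homotopy classes are classes of a generated equivalence relation. Facts about them are therefore
    transported along zigzags, with a refinement at each step, and no group structure is used.

    Complexes are families of chains in finite posets, so that prisms, subdivisions and mapping
    cylinders share one combinatorics of vertex sets.

    The mapping cylinder is forced by the passage from p to Ex p: a lift along Ex p is only a map on
    sd Delta^n, and its restriction to the boundary factors through the last vertex map. Such a map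
    has to be traded for one on Delta^n with the prescribed boundary. *)

Section Locally.
Variable C : Site.
Implicit Types X U V : C.

Definition locally X (phi : forall U, Hom U X -> Prop) : Prop :=
  exists2 S : Sieve X, covering S & forall U (f : yoneda X U), S U f -> phi U f.

Lemma covering_sub X (S R : Sieve X) :
  covering S -> (forall U (f : yoneda X U), S U f -> R U f) -> covering R.
Proof.
move=> Sc SR; apply: (cov_trans Sc) => U f Sf.
suff -> : pull_sieve f R = max_sieve U by exact: cov_max.
by apply: SubPsh_eq => V g; split=> // _; apply: SR; exact: (sub_closed g Sf).
Qed.

Lemma locallyT X (phi : forall U, Hom U X -> Prop) :
  (forall U f, phi U f) -> locally phi.
Proof. by move=> h; exists (max_sieve X) => [|U f _]; [exact: cov_max | exact: h]. Qed.

Lemma locally_mono X (phi psi : forall U, Hom U X -> Prop) :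
  (forall U f, phi U f -> psi U f) -> locally phi -> locally psi.
Proof. by move=> h [S Sc Sphi]; exists S => // U f /Sphi /h. Qed.

Lemma locally_pull X Y (g : Hom Y X) (phi : forall U, Hom U X -> Prop) :
  locally phi -> locally (fun U (f : Hom U Y) => phi U (g ∘ f)).
Proof.
by move=> [S Sc Sphi]; exists (pull_sieve g S) => [|U f /Sphi]; first exact: cov_pull.
Qed.

Lemma locally_bind X (phi psi : forall U, Hom U X -> Prop) :
  locally phi ->
  (forall U f, phi U f -> locally (fun V (g : Hom V U) => psi V (f ∘ g))) ->
  locally psi.
Proof.
move=> [S Sc Sphi] h.
(* [psi] need not be stable under restriction, so the sieve consists of the arrows all of whose
   composites satisfy [psi]. *)
have Rcl U V (g : Hom V U) (f : yoneda X U) : (forall W (k : Hom W U), psi W (f ∘ k)) ->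
    forall W (k : Hom W V), psi W (pact (yoneda X) g f ∘ k).
  by move=> hf W k; rewrite /= -hcompA.
exists (Build_SubPsh Rcl) => [|U f /(_ U (hid U))]; last by rewrite hcomp1.
apply: (cov_trans Sc) => U f /Sphi /h [R Rc Rpsi].
apply: (covering_sub Rc) => V g Rg W k /=; rewrite -hcompA.
by apply: Rpsi; exact: (sub_closed k Rg).
Qed.

End Locally.

Section Sheafification.
Variable C : Site.
Implicit Types (P Q : Psh C) (X U V : C).

Definition loc_inj P Q (f : PshMap P Q) : Prop :=
  forall X (x x' : P X), f X x = f X x' ->
    locally (fun U (g : Hom U X) => pact P g x = pact P g x').

Definition loc_surj P Q (f : PshMap P Q) : Prop :=
  forall X (y : Q X), locally (fun U (g : Hom U X) => exists x, f U x = pact Q g y).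

Lemma covering_meet X (S R : Sieve X) : covering S -> covering R ->
  exists2 T : Sieve X, covering T & forall U (f : yoneda X U), T U f -> S U f /\ R U f.
Proof.
move=> Sc Rc.
have Tcl U V (g : Hom V U) (f : yoneda X U) : S U f /\ R U f ->
    S V (pact (yoneda X) g f) /\ R V (pact (yoneda X) g f).
  by move=> [Sf Rf]; split; apply: sub_closed.
exists (Build_SubPsh Tcl) => //; apply: (cov_trans Sc) => U f Sf.
apply: (covering_sub (cov_pull f Rc)) => V g /= Rg; split=> //.
exact: (sub_closed g Sf).
Qed.

Lemma germ_relE P X (a b : germ P X) : gen_equiv (@germ_rel C P X) a b -> germ_rel a b.
Proof.
elim=> {a b} [//|a|a b _ [R Rc ab]|a b c _ [R Rc ab] _ [R' Rc' bc]].
- exists (germ_sieve a) => [|U f fa]; [exact: germ_cov | by exists fa, fa].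
- by exists R => // U f /ab [fa [fb E]]; exists fb, fa.
- have [T Tc TR] := covering_meet Rc Rc'; exists T => // U f /TR [/ab[fa [fb E]] /bc].
  move=> [fb' [fc E']]; exists fa, fc; rewrite E -E'.
  by congr (germ_fam b U _); exact: sig_eq.
Qed.

Lemma plus_separated P X (z z' : plus P X) :
  locally (fun U (f : Hom U X) => pact (plus P) f z = pact (plus P) f z') -> z = z'.
Proof.
elim/quotW: z => a; elim/quotW: z' => b [S Sc zz'].
apply/eq_class/rst_step.
(* The sieve on which the two families agree; it covers by transitivity. *)
pose W U (f : yoneda X U) := exists (fa : germ_sieve a U f) (fb : germ_sieve b U f),
  germ_fam a U (exist _ f fa) = germ_fam b U (exist _ f fb).
have Wcl U V (g : Hom V U) (f : yoneda X U) : W U f -> W V (pact (yoneda X) g f).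
  move=> [fa [fb E]]; exists (sub_closed g fa), (sub_closed g fb).
  have Ha := pmap_nat (germ_fam a) g (exist _ f fa).
  have Hb := pmap_nat (germ_fam b) g (exist _ f fb).
  by rewrite /= in Ha Hb; rewrite Ha Hb E.
exists (Build_SubPsh Wcl) => //; apply: (cov_trans Sc) => U f /zz'.
rewrite /= !quot_mapE => E0; have [R Rc RW] := germ_relE (class_eq E0).
by apply: (covering_sub Rc) => V g /RW [ga [gb E]]; exists ga, gb.
Qed.

Definition const_germ P X (x : P X) : germ P X.
Proof.
exists (max_sieve X); first exact: cov_max.
exists (fun U f => pact P (proj1_sig f) x) => U V g [f Sf] /=; exact: pactM.
Defined.

Definition plus_unit P : PshMap P (plus P).
Proof.
exists (fun X x => class (@germ_rel C P X) (const_germ x)) => X Y g x.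
rewrite /= quot_mapE; apply: germ_eq => U f fa; exists I => /=.
by rewrite pactM.
Defined.

Lemma plus_unit_inj P : loc_inj (plus_unit P).
Proof.
move=> X x x' E; have [R Rc RE] := germ_relE (class_eq E).
by exists R => // U f Rf; have [? [? E']] := RE U f Rf.
Qed.

Lemma plus_unit_germ P X (a : germ P X) U (f : yoneda X U) (fa : germ_sieve a U f) :
  pact (plus P) f (class (@germ_rel C P X) a) =
  plus_unit P U (germ_fam a U (exist _ f fa)).
Proof.
rewrite /= quot_mapE; apply: germ_eq => V g ga; exists I => /=.
rewrite -pmap_nat; congr (germ_fam a V _); exact: sig_eq.
Qed.

Lemma plus_unit_surj P : loc_surj (plus_unit P).
Proof.
move=> X; apply: quotW => a; exists (germ_sieve a) => [|U f fa]; first exact: germ_cov.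
by exists (germ_fam a U (exist _ f fa)); rewrite plus_unit_germ.
Qed.

Lemma plus_unit_nat P Q (f : PshMap P Q) X x :
  plus_map f X (plus_unit P X x) = plus_unit Q X (f X x).
Proof.
rewrite /= quot_mapE; apply: germ_eq => U g ga; exists I => /=.
exact: pmap_nat.
Qed.

Lemma loc_inj_comp P Q R (f : PshMap P Q) (g : PshMap Q R) :
  loc_inj f -> loc_inj g -> loc_inj (pcomp g f).
Proof.
move=> fi gi X x x' /gi h; apply: (locally_bind h) => U k.
rewrite -!pmap_nat => /fi; apply: locally_mono => V l; by rewrite !pactM.
Qed.

Lemma loc_surj_comp P Q R (f : PshMap P Q) (g : PshMap Q R) :
  loc_surj f -> loc_surj g -> loc_surj (pcomp g f).
Proof.
move=> fs gs X z; apply: (locally_bind (gs X z)) => U k [y E].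
apply: (locally_mono _ (fs U y)) => V l [x Ex]; exists x => /=.
by rewrite Ex pmap_nat E pactM.
Qed.

Definition sh_unit P : PshMap P (sheafify P) := pcomp (plus_unit (plus P)) (plus_unit P).

Lemma sh_unit_inj P : loc_inj (sh_unit P).
Proof. by apply: loc_inj_comp; exact: plus_unit_inj. Qed.

Lemma sh_unit_surj P : loc_surj (sh_unit P).
Proof. by apply: loc_surj_comp; exact: plus_unit_surj. Qed.

Lemma sh_unit_nat P Q (f : PshMap P Q) X x :
  sheafify_map f X (sh_unit P X x) = sh_unit Q X (f X x).
Proof. by rewrite /sheafify_map /sh_unit [LHS]plus_unit_nat plus_unit_nat. Qed.

Lemma is_iso_bij P Q (f : PshMap P Q) :
  is_iso f <-> (forall X x x', f X x = f X x' -> x = x') /\ forall X y, exists x, f X x = y.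
Proof.
split=> [[g [gf fg]]|[inj surj]].
- have gfE X x : g X (f X x) = x by rewrite -[RHS](congr1 (fun a : PshMap _ _ => a X x) gf).
  have fgE X y : f X (g X y) = y by rewrite -[RHS](congr1 (fun a : PshMap _ _ => a X y) fg).
  by split=> [X x x' E|X y]; [rewrite -(gfE X x) E gfE | exists (g X y)].
- pose g X y := projT1 (cid (surj X y)).
  have fgE X y : f X (g X y) = y by rewrite /g; case: cid.
  have gN X Y (h : Hom Y X) y : g Y (pact Q h y) = pact P h (g X y).
    by apply: inj; rewrite pmap_nat !fgE.
  exists (Build_PshMap gN); split; apply: PshMap_eq => X x /=; last exact: fgE.
  by apply: inj; rewrite fgE.
Qed.

(** Gluing in the sheafification, with the matching family described by a predicate whose uniqueness
    forces compatibility. The local sections are first lifted to [plus P]; this presheaf is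
    separated, so the chosen lifts are compatible and form a germ. *)
Lemma sheafify_glue P X (phi : forall U, Hom U X -> sheafify P U -> Prop) :
  (forall U f z z', phi U f z -> phi U f z' -> z = z') ->
  (forall U f z, phi U f z -> forall V (g : Hom V U),
     phi V (f ∘ g) (pact (sheafify P) g z)) ->
  locally (fun U f => exists z, phi U f z) ->
  exists z, locally (fun U f => phi U f (pact (sheafify P) f z)).
Proof.
move=> uniq stab phil.
pose u := plus_unit (plus P).
have {phil} [S Sc Sphi] : locally (fun U f => exists w, phi U f (u U w)).
  apply: (locally_bind phil) => U f [z zP].
  apply: (locally_mono _ (plus_unit_surj z)) => V g [w E].
  by exists w; rewrite /u E; exact: stab.
have uinj U w w' : u U w = u U w' -> w = w'.
  by move/plus_unit_inj/plus_separated.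
pose fam U (f : sub_psh S U) := projT1 (cid (Sphi U _ (proj2_sig f))).
have famP U f : phi U (proj1_sig f) (u U (fam U f)) by rewrite /fam; case: cid.
have famN U V (g : Hom V U) f : fam V (pact (sub_psh S) g f) = pact (plus P) g (fam U f).
  apply: uinj; apply: uniq (famP V _) _; rewrite pmap_nat; exact: stab.
exists (class (@germ_rel C (plus P) X) (Build_germ Sc (Build_PshMap famN))).
exists S => // U f Sf.
have -> := @plus_unit_germ _ _ (Build_germ Sc (Build_PshMap famN)) U f Sf.
exact: (famP U (exist _ f Sf)).
Qed.

(** The unit of sheafification is itself locally injective and locally surjective, so local
    statements pass through it in both directions. Local preimages of a section glue because
    injectivity makes them unique. *)
Lemma iso_on_sheafificationP P Q (f : PshMap P Q) :
  iso_on_sheafification f <-> loc_inj f /\ loc_surj f.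
Proof.
split=> [/is_iso_bij [inj surj]|[fi fs]].
- split=> [X x x' E|X y].
    by apply/sh_unit_inj/inj; rewrite !sh_unit_nat E.
  have [z Ez] := surj X (sh_unit Q X y).
  apply: (locally_bind (sh_unit_surj z)) => U g [x Ex].
  have /sh_unit_inj : sh_unit Q U (f U x) = sh_unit Q U (pact Q g y).
    by rewrite -sh_unit_nat Ex !pmap_nat Ez.
  apply: locally_mono => V h E; exists (pact P h x).
  by rewrite pmap_nat E -pactM.
- have inj X (z z' : sheafify P X) : sheafify_map f X z = sheafify_map f X z' -> z = z'.
    move=> E; apply: plus_separated.
    apply: (locally_bind (sh_unit_surj z)) => U g [x Ex].
    apply: (locally_bind (locally_pull g (sh_unit_surj z'))) => V h [x' Ex'].
    have /sh_unit_inj l : sh_unit Q V (f V (pact P h x)) = sh_unit Q V (f V x').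
      by rewrite -!sh_unit_nat pmap_nat Ex Ex' !pmap_nat E -pactM.
    apply: (locally_bind l) => W k; rewrite -!pmap_nat => /fi.
    apply: locally_mono => T t E'; move/(congr1 (sh_unit P T)): E'.
    by rewrite !(pmap_nat (sh_unit P)) Ex Ex' -!pactM !hcompA.
  apply/is_iso_bij; split=> // X z.
  pose phi U (g : Hom U X) w := sheafify_map f U w = pact (sheafify Q) g z.
  have [|||w wP] := @sheafify_glue P X phi.
  + by move=> U g w w' E E'; apply: inj; rewrite E E'.
  + by move=> U g w E V h; rewrite /phi pmap_nat E pactM.
  + apply: (locally_bind (sh_unit_surj z)) => U g [y Ey].
    apply: (locally_mono _ (fs U y)) => V h [x Ex].
    exists (sh_unit P V x); rewrite /phi sh_unit_nat Ex pmap_nat Ey.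
    by rewrite -pactM.
  + exists w; apply: plus_separated; apply: (locally_mono _ wP) => U g.
    by rewrite /phi pmap_nat.
Qed.

End Sheafification.

(** * Subcomplexes of nerves of finite posets *)

Section PartialMaps.
Variable C : Category.
Implicit Types P K : Psh C.

(** Maps are built from their graphs: well-definedness on overlaps and independence of
    representatives both become functionality of [R]. *)
Lemma mk_map P K (S : SubPsh P) (R : forall U, P U -> K U -> Prop) :
  (forall U x, S U x -> exists k, R U x k) ->
  (forall U x k k', R U x k -> R U x k' -> k = k') ->
  (forall U V (f : Hom V U) x k, R U x k -> R V (pact P f x) (pact K f k)) ->
  exists g : PshMap (sub_psh S) K, forall U x h, R U x (g U (exist _ x h)).
Proof.
move=> tot fct nat.
pose g U (x : sub_psh S U) := projT1 (cid (tot U _ (proj2_sig x))).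
have gP U x : R U (proj1_sig x) (g U x) by rewrite /g; case: cid.
have gN U V (f : Hom V U) x : g V (pact (sub_psh S) f x) = pact K f (g U x).
  by apply: fct (gP _ _) _; exact: nat.
by exists (Build_PshMap gN) => U x h; exact: (gP U (exist _ x h)).
Qed.

Lemma sub_app P K (S : SubPsh P) (f : PshMap (sub_psh S) K) U (x x' : P U) h h' :
  x = x' -> f U (exist _ x h) = f U (exist _ x' h').
Proof. by move=> E; congr (f U _); exact: sig_eq. Qed.

Lemma sub_nat P K (S : SubPsh P) (f : PshMap (sub_psh S) K) U V (g : Hom V U) x h h' :
  f V (exist _ (pact P g x) h') = pact K g (f U (exist _ x h)).
Proof. by rewrite -pmap_nat; exact: sub_app. Qed.

Lemma glue P K (I : Type) (S : I -> SubPsh P)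
    (f : forall i, PshMap (sub_psh (S i)) K) (T : SubPsh P) :
  (forall U x, T U x -> exists i, S i U x) ->
  (forall i j U x hi hj, f i U (exist _ x hi) = f j U (exist _ x hj)) ->
  exists g : PshMap (sub_psh T) K,
    forall i U x hi ht, g U (exist _ x ht) = f i U (exist _ x hi).
Proof.
move=> cov agr.
pose R U (x : P U) k := exists i (hi : S i U x), f i U (exist _ x hi) = k.
have [|||g gP] := @mk_map P K T R.
- by move=> U x /cov [i hi]; exists (f i U (exist _ x hi)), i, hi.
- by move=> U x k k' [i [hi <-]] [j [hj <-]].
- move=> U V h x k [i [hi <-]]; exists i, (sub_closed h hi); exact: sub_nat.
- exists g => i U x hi ht; have [j [hj <-]] := gP U x ht; exact: agr.
Qed.

Definition sub_total P (T : SubPsh P) (h : forall U x, T U x) : PshMap P (sub_psh T).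
Proof.
exists (fun U x => exist _ x (h U x)) => U V f x; exact: sig_eq.
Defined.

End PartialMaps.

Section Complexes.
Variables (d : Order.disp_t) (P : finPOrderType d).

(* A simplicial subset of the nerve of P, given by the chains it contains; the
   value on sets that are not chains is irrelevant. *)
Record cplx := Cplx {
  face :> pred {set P};
  face0 : face set0;
  face_sub : forall A B : {set P}, A \subset B -> face B -> face A }.

Definition im m (x : nerve P m) : {set P} := x @: setT.

Lemma im_pact m n (f : @Hom Delta n m) (x : nerve P m) :
  im (pact (nerve P) f x) = x @: (f @: setT).
Proof. by rewrite /im -imset_comp; apply: eq_imset => i. Qed.

Lemma im_pact_sub m n (f : @Hom Delta n m) (x : nerve P m) :
  im (pact (nerve P) f x) \subset im x.
Proof. by rewrite im_pact; apply: imsetS; exact: subsetT. Qed.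

Lemma mem_im m (x : nerve P m) i : x i \in im x.
Proof. exact: imset_f. Qed.

Definition sub (D : cplx) : SubPsh (nerve P).
Proof.
exists (fun m x => D (im x)) => U V f x; apply: face_sub; exact: im_pact_sub.
Defined.

Definition full : cplx.
Proof. by exists predT. Defined.

Lemma full_mem m (x : nerve P m) : sub full m x.
Proof. by []. Qed.

Definition pow (c : {set P}) : cplx.
Proof.
exists (fun A : {set P} => A \subset c) => [|A B AB]; [exact: sub0set | exact: subset_trans].
Defined.

Definition cplxU (D E : cplx) : cplx.
Proof.
exists (fun A : {set P} => D A || E A) => [|A B AB /orP[DB|EB]]; rewrite ?face0 //.
- by rewrite (face_sub AB DB).
- by rewrite (face_sub AB EB) orbT.
Defined.

Definition is_chain (c : {set P}) := [forall x in c, forall y in c, (x >=< y)%O].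

Lemma is_chainP (c : {set P}) : reflect {in c &, forall x y, (x >=< y)%O} (is_chain c).
Proof.
apply: (iffP forall_inP) => [h x y xc yc|h x xc].
- exact: (forall_inP (h x xc) y yc).
- by apply/forall_inP => y yc; exact: h.
Qed.

Lemma is_chainS (A B : {set P}) : A \subset B -> is_chain B -> is_chain A.
Proof.
move=> AB /is_chainP h; apply/is_chainP => x y xA yA.
by apply: h; exact: (subsetP AB).
Qed.

Lemma is_chainU1 v (A : {set P}) :
  is_chain A -> {in A, forall x, (x >=< v)%O} -> is_chain (v |: A).
Proof.
move=> /is_chainP Ac h; apply/is_chainP => x y.
rewrite !inE => /orP[/eqP->|xA] /orP[/eqP->|yA] //; first exact: comparablexx.
- by rewrite comparable_sym h.
- exact: h.
- exact: Ac.
Qed.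

Lemma im_chain m (x : nerve P m) : is_chain (im x).
Proof.
apply/is_chainP => _ _ /imsetP[i _ ->] /imsetP[j _ ->].
rewrite /Order.comparable; case/orP: (leq_total i j) => ij.
- by rewrite (omorph_le x).
- by rewrite [X in _ || X](omorph_le x) ?orbT.
Qed.

Lemma im_neq0 m (x : nerve P m) : im x != set0.
Proof. by apply/set0Pn; exists (x ord0); exact: mem_im. Qed.

Lemma chain_simplex (c : {set P}) : is_chain c -> c != set0 ->
  exists r (x : nerve P r), injective x /\ im x = c.
Proof.
move=> /is_chainP cc /set0Pn[x0 x0c].
pose s := sort <=%O (enum c).
have ss : size s = #|c|.-1.+1.
  by rewrite size_sort -cardE prednK //; apply/card_gt0P; exists x0.
have s_sorted : sorted <=%O s.
  apply: (@sort_sorted_in _ (mem c)) => [x y xc yc|]; first exact: cc.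
  by apply/allP => x; rewrite mem_enum.
have nth_le : {homo (fun i : 'I_#|c|.-1.+1 => nth x0 s i) : i j / (i <= j)%O}.
  move=> i j ij; apply: (sorted_leq_nth le_trans le_refl) => //.
  - by rewrite inE ss.
  - by rewrite inE ss.
exists #|c|.-1, (omorph_mk nth_le); split.
- move=> i j /= /eqP; rewrite nth_uniq ?ss // ?sort_uniq ?enum_uniq //.
  by move=> /eqP /val_inj.
- apply/setP => y; apply/imsetP/idP => [[i _ ->]|yc].
  + by rewrite /= -mem_enum -(mem_sort <=%O) mem_nth // ss.
  + have ys : y \in s by rewrite mem_sort mem_enum.
    have yi : index y s < #|c|.-1.+1 by rewrite -ss index_mem.
    by exists (Ordinal yi) => //=; rewrite nth_index.
Qed.

Lemma simplex_mono m (x : nerve P m) : injective x -> {mono x : i j / (i <= j)%O}.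
Proof.
move=> xi i j; apply/idP/idP => [xij|ij]; last exact: omorph_le.
case: (leqP i j) => // ji.
have xji : (x j <= x i)%O by apply: omorph_le; exact: ltnW.
have /xi E : x i = x j by apply/le_anti/andP.
by rewrite E ltnn in ji.
Qed.

Lemma nerve_factor m r (x : nerve P r) (y : nerve P m) : injective x ->
  im y \subset im x -> exists g : @Hom Delta m r, pact (nerve P) g x = y.
Proof.
move=> xi /subsetP yx.
have h (i : 'I_m.+1) : exists j, x j == y i.
  by have /imsetP[j _ ->] := yx _ (mem_im y i); exists j.
pose g i := xchoose (h i).
have gP i : x (g i) = y i by apply/eqP; exact: (xchooseP (h i)).
have g_le : {homo g : i j / (i <= j)%O}.
  by move=> i j ij; rewrite -(simplex_mono xi) !gP omorph_le.
exists (omorph_mk g_le); apply: omorph_eq => i; exact: gP.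
Qed.

Lemma simplex_pact_inj m r (x : nerve P r) (g g' : @Hom Delta m r) : injective x ->
  pact (nerve P) g x = pact (nerve P) g' x -> g = g'.
Proof.
move=> xi E; apply: omorph_eq => i; apply: xi.
exact: (congr1 (fun z : {omorphism _ -> _} => z i) E).
Qed.

Lemma attach (D D' : cplx) r (x : nerve P r) (K : sSet)
    (a : sMap (sub_psh (sub D)) K) (b : K r) : injective x ->
  (forall A : {set P}, D' A -> D A || (A \subset im x)) ->
  (forall m (g : @Hom Delta m r) h, a m (exist _ (pact (nerve P) g x) h) = pact K g b) ->
  exists a' : sMap (sub_psh (sub D')) K,
    (forall m y h h', a' m (exist _ y h') = a m (exist _ y h)) /\
    (forall m (g : @Hom Delta m r) h', a' m (exist _ (pact (nerve P) g x) h') = pact K g b).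
Proof.
move=> xi D'D ab.
pose R m (y : nerve P m) (k : K m) :=
  (exists h, a m (exist _ y h) = k) \/
  (exists2 g : @Hom Delta m r, pact (nerve P) g x = y & pact K g b = k).
have [|||a' a'P] := @mk_map Delta (nerve P) K (sub D') R.
- move=> m y /D'D /orP[h|/(nerve_factor xi) [g E]].
  + by exists (a m (exist _ y h)); left; exists h.
  + by exists (pact K g b); right; exists g.
- move=> m y k k' [[h <-]|[g E <-]] [[h' <-]|[g' E' <-]].
  + exact: sub_app.
  + by subst y.
  + by subst y.
  + by rewrite -E' in E; rewrite (simplex_pact_inj xi E).
- move=> m n f y k [[h <-]|[g E <-]].
  + by left; exists (sub_closed f h); exact: sub_nat.
  + by right; exists (g ∘ f); rewrite pactM // E.
- exists a'; split=> [m y h h'|m g h'].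
  + have [[h0 <-]|[g E <-]] := a'P m y h'; first exact: sub_app.
    by subst y; rewrite ab.
  + have [[h0 <-]|[g' E <-]] := a'P _ _ h'; first exact: ab.
    by rewrite (simplex_pact_inj xi E).
Qed.

End Complexes.

Arguments full {d P}.

Definition bd n : cplx 'I_n.+1.
Proof.
exists (fun A : {set 'I_n.+1} => A != setT) => [|A B AB].
- by apply/eqP => /setP /(_ ord0); rewrite !inE.
- by apply: contra => /eqP AT; rewrite AT in AB; rewrite -subTset.
Defined.

(* The empty set is added to make hn a complex also when n = 0; it is never the
   image of a simplex. *)
Definition hn n (k : 'I_n.+1) : cplx 'I_n.+1.
Proof.
exists (fun A : {set 'I_n.+1} => (A == set0) || [exists j, (j != k) && (j \notin A)]).
- by rewrite eqxx.
- move=> A B AB /orP[/eqP B0|/existsP[j /andP[jk jB]]].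
  + by rewrite B0 subset0 in AB; rewrite AB.
  + apply/orP; right; apply/existsP; exists j; rewrite jk /=.
    by apply: contra jB; exact: (subsetP AB).
Defined.

Lemma bd_sub n : sub (bd n) = boundary n.
Proof.
apply: SubPsh_eq => m x /=; rewrite -subTset; split.
- by move/subsetPn => [j _ jx]; exists j => i; apply: contra jx => /eqP <-; exact: mem_im.
- move=> [j jx]; apply/subsetPn; exists j => //.
  by apply/imsetP => -[i _ E]; have := jx i; rewrite E eqxx.
Qed.

Lemma hn_sub n (k : 'I_n.+1) : sub (hn k) = horn k.
Proof.
apply: SubPsh_eq => m x /=; rewrite (negbTE (im_neq0 _)) /=; split.
- move=> /existsP[j /andP[jk jx]]; exists j => // i.
  by apply: contra jx => /eqP <-; exact: mem_im.
- move=> [j jk jx]; apply/existsP; exists j; rewrite jk /=.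
  by apply/imsetP => -[i _ E]; have := jx i; rewrite E eqxx.
Qed.

(** * Local liftings, boundaries and horns *)

Section LocalLifting.
Variables (C : Site) (F G : SPsh C) (p : SPshMap F G).

(* [lifts_locally] for the inclusion of sub S in sub T, with maps out of a tensor
   product rewritten as maps into the values of F and G. *)
Definition LL d (P : finPOrderType d) (S T : cplx P) : Prop :=
  forall (X : C) (a : sMap (sub_psh (sub S)) (F X)) (b : sMap (sub_psh (sub T)) (G X)),
    (forall m x hs ht, p X m (a m (exist _ x hs)) = b m (exist _ x ht)) ->
    locally (fun U (f : Hom U X) => exists l : sMap (sub_psh (sub T)) (F U),
      (forall m x hs ht, l m (exist _ x ht) = spact F f m (a m (exist _ x hs))) /\
      (forall m y, p U m (l m y) = spact G f m (b m y))).

Lemma spmap_act U V (f : Hom V U) m x : p V m (spact F f m x) = spact G f m (p U m x).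
Proof. exact: (congr1 (fun c : sMap (F U) (G V) => c m x) (spmap_nat p f)). Qed.

Lemma spactMx (H : SPsh C) U V W (f : Hom V U) (g : Hom W V) m x :
  spact H (f ∘ g) m x = spact H g m (spact H f m x).
Proof. by rewrite spactM. Qed.

Variables (d : Order.disp_t) (P : finPOrderType d).
Implicit Types S T W : cplx P.

(** Images of simplices are nonempty chains, so [S] and [T] have the same simplices. *)
Lemma LL_same S T : (forall A, S A -> T A) ->
  (forall A : {set P}, is_chain A -> A != set0 -> T A -> S A) -> LL S T.
Proof.
move=> ST TS X a b ab; apply: locallyT => U f.
have TS' m (x : nerve P m) : sub T m x -> sub S m x.
  by apply: TS; [exact: im_chain | exact: im_neq0].
have lN n m (g : @Hom Delta m n) (y : sub_psh (sub T) n) :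
  spact F f m (a m (exist _ _ (TS' m _ (proj2_sig (pact (sub_psh (sub T)) g y))))) =
  pact (F U) g (spact F f n (a n (exist _ _ (TS' n _ (proj2_sig y))))).
  by rewrite -!pmap_nat; congr (spact F f m _); exact: sub_app.
exists (Build_PshMap lN); split=> [m x hs ht|m [x ht]] /=.
  by congr (spact F f m _); exact: sub_app.
by rewrite spmap_act; congr (spact G f m _); exact: ab.
Qed.

Definition sub_incl2 S T (ST : forall A, S A -> T A) : sMap (sub_psh (sub S)) (sub_psh (sub T)).
Proof.
exists (fun m x => exist _ (proj1_sig x) (ST _ (proj2_sig x))) => m n f x.
exact: sig_eq.
Defined.

Lemma LL_trans S T W : (forall A, S A -> T A) -> (forall A, T A -> W A) ->
  LL S T -> LL T W -> LL S W.
Proof.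
move=> ST TW llS llT X a b ab.
have [|Z Zc ZP] := llS X a (pcomp b (sub_incl2 TW)).
  by move=> m x hs ht; exact: ab.
apply: (@locally_bind _ _ _ _ (ex_intro2 _ _ Z Zc ZP)) => U f [l [l1 l2]].
have [|Z' Z'c Z'P] := llT U l (pcomp (spact G f) b).
  move=> m x hs ht; rewrite l2 /=; congr (spact G f m _); exact: sub_app.
exists Z' => // V g /Z'P [l' [l'1 l'2]]; exists l'; split=> [m x hs ht|m y].
- by rewrite (l'1 _ _ (ST _ hs)) (l1 _ _ hs) spactMx.
- by rewrite l'2 spactMx.
Qed.

(** Up to sets that are not chains, [S] -> [T] is a pushout of [E] -> Delta^r along [x]. The square
    is pulled back along [x], lifted there, and the lift is glued to the given map by [attach]. *)
Lemma LL_attach r (x : nerve P r) (E : cplx 'I_r.+1) S T : LL E full -> injective x ->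
  (forall A, S A -> T A) -> T (im x) ->
  (forall A : {set P}, T A -> S A || (A \subset im x)) ->
  (forall B : {set 'I_r.+1}, B != set0 -> S (x @: B) = E B) -> LL S T.
Proof.
move=> llE xi ST Tx TSx SE X a b ab.
have ES m (g : nerve 'I_r.+1 m) : sub S m (pact (nerve P) g x) <-> sub E m g.
  by rewrite /= im_pact SE ?im_neq0.
have Tg m (g : nerve 'I_r.+1 m) : sub T m (pact (nerve P) g x).
  by apply: face_sub Tx; exact: im_pact_sub.
pose a0 m (g : sub_psh (sub E) m) : F X m :=
  a m (exist _ (pact (nerve P) (proj1_sig g) x) ((ES m _).2 (proj2_sig g))).
have a0N n m (f : @Hom Delta m n) g : a0 m (pact (sub_psh (sub E)) f g) = pact (F X) f (a0 n g).
  by rewrite /a0 -pmap_nat; apply: sub_app; rewrite -pactM.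
pose b0 m (g : sub_psh (sub full) m) : G X m :=
  b m (exist _ (pact (nerve P) (proj1_sig g) x) (Tg m _)).
have b0N n m (f : @Hom Delta m n) g :
    b0 m (pact (sub_psh (sub full)) f g) = pact (G X) f (b0 n g).
  by rewrite /b0 -pmap_nat; apply: sub_app; rewrite -pactM.
have [|Z Zc ZP] := llE X (Build_PshMap a0N) (Build_PshMap b0N).
  by move=> m g hs ht; exact: ab.
exists Z => // U f /ZP [l [l1 l2]].
pose e : F U r := l r (exist _ (hid r : nerve 'I_r.+1 r) (full_mem _)).
have le m (g : @Hom Delta m r) : pact (F U) g e = l m (exist _ g (full_mem _)).
  by rewrite -pmap_nat; apply: sub_app; exact: (@hcomp1r Delta).
have [|l' [l'1 l'2]] := @attach _ P S T r x (F U) (pcomp (spact F f) a) e xi TSx.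
  move=> m g h; rewrite le (l1 _ _ ((ES m g).1 h)) /=.
  by congr (spact F f m _); exact: sub_app.
exists l'; split=> [m y hs ht|m [y ht]]; first by rewrite (l'1 _ _ hs).
case/orP: (TSx _ ht) => [hs|yx].
- by rewrite (l'1 _ _ hs) spmap_act; congr (spact G f m _); exact: ab.
- have [g E'] := nerve_factor xi yx; subst y.
  rewrite l'2 le l2 /=; congr (spact G f m _); exact: sub_app.
Qed.

End LocalLifting.

(** * Inclusions built from boundaries, or from horns by an acyclic matching *)

Section Cells.
Variables (C : Site) (F G : SPsh C) (p : SPshMap F G).
Variables (d : Order.disp_t) (P : finPOrderType d).
Implicit Types S T : cplx P.

Definition missing S T : {set {set P}} := [set A : {set P} | [&& is_chain A, T A & ~~ S A]].

Lemma missing0 S T : (forall A, S A -> T A) -> missing S T = set0 -> LL p S T.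
Proof.
move=> ST E; apply: LL_same => // A Ac _ TA; apply: contraT => SA.
by have : A \in missing S T; [rewrite inE Ac TA | rewrite E inE].
Qed.

Lemma missing_face0 S A : ~~ S A -> A != set0.
Proof. by apply: contraNneq => ->; exact: face0. Qed.

Lemma missing_pow S T A : A \in missing S T ->
  #|missing (cplxU S (pow A)) T| < #|missing S T|.
Proof.
move=> AM; apply: proper_card; apply/properP; split.
- apply/subsetP => B; rewrite !inE => /and3P[-> ->].
  by rewrite negb_or => /andP[].
- by exists A => //; rewrite inE /= subxx orbT /= !andbF.
Qed.

(** A missing chain of least size has all its proper faces in [S], so it is attached along its whole
    boundary; induction on the number of missing chains does the rest. *)
Lemma LL_cells S T : (forall n, LL p (bd n) full) -> (forall A, S A -> T A) -> LL p S T.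
Proof.
move=> llb; have [n] := ubnP #|missing S T|; elim: n S => // n IH S Mn ST.
have [M0|/set0Pn[A0 A0M]] := eqVneq (missing S T) set0; first exact: missing0.
pose A := [arg min_(B < A0 in missing S T) #|B|].
have [AM Amin] : A \in missing S T /\ forall B, B \in missing S T -> #|A| <= #|B|.
  by rewrite /A; case: arg_minnP.
have /and3P[Ac TA SA] : [&& is_chain A, T A & ~~ S A] by rewrite inE in AM.
have [r [x [xi xA]]] := chain_simplex Ac (missing_face0 SA).
pose S' := cplxU S (pow A).
have S'T (B : {set P}) : S' B -> T B.
  by move=> /orP[/ST //|BA]; exact: face_sub BA TA.
apply: (@LL_trans _ _ _ _ _ _ S S' T) => //.
- by move=> B SB; apply/orP; left.
- apply: (LL_attach (llb r) xi).
  + by move=> B SB; apply/orP; left.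
  + by rewrite xA; apply/orP; right; exact: subxx.
  + by rewrite xA.
  + move=> B B0 /=; have [->|BT] := eqVneq B setT.
      by rewrite [x @: _]xA (negbTE SA).
    have xBA : x @: B \proper A.
      rewrite -xA properEcard imsetS ?subsetT // !card_imset //.
      by apply: proper_card; rewrite properT.
    apply: contraLR (proper_card xBA); rewrite -leqNgt => SB; apply: Amin.
    have xBs := proper_sub xBA.
    by rewrite inE SB (is_chainS xBs Ac) (face_sub xBs TA).
- by apply: IH => //; exact: leq_trans (missing_pow AM) Mn.
Qed.

(* The chains of T outside S are matched by toggling the vertex v c; the pairs
   are attached one at a time as horns, by increasing rho and then size. *)
Lemma LL_matching S T (v : {set P} -> P) (rho : {set P} -> nat) :
  (forall n k, 0 < n -> LL p (@hn n k) full) -> (forall A, S A -> T A) ->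
  (forall c, c \in missing S T ->
     [/\ v c |: c \in missing S T, c :\ v c \in missing S T,
         v (v c |: c) = v c /\ v (c :\ v c) = v c,
         rho (v c |: c) = rho c
       & forall w, w \in c -> w != v c -> v c \in c -> ~~ S (c :\ w) ->
           rho (c :\ w) < rho c \/ rho (c :\ w) = rho c /\ v (c :\ w) = v c]) ->
  LL p S T.
Proof.
move=> llh ST0 H.
have MP A : A \in missing S T -> [/\ is_chain A, T A & ~~ S A].
  by rewrite inE => /and3P[].
(* The induction runs over intermediate complexes [S'] that contain both or neither member of each
   matched pair. *)
suff: forall n (S' : cplx P), #|missing S' T| < n -> (forall A, S A -> S' A) ->
    (forall A, S' A -> T A) ->
    (forall c, c \in missing S T -> S' (v c |: c) = S' (c :\ v c)) -> LL p S' T.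
  apply=> // c /H [/MP[_ _ /negbTE->] /MP[_ _ /negbTE->]] //.
elim=> // n IH S' Mn SS' S'T good.
have [M0|/set0Pn[A0 A0M]] := eqVneq (missing S' T) set0; first exact: missing0.
(* Lexicographic order on [rho] and the size of the lower member of the pair, which is at most
   [#|P|]. *)
pose rk (c : {set P}) := rho c * #|P|.+1 + #|c :\ v c|.
pose c := [arg min_(B < A0 in missing S' T) rk B].
have [cM' cmin] : c \in missing S' T /\ forall B, B \in missing S' T -> rk c <= rk B.
  by rewrite /c; case: arg_minnP.
have M'M A : A \in missing S' T -> A \in missing S T.
  by rewrite !inE => /and3P[-> -> /=]; apply: contra => /SS'.
have cM := M'M _ cM'.
have [eM dM [ve vd] rhoe _] := H _ cM.
set e := v c |: c in eM ve rhoe; set w0 := v c in vd.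
have w0e : w0 \in e by rewrite setU11.
have dE : e :\ w0 = c :\ v c by rewrite /e setDUl setDv set0U.
have ce : c \subset e by exact: subsetUr.
have ge : S' e = S' (e :\ w0) by rewrite dE; exact: good.
clearbody e.
have eS' : ~~ S' e.
  move: cM'; rewrite inE => /and3P[_ _]; apply: contra; exact: face_sub.
have dS' : ~~ S' (e :\ w0) by rewrite -ge.
have [ec Te _] := MP _ eM.
have [r [x [xi xe]]] := chain_simplex ec (missing_face0 eS').
have [k xk] : exists k, x k = w0.
  by move: w0e; rewrite -xe => /imsetP[k _ E]; exists k.
have rke : rk e = rk c by rewrite /rk rhoe ve dE.
(* By minimality of the rank: were this face missing, the acyclicity hypothesis would make its rank
   smaller. *)
have other w : w \in e -> w != w0 -> S' (e :\ w).
  move=> we ww0; apply: contraT => wS'.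
  have wM' : e :\ w \in missing S' T.
    by rewrite inE wS' (is_chainS (subD1set _ _) ec) (face_sub (subD1set _ _) Te).
  have [_ _ _ _ /(_ w we)] := H _ eM; rewrite ve => /(_ ww0 w0e).
  have [_ _ wS] := MP _ (M'M _ wM'); move=> /(_ wS) lt.
  have := cmin _ wM'; rewrite leqNgt -rke /rk ve => /negP; case.
  case: lt => [lt|[-> ->]].
  - apply: (@leq_trans ((rho (e :\ w)).+1 * #|P|.+1)).
      by rewrite mulSn [X in X < _]addnC ltn_add2r ltnS max_card.
    by apply: leq_trans (leq_addr _ _); rewrite leq_mul2r lt orbT.
  - rewrite ltn_add2l; apply: proper_card; apply/properP; split.
      by apply: setSD; exact: subD1set.
    by exists w; [rewrite in_setD1 ww0 we | rewrite !in_setD1 eqxx andbF].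
(* Hence [e] and [e :\ w0] are the only faces of [e] outside [S']: [e] is attached along the horn at
   [w0]. *)
have below (A : {set P}) : A \subset e -> ~~ S' A -> e :\ w0 \subset A.
  move=> Ae AS'; apply/subsetP => w /[!inE]/andP[ww0 we]; apply: contraR AS' => wA.
  apply: (face_sub _ (other _ we ww0)); apply/subsetP => u uA.
  by rewrite !inE (subsetP Ae) // andbT; apply: contraNneq wA => <-.
have r_gt0 : 0 < r.
  rewrite lt0n; apply/eqP => r0; have /set0Pn[w] := missing_face0 dS'.
  rewrite -xe => /setD1P[ww0 /imsetP[j _ E]]; move: ww0; rewrite E -xk.
  case/eqP; congr (x _); apply: val_inj => /=.
  have r0E (i : 'I_r.+1) : i = 0 :> nat.
    by apply/eqP; rewrite -leqn0 -[X in _ <= X]r0 leq_ord.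
  by rewrite !r0E.
pose S'' := cplxU S' (pow e).
have S''T A : S'' A -> T A by move=> /orP[/S'T //|Ae]; exact: face_sub Ae Te.
apply: (@LL_trans _ _ _ _ _ _ S' S'' T) => //.
- by move=> B SB; apply/orP; left.
- apply: (LL_attach (llh r k r_gt0) xi).
  + by move=> B SB; apply/orP; left.
  + by rewrite xe; apply/orP; right => /=.
  + by rewrite xe.
  + move=> B B0 /=; rewrite (negbTE B0) /=.
    apply/idP/existsP => [SB|[j /andP[jk jB]]].
    * have /subsetPn[w] : ~~ (e :\ w0 \subset x @: B).
        by apply: contra dS' => dB; exact: face_sub dB SB.
      rewrite -xe => /setD1P[ww0 /imsetP[j _ E]] wB; exists j; apply/andP; split.
        by apply: contra ww0 => /eqP jk; rewrite E jk xk.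
      by apply: contra wB => jB; rewrite E imset_f.
    * have xje : x j \in e by rewrite -xe mem_im.
      apply: (face_sub _ (other _ xje _)); last by rewrite -xk (inj_eq xi).
      apply/subsetP => _ /imsetP[i iB ->]; rewrite !inE (inj_eq xi).
      by rewrite -xe mem_im andbT; apply: contraNneq jB => <-.
(* The invariant survives: a pair whose lower member enters with [e] is the pair of [e] itself,
   because that member contains [e :\ w0]. *)
- apply: IH; last 1 first.
  + move=> c' c'M; clear ce; have [e'M d'M [ve' vd'] _ _] := H _ c'M.
    rewrite /S'' /= good //; case: (boolP (S' (c' :\ v c'))) => //= dS'1.
    apply/idP/idP => [|ce]; first exact: (subset_trans (subset_trans (subD1set _ _) (subsetUr _ _))).
    have := below _ ce dS'1.
    have [w0c|w0c] := boolP (w0 \in c' :\ v c').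
      have E : c' :\ v c' = e.
        apply/eqP; rewrite eqEsubset ce /=; apply/subsetP => u ue.
        have [->//|uw0] := eqVneq u w0.
        by apply: (subsetP (below _ ce dS'1)); rewrite !inE uw0.
      by move: w0c; rewrite -vd' E ve setD11.
    move=> de; have E : c' :\ v c' = e :\ w0.
      apply/eqP; rewrite eqEsubset de andbT; apply/subsetP => u uc.
      by rewrite !inE (subsetP ce) // andbT; apply: contraNneq w0c => <-.
    have vE : v c' = w0 by rewrite -vd' E dE vd.
    rewrite subUset sub1set vE w0e; apply/subsetP => u uc.
    have [->//|uw0] := eqVneq u w0.
    by apply: (subsetP ce); rewrite !inE vE uw0.
  + rewrite ltnS in Mn; apply: leq_trans Mn; apply: proper_card; apply/properP; split.
      apply/subsetP => A; rewrite !inE => /and3P[-> ->].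
      by rewrite negb_or => /andP[].
    exists c => //; rewrite inE /= ce orbT /= !andbF //.
  + by move=> A /SS' h; apply/orP; left.
  + exact: S''T.
Qed.

End Cells.

(** * Three anodyne inclusions *)

Section Prism.
Variable n : nat.
Local Notation prism := ('I_n.+1 *p 'I_2)%type.
Implicit Types (T K : cplx 'I_n.+1) (e : 'I_2) (A c : {set prism}).

Definition pr1 A : {set 'I_n.+1} := [set x.1 | x in A].

Definition cyl T : cplx prism.
Proof.
exists (fun A : {set prism} => T (pr1 A)) => [|A B AB].
- by rewrite /pr1 imset0 face0.
- by apply: face_sub; exact: imsetS.
Defined.

Definition base K e : cplx prism.
Proof.
exists (fun A : {set prism} => K (pr1 A) && [forall x in A, x.2 == e]) => [|A B AB].
- by rewrite /pr1 imset0 face0; apply/forall_inP => x; rewrite inE.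
- move=> /andP[KB /forall_inP h]; rewrite (face_sub (imsetS _ AB) KB).
  by apply/forall_inP => x /(subsetP AB); exact: h.
Defined.

(** In Delta^n x Delta^1, [cyl T] is T x Delta^1 and [base K e] is K x {e}; the box is their
    union. *)
Definition box T K e : cplx prism := cplxU (cyl T) (base K e).

(* Toggled vertex: (i c, e), where i c is the extremal index of c on the other
   level e'. *)
Lemma LL_prism_gen (C : Site) (F G : SPsh C) (p : SPshMap F G) T K e e' (i : {set prism} -> 'I_n.+1)
    (rho : 'I_n.+1 -> nat) :
  (forall n k, 0 < n -> LL p (@hn n k) full) -> (forall D : {set 'I_n.+1}, T D -> K D) ->
  (forall f : 'I_2, f = e \/ f = e') -> e != e' ->
  (forall A B : {set prism},
     (forall j, ((j, e') : prism) \in A = (((j, e') : prism) \in B)) -> i A = i B) ->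
  (forall c, is_chain c -> (exists j, ((j, e') : prism) \in c) ->
     ((i c, e') : prism) \in c /\ {in c, forall x, (x >=< ((i c, e) : prism))%O}) ->
  (forall c w, w \in c -> (exists j, ((j, e') : prism) \in c :\ w) ->
     rho (i (c :\ w)) < rho (i c) \/ i (c :\ w) = i c) ->
  LL p (box T K e) (cyl K).
Proof.
move=> llh TK ee' nee' iE iP ilt.
pose v c : prism := (i c, e).
have level c : (exists j, ((j, e') : prism) \in c) <-> ~~ [forall x in c, x.2 == e].
  split=> [[j jc]|/forall_inPn[[j f] jc /= fe]].
    by apply/forall_inPn; exists (j, e') => //=; rewrite eq_sym.
  by case: (ee' f) => E; [rewrite E eqxx in fe | exists j; rewrite -E].
have MP c : c \in missing (box T K e) (cyl K) <->
    [/\ is_chain c, K (pr1 c), ~~ T (pr1 c) & exists j, ((j, e') : prism) \in c].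
  rewrite inE /= negb_or negb_and; split.
    by move=> /and3P[cc Kc /andP[Tc]]; rewrite Kc => /level.
  by move=> [-> -> -> /level ->]; rewrite orbT.
apply: (@LL_matching _ _ _ p _ _ _ _ v (rho \o i) llh).
  by move=> A /orP[/TK //|/andP[]].
move=> c /MP[cc Kc Tc ce']; have [ic comp] := iP _ cc ce'.
have e'U j : ((j, e') : prism) \in v c |: c = (((j, e') : prism) \in c).
  by rewrite !inE xpair_eqE [e' == e]eq_sym (negbTE nee') andbF.
have e'D j : ((j, e') : prism) \in c :\ v c = (((j, e') : prism) \in c).
  by rewrite !inE xpair_eqE [e' == e]eq_sym (negbTE nee') andbF.
have icc : i c \in pr1 c by apply/imsetP; exists ((i c, e') : prism).
have prU : pr1 (v c |: c) = pr1 c.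
  by rewrite /pr1 imsetU1 /=; apply/setUidPr; rewrite sub1set.
have prD : pr1 (c :\ v c) = pr1 c.
  apply/eqP; rewrite eqEsubset imsetS ?subD1set //=.
  apply/subsetP => _ /imsetP[x xc ->]; have [->|xv] := eqVneq x (v c).
    by apply/imsetP; exists ((i c, e') : prism); rewrite ?e'D.
  by apply: imset_f; rewrite !inE xv.
split.
- apply/MP; rewrite prU; split=> //; first exact: is_chainU1.
  by exists (i c); rewrite e'U.
- apply/MP; rewrite prD; split=> //; first exact: (is_chainS (subD1set _ _)).
  by exists (i c); rewrite e'D.
- by rewrite /v (iE _ _ e'U) (iE _ _ e'D).
- by rewrite /= (iE _ _ e'U).
(* If [w] was the only vertex on level [e'], the remaining chain lies in the base and is not
   missing. Otherwise the extremal index moves, and [rho] drops, or it stays and so does the toggled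
   vertex. *)
- move=> w wc wv vc.
  case: (boolP (box T K e (c :\ w))) => // wS _.
  case: (pselect (exists j, ((j, e') : prism) \in c :\ w)) => [h|nh].
    by case: (ilt _ _ wc h) => [|E]; [left | right; rewrite /v /= E].
  case/negP: wS; apply/orP; right => /=.
  rewrite (face_sub (imsetS _ (subD1set _ _)) Kc) /=.
  by apply: contraT => /level.
Qed.

Lemma ord2P (f : 'I_2) : f = ord0 \/ f = ord_max.
Proof. by case: f => -[|[|//]] h; [left|right]; exact: val_inj. Qed.

Lemma LL_prism (C : Site) (F G : SPsh C) (p : SPshMap F G) T K e :
  (forall n k, 0 < n -> LL p (@hn n k) full) -> (forall D : {set 'I_n.+1}, T D -> K D) ->
  LL p (box T K e) (cyl K).
Proof.
move=> llh TK; case: (ord2P e) => ->.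
(* For [e] = 0 the index is the least one on level 1. Deleting vertices can only raise it, so [rho]
   is n - j. For [e] = 1 the order is reversed. *)
- pose i A := \big[Order.min/ord_max]_(x in A | x.2 == ord_max) (x.1 : 'I_n.+1).
  apply: (@LL_prism_gen _ _ _ _ _ _ _ ord_max i (fun j => n - j)) => //; first exact: ord2P.
  + by move=> A B AB; apply: eq_bigl => -[j f] /=; case: (ord2P f) => -> //=; rewrite ?AB ?andbF.
  + move=> c /is_chainP cc [j jc].
    have [||[j' f] /andP[j'c /eqP /= fm] E] :=
      @eq_bigmin _ _ _ ord_max ((j, ord_max) : prism)
        (fun x : prism => (x \in c) && (x.2 == ord_max)) (fun x => x.1); first by rewrite jc eqxx.
      by move=> k _; exact: leq_ord.
    rewrite {f}fm in j'c.
    have ic : i c = j' by exact: E.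
    rewrite ic; split=> // -[k f] kc.
    case: (ord2P f) => ff; subst f.
    * have := cc _ _ kc j'c; rewrite /Order.comparable !leEprod /= andbT andbF orbF => h.
      by rewrite h.
    * have h : (j' <= k)%O by rewrite -ic; apply: (@bigmin_le_cond _ _ _ _ (k, ord_max)) => //=; rewrite kc eqxx.
      by rewrite /Order.comparable !leEprod /= h andbT orbT.
  + move=> c w wc _.
    have : (i c <= i (c :\ w))%O.
      by apply: sub_bigmin => x /=; rewrite !inE => /andP[/andP[_ ->] ->].
    rewrite le_eqVlt => /orP[/eqP->|lt]; [by right|left].
    by apply: ltn_sub2l => //; apply: (leq_trans lt); exact: leq_ord.
- pose i A := \big[Order.max/ord0]_(x in A | x.2 == ord0) (x.1 : 'I_n.+1).
  apply: (@LL_prism_gen _ _ _ _ _ _ _ ord0 i (fun j => j)) => //.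
  + by move=> f; case: (ord2P f); [right|left].
  + by move=> A B AB; apply: eq_bigl => -[j f] /=; case: (ord2P f) => -> //=; rewrite ?AB ?andbF.
  + move=> c /is_chainP cc [j jc].
    have [||[j' f] /andP[j'c /eqP /= fm] E] :=
      @eq_bigmax _ _ _ ord0 ((j, ord0) : prism)
        (fun x : prism => (x \in c) && (x.2 == ord0)) (fun x => x.1); first by rewrite jc eqxx.
      by move=> k _; exact: leq0n.
    rewrite {f}fm in j'c.
    have ic : i c = j' by exact: E.
    rewrite ic; split=> // -[k f] kc.
    case: (ord2P f) => ff; subst f.
    * have h : (k <= j')%O by rewrite -ic; apply: (@le_bigmax_cond _ _ _ _ (k, ord0)) => //=; rewrite kc eqxx.
      by rewrite /Order.comparable !leEprod /= h.
    * have := cc _ _ kc j'c; rewrite /Order.comparable !leEprod /= andbF andbT /= => h.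
      by rewrite h orbT.
  + move=> c w wc _.
    have : (i (c :\ w) <= i c)%O.
      by apply: sub_bigmax => x /=; rewrite !inE => /andP[/andP[_ ->] ->].
    by rewrite le_eqVlt => /orP[/eqP->|lt]; [right|left].
Qed.

End Prism.

HB.instance Definition _ n := [Finite of nesub n by <:].

Section Subdivision.
Variable n : nat.
Implicit Types (A B : nesub n) (c : {set nesub n}).

Lemma nesub_leE A B : (A <= B)%O = ((A : {set _}) \subset B).
Proof. by []. Qed.

Definition nesubU1 (D : {set 'I_n.+1}) (k : 'I_n.+1) : nesub n.
Proof. by exists (k |: D); apply/set0Pn; exists k; rewrite setU11. Defined.

(* The subdivision of D, as a subcomplex of sd n. *)
Definition sdc (D : cplx 'I_n.+1) : cplx (nesub n).
Proof.
exists (fun c : {set nesub n} => [forall B in c, D (B : {set 'I_n.+1})]) => [|c c' cc'].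
- by apply/forall_inP => B; rewrite inE.
- by move=> /forall_inP h; apply/forall_inP => B /(subsetP cc'); exact: h.
Defined.

(* For a chain c, the largest member of c avoiding k (empty if there is none). *)
Definition avoid (k : 'I_n.+1) c : {set 'I_n.+1} :=
  \bigcup_(B in c | k \notin (B : {set _})) (B : {set _}).

Lemma avoidP k c x :
  reflect (exists B, [/\ B \in c, k \notin (B : {set _}) & x \in (B : {set _})])
          (x \in avoid k c).
Proof.
apply: (iffP bigcupP) => [[B /andP[Bc kB] xB]|[B [Bc kB xB]]]; exists B => //.
by rewrite Bc.
Qed.

Lemma avoid_sub k c B : B \in c -> k \notin (B : {set _}) -> (B : {set _}) \subset avoid k c.
Proof. by move=> Bc kB; apply/subsetP => x xB; apply/avoidP; exists B. Qed.

Lemma avoidS k c c' : c \subset c' -> avoid k c \subset avoid k c'.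
Proof.
move=> cc'; apply/subsetP => x /avoidP[B [Bc kB xB]]; apply/avoidP; exists B.
by rewrite (subsetP cc').
Qed.

Lemma chain_avoid_mem k c : is_chain c -> avoid k c != set0 ->
  exists B, [/\ B \in c, k \notin (B : {set _}) & avoid k c = B].
Proof.
move=> /is_chainP cc /set0Pn[x /avoidP[B0 [B0c kB0 _]]].
have PB0 : (B0 \in c) && (k \notin (B0 : {set _})) by rewrite B0c.
pose B := [arg max_(B > B0 | (B \in c) && (k \notin (B : {set _}))) #|(B : {set _})|].
have [/andP[Bc kB] Bmax] : (B \in c) && (k \notin (B : {set _})) /\
    forall A, (A \in c) && (k \notin (A : {set _})) -> #|(A : {set _})| <= #|(B : {set _})|.
  by rewrite /B; case: arg_maxnP.
exists B; split=> //; apply/eqP; rewrite eqEsubset avoid_sub // andbT.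
apply/subsetP => y /avoidP[A [Ac kA yA]].
have /orP[AB|BA] : ((A : {set _}) \subset B) || ((B : {set _}) \subset A) by exact: (cc _ _ Ac Bc).
  exact: (subsetP AB).
have /eqP -> // : (B : {set _}) == A by rewrite eqEcard BA Bmax // Ac.
Qed.

Lemma chain_avoid_le k c B : is_chain c -> B \in c -> k \in (B : {set _}) ->
  avoid k c \subset B.
Proof.
move=> /is_chainP cc Bc kB; apply/subsetP => x /avoidP[A [Ac kA xA]].
have /orP[AB|BA] : ((A : {set _}) \subset B) || ((B : {set _}) \subset A) by exact: (cc _ _ Ac Bc).
  exact: (subsetP AB).
by case/negP: kA; exact: (subsetP BA).
Qed.

(* Toggled vertex: avoid k c with k added. *)
Lemma LL_sd_horn (C : Site) (F G : SPsh C) (p : SPshMap F G) (k : 'I_n.+1) : 0 < n ->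
  (forall n k, 0 < n -> LL p (@hn n k) full) -> LL p (sdc (hn k)) full.
Proof.
move=> n0 llh.
pose v c : nesub n := nesubU1 (avoid k c) k.
have kv c : k \in (v c : {set _}) by rewrite /= setU11.
have vU c : avoid k (v c |: c) = avoid k c.
  apply: eq_bigl => B; rewrite !inE; case: eqP => // ->.
  by rewrite /= !inE eqxx /= !andbF.
have vD c : avoid k (c :\ v c) = avoid k c.
  apply: eq_bigl => B; rewrite !inE; case: eqP => // ->.
  by rewrite /= !inE eqxx /= !andbF.
have hnN (B : nesub n) : hn k (B : {set _}) = false -> forall j, j != k -> j \in (B : {set _}).
  move=> /negbT; rewrite negb_or => /andP[_ /existsPn h] j jk.
  by have := h j; rewrite jk negbK.
have MP c : c \in missing (sdc (hn k)) full <->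
    is_chain c /\ exists2 B, B \in c & ~~ hn k (B : {set _}).
  rewrite inE /=; split.
    by move=> /andP[-> /forall_inPn[B Bc hB]]; split=> //; exists B.
  by move=> [-> [B Bc hB]]; apply/forall_inPn; exists B.
apply: (@LL_matching _ _ _ p _ _ _ _ v (fun c => #|avoid k c|) llh) => // c /MP[cc [B Bc hB]].
split.
- apply/MP; split; last by exists B; rewrite // setU1r.
  apply: is_chainU1 => // A Ac; rewrite /Order.comparable !nesub_leE /=.
  have [kA|kA] := boolP (k \in (A : {set _})).
    by rewrite [X in _ || X]subUset sub1set kA chain_avoid_le // orbT.
  by apply/orP; left; apply: subset_trans (subsetUr _ _); exact: avoid_sub.
- apply/MP; split; first exact: (is_chainS (subD1set _ _)).
  (* If the member outside the horn is [v c] itself, then [avoid k c] contains every j other than k.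
     As 0 < n it is nonempty, hence a member of [c]: the face opposite k, which is not in the horn
     either. *)
  have [BE|Bv] := eqVneq B (v c); last by exists B; rewrite // in_setD1 Bv.
  have avE j : j != k -> j \in avoid k c.
    by move=> jk; have := hnN B (negbTE hB) j jk; rewrite BE !inE (negbTE jk).
  have [j jk] : exists j : 'I_n.+1, j != k.
    have [->|k0] := eqVneq k ord0; last by exists ord0; rewrite eq_sym.
    by exists ord_max; rewrite -(inj_eq val_inj) /= -lt0n.
  have [|A [Ac kA AE]] := chain_avoid_mem (k := k) cc; first by apply/set0Pn; exists j; exact: avE.
  exists A.
    by rewrite in_setD1 Ac andbT; apply: contraNneq kA => ->.
  rewrite /= negb_or (nesubP A) /=; apply/existsPn => l; rewrite -AE.
  by have [//|lk /=] := eqVneq l k; rewrite negbK; exact: avE.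
- by rewrite /v vU vD.
- by rewrite vU.
- move=> w wc wv vc _; have := avoidS k (subD1set c w).
  rewrite subEproper => /orP[/eqP E|lt]; last by left; exact: proper_card.
  by right; rewrite /v E.
Qed.

End Subdivision.

Section Cylinder.
Variable n : nat.
Local Notation cone := (nesub n *p 'I_2)%type.
Implicit Types (A : {set cone}) (x : cone).

Lemma nesub_max_mem (B : nesub n) : nesub_max B \in (B : {set _}).
Proof.
have /set0Pn[j jB] := nesubP B.
have [//|i iB E] := @eq_bigmax _ _ _ ord0 j (mem (B : {set _})) id jB.
by rewrite /nesub_max E.
Qed.

Lemma nesub_max_ge (B : nesub n) (j : 'I_n.+1) : j \in (B : {set _}) -> (j <= nesub_max B)%O.
Proof. by move=> jB; apply: (@le_bigmax_cond _ _ _ ord0 j _ id). Qed.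

Definition init_seg (i : 'I_n.+1) : nesub n.
Proof. by exists [set j | (j <= i)%O]; apply/set0Pn; exists i; rewrite inE. Defined.

Lemma init_segP (i j : 'I_n.+1) : (j \in (init_seg i : {set _})) = (j <= i)%O.
Proof. by rewrite /= inE. Qed.

Lemma init_seg_max i : nesub_max (init_seg i) = i.
Proof.
apply/le_anti/andP; split; last by apply: nesub_max_ge; rewrite init_segP.
by rewrite -init_segP nesub_max_mem.
Qed.

Lemma init_seg_le : {homo init_seg : i j / (i <= j)%O}.
Proof.
by move=> i j ij; apply/subsetP => l; rewrite !init_segP => /le_trans; exact.
Qed.

(** The face of Delta^n over which a vertex of the cylinder lies: a vertex of sd Delta^n lies over
    the face it names, a vertex of Delta^n over itself. *)
Definition supp_of x : {set 'I_n.+1} :=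
  if x.2 == ord0 then (x.1 : {set _}) else [set nesub_max x.1].

Definition supp A : {set 'I_n.+1} := \bigcup_(x in A) supp_of x.

(* The mapping cylinder of the last vertex map sd n -> Delta^n: the vertex i of
   Delta^n is encoded by the initial segment at level 1. *)
Definition mcyl : cplx cone.
Proof.
exists (fun A : {set cone} => [forall x in A, (x.2 == ord0) || (x.1 == init_seg (nesub_max x.1))])
  => [|A B AB].
- by apply/forall_inP => x; rewrite inE.
- by move=> /forall_inP h; apply/forall_inP => x /(subsetP AB); exact: h.
Defined.

Definition mcyl_end : cplx cone.
Proof.
exists (fun A : {set cone} => [forall x in A, x.2 == ord0]) => [|A B AB].
- by apply/forall_inP => x; rewrite inE.
- by move=> /forall_inP h; apply/forall_inP => x /(subsetP AB); exact: h.
Defined.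

Lemma suppS A (B : {set cone}) : A \subset B -> supp A \subset supp B.
Proof.
move=> AB; apply/bigcupsP => x xA; apply: (bigcup_max x) => //; exact: (subsetP AB).
Qed.

(** The union of the mapping cylinders over the proper faces of Delta^n. *)
Definition mcyl_bd : cplx cone.
Proof.
exists (fun A : {set cone} => mcyl A && (supp A != setT)) => [|A B AB /andP[mB sB]].
- by rewrite face0 /= /supp big_set0; apply/eqP => /setP /(_ ord0); rewrite !inE => /esym.
- rewrite (face_sub AB mB) /=; apply: contra sB => /eqP sA.
  by rewrite -subTset -sA suppS.
Defined.

(* Toggled vertex: with i the least vertex of Delta^n in the chain, the largest
   member of level 0 avoiding i, with i added. *)
Lemma LL_mcyl (C : Site) (F G : SPsh C) (p : SPshMap F G) :
  (forall n k, 0 < n -> LL p (@hn n k) full) -> LL p (cplxU mcyl_end mcyl_bd) mcyl.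
Proof.
move=> llh.
pose idx A := \big[Order.min/ord_max]_(x in A | x.2 == ord_max) nesub_max x.1.
pose lev0 A : {set nesub n} := [set B | ((B, ord0) : cone) \in A].
pose tau A := avoid (idx A) (lev0 A).
pose v A : cone := (nesubU1 (tau A) (idx A), ord0).
(* Lexicographic: first a large [idx], then a small [tau]. The weight [n.+2] exceeds [#|tau A|],
   which is at most [n.+1]. *)
pose rho A := (n - idx A) * n.+2 + #|tau A|.
have level A : (exists B, ((B, ord_max) : cone) \in A) <-> ~~ [forall x in A, x.2 == ord0].
  split=> [[B BA]|/forall_inPn[[B f] BA /= f0]].
    by apply/forall_inPn; exists (B, ord_max).
  by case: (ord2P f) => E; [rewrite E in f0 | exists B; rewrite -E].
have MP A : A \in missing (cplxU mcyl_end mcyl_bd) mcyl <->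
    [/\ is_chain A, mcyl A, supp A = setT & exists B, ((B, ord_max) : cone) \in A].
  rewrite inE /mcyl_bd /=; split.
    move=> /and3P[Ac mA]; rewrite /= mA negb_or /= negbK => /andP[/level h /eqP sA].
    by split.
  by move=> [-> mA sA /level h]; rewrite mA sA negb_or h eqxx.
apply: (@LL_matching _ _ _ p _ _ _ _ v rho llh).
  move=> A /= /orP[/forall_inP h|/andP[] //].
  by apply/forall_inP => x /h ->.
move=> A /MP[Ac mA sA [B0 B0A]].
have AP := is_chainP _ Ac.
have mP (B : nesub n) : ((B, ord_max) : cone) \in A -> B = init_seg (nesub_max B).
  by move=> BA; have := forall_inP mA _ BA => /= /eqP.
have [Bi [BiA idxE BiE]] : exists Bi : nesub n, [/\ ((Bi, ord_max) : cone) \in A,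
    idx A = nesub_max Bi & Bi = init_seg (idx A)].
  have [||[B f] /andP[BA /eqP /= fm] E] :=
    @eq_bigmin _ _ _ ord_max ((B0, ord_max) : cone)
      (fun x : cone => (x \in A) && (x.2 == ord_max)) (fun x => nesub_max x.1); first by rewrite B0A eqxx.
    by move=> k _; exact: leq_ord.
  rewrite {f}fm in BA; exists B; split=> //.
  by rewrite [idx A]E /=; exact: mP.
have idx_le (B : nesub n) : ((B, ord_max) : cone) \in A -> (idx A <= nesub_max B)%O.
  by move=> BA; apply: (@bigmin_le_cond _ _ _ _ ((B, ord_max) : cone)) => //=; rewrite BA eqxx.
have lev0c : is_chain (lev0 A).
  apply/is_chainP => B B'; rewrite !inE => BA B'A.
  by have := AP _ _ BA B'A; rewrite /Order.comparable !leEprod /= !andbT.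
have lev0_le (B : nesub n) : B \in lev0 A -> (B : {set _}) \subset init_seg (idx A).
  rewrite inE => BA; have := AP _ _ BA BiA; rewrite BiE /Order.comparable !leEprod /=.
  by rewrite andbT andbF orbF.
have tau_le : tau A \subset init_seg (idx A).
  by apply/bigcupsP => B /andP[Bl _]; exact: lev0_le.
have v_le : ((v A).1 : {set _}) \subset init_seg (idx A).
  by rewrite /= subUset tau_le sub1set init_segP lexx.
have v_comp : {in A, forall x, (x >=< v A)%O}.
  move=> [B f] BA; rewrite /Order.comparable !leEprod /=; case: (ord2P f) => ff; subst f => /=.
    have Bl : B \in lev0 A by rewrite inE.
    rewrite !andbT !nesub_leE /=.
    have [kB|kB] := boolP (idx A \in (B : {set _})).
      by rewrite [X in _ || X]subUset sub1set kB chain_avoid_le // orbT.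
    by apply/orP; left; apply: subset_trans (subsetUr _ _); exact: avoid_sub.
  rewrite andbF andbT /= nesub_leE (mP _ BA) (subset_trans v_le) //.
  exact/init_seg_le/idx_le.
have lvl1U B : ((B, ord_max) : cone) \in v A |: A = (((B, ord_max) : cone) \in A).
  by rewrite !inE xpair_eqE andbF.
have lvl1D B : ((B, ord_max) : cone) \in A :\ v A = (((B, ord_max) : cone) \in A).
  by rewrite !inE xpair_eqE andbF.
have idxU : idx (v A |: A) = idx A.
  by apply: eq_bigl => -[B f] /=; case: (ord2P f) => ->; rewrite ?lvl1U ?andbF.
have idxD : idx (A :\ v A) = idx A.
  by apply: eq_bigl => -[B f] /=; case: (ord2P f) => ->; rewrite ?lvl1D ?andbF.
have idxv : idx A \in ((v A).1 : {set _}) by rewrite /= setU11.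
have tauU : tau (v A |: A) = tau A.
  rewrite /tau idxU; apply: eq_bigl => B; rewrite !inE xpair_eqE eqxx andbT.
  by case: eqP => // ->; rewrite idxv !andbF.
have tauD : tau (A :\ v A) = tau A.
  rewrite /tau idxD; apply: eq_bigl => B; rewrite !inE xpair_eqE eqxx andbT.
  by case: eqP => // ->; rewrite idxv !andbF.
(* Deleting the toggled vertex keeps the support: [idx A] is still contributed from level 1, and
   [tau A] by members of level 0 that avoid it. *)
have suppD : supp (A :\ v A) = setT.
  apply/eqP; rewrite -subTset -sA; apply/bigcupsP => x xA.
  have [->|xv] := eqVneq x (v A); last by apply: (bigcup_max x); rewrite // in_setD1 xv.
  rewrite /supp_of eqxx subUset sub1set; apply/andP; split.
    apply/bigcupP; exists ((Bi, ord_max) : cone); first by rewrite lvl1D.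
    by rewrite /supp_of /= inE idxE.
  apply/bigcupsP => B /andP[/[!inE] BA kB].
  apply: (bigcup_max ((B, ord0) : cone)) => //; rewrite in_setD1 BA andbT.
  by apply: contraNneq kB => BE; have -> : B = (v A).1 by rewrite -BE.
split.
- apply/MP; split; first exact: is_chainU1.
  + apply/forall_inP => x; rewrite in_setU1 => /orP[/eqP->|xA] //.
    exact: (forall_inP mA).
  + by apply/eqP; rewrite -subTset -sA suppS // subsetUr.
  + by exists B0; rewrite lvl1U.
- apply/MP; split=> //; first exact: (is_chainS (subD1set _ _)).
  + exact: (face_sub (subD1set _ _)).
  + by exists B0; rewrite lvl1D.
- by rewrite /v idxU idxD tauU tauD.
- by rewrite /rho idxU tauU.
- move=> w wA wv vA wS.
  have idx_ge : (idx A <= idx (A :\ w))%O.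
    by apply: sub_bigmin => x /=; rewrite !inE => /andP[/andP[_ ->] ->].
  move: (idx_ge); rewrite le_eqVlt => /orP[/eqP idE|lt].
    have : tau (A :\ w) \subset tau A.
      rewrite /tau -idE; apply: avoidS; apply/subsetP => B.
      by rewrite !inE => /andP[].
    rewrite subEproper => /orP[/eqP tE|tlt].
      by right; rewrite /rho /v tE -idE.
    by left; rewrite /rho -idE ltn_add2l; exact: proper_card.
  left; rewrite /rho.
  have lt' : n - idx (A :\ w) < n - idx A.
    by apply: ltn_sub2l => //; apply: (leq_trans lt); exact: leq_ord.
  apply: (@leq_trans ((n - idx (A :\ w)).+1 * n.+2)).
    rewrite mulSn [X in X < _]addnC ltn_add2r ltnS -[X in _ <= X]card_ord.
    exact: max_card.
  by apply: leq_trans (leq_addr _ _); rewrite leq_mul2r lt' orbT.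
Qed.

End Cylinder.

(** * The functors Ex and Ex^oo *)

Section Extension.

Definition Ex_psh (C : Category) (F : SPsh C) : SPsh C.
Proof.
exists (fun U => Ex (F U)) (fun U V f => Ex_map (spact F f)).
- by move=> U; rewrite spact1; apply: PshMap_eq => n a; exact: pcomp1r.
- by move=> U V W f g; rewrite spactM; apply: PshMap_eq => n a /=; rewrite pcompA.
Defined.

Definition Ex_psh_map (C : Category) (F G : SPsh C) (p : SPshMap F G) :
  SPshMap (Ex_psh F) (Ex_psh G).
Proof.
exists (fun U => Ex_map (p U)) => U V f; apply: PshMap_eq => n a /=.
by rewrite !pcompA spmap_nat.
Defined.

Lemma sd_lift n r m (x : nerve 'I_n.+1 r) (t : sd n m) : injective x ->
  (t ord_max : {set _}) \subset im x -> exists s : sd r m, sd_map x m s = t.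
Proof.
move=> xi tx.
have tix i : (t i : {set _}) \subset im x.
  by apply: subset_trans tx; apply: (omorph_le t); exact: leq_ord.
have ne i : x @^-1: (t i : {set _}) != set0.
  have /set0Pn[j jt] := nesubP (t i).
  have /imsetP[l _ E] := subsetP (tix i) _ jt.
  by apply/set0Pn; exists l; rewrite inE -E.
have le : {homo (fun i => NeSub (ne i)) : i j / (i <= j)%O}.
  by move=> i j ij; apply: preimsetS; exact: (omorph_le t ij).
exists (omorph_mk le); apply: omorph_eq => i; apply: val_inj => /=.
apply/setP => j; apply/imsetP/idP => [[l /[!inE] h -> //]|jt].
have /imsetP[l _ E] := subsetP (tix i) _ jt.
by exists l; rewrite // inE -E.
Qed.

Lemma sd_map_inj n r m (x : nerve 'I_n.+1 r) (s s' : sd r m) : injective x ->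
  sd_map x m s = sd_map x m s' -> s = s'.
Proof.
move=> xi E; apply: omorph_eq => i; apply: val_inj; apply: (imset_inj xi).
exact: (congr1 (fun z : sd n m => (z i : {set _})) E).
Qed.

Lemma nerve_ord_chain n (A : {set 'I_n.+1}) : is_chain A.
Proof. by apply/is_chainP => x y _ _; rewrite /Order.comparable; exact: leq_total. Qed.

Lemma sdc_map n (D : cplx 'I_n.+1) r (x : nerve 'I_n.+1 r) m (s : sd r m) :
  sub D r x -> sub (sdc D) m (sd_map x m s).
Proof.
move=> Dx; apply/forall_inP => _ /imsetP[i _ ->] /=.
by apply: face_sub Dx; exact/imsetS/subsetT.
Qed.

Lemma sdc_lift n (D : cplx 'I_n.+1) m (t : sd n m) : sub (sdc D) m t ->
  exists r (x : nerve 'I_n.+1 r) (s : sd r m),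
    [/\ injective x, sub D r x & sd_map x m s = t].
Proof.
move=> /forall_inP Dt.
have [r [x [xi xt]]] := chain_simplex (nerve_ord_chain _) (nesubP (t ord_max)).
have [|s sE] := @sd_lift n r m x t xi; first by rewrite xt.
by exists r, x, s; split=> //; rewrite /= xt; apply: Dt; exact: mem_im.
Qed.

(* sd is left adjoint to Ex, for subcomplexes of Delta^n. *)
Lemma Ex_adj n (D : cplx 'I_n.+1) (K : sSet) (a : sMap (sub_psh (sub D)) (Ex K)) :
  exists a' : sMap (sub_psh (sub (sdc D))) K, forall r x hx m (s : sd r m) h,
    a' m (exist _ (sd_map x m s) h) = a r (exist _ x hx) m s.
Proof.
have a_pact r q (g : @Hom Delta q r) x hx hx' m (s : sd q m) :
    a q (exist _ (pact (nerve 'I_n.+1) g x) hx') m s = a r (exist _ x hx) m (sd_map g m s).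
  by rewrite (sub_nat a hx hx').
(* Independence of the presentation of a simplex of the subdivision: [s] is reduced to the face
   spanned by its largest set, and the image of this face factors through the injective [x']. *)
have uniq r r' (x : nerve 'I_n.+1 r) (x' : nerve 'I_n.+1 r') hx hx' m
    (s : sd r m) (s' : sd r' m) : injective x' ->
    sd_map x m s = sd_map x' m s' -> a r (exist _ x hx) m s = a r' (exist _ x' hx') m s'.
  move=> x'i E.
  have [q [y [yi ys]]] := chain_simplex (nerve_ord_chain _) (nesubP (s ord_max)).
  have [|s0 s0E] := @sd_lift r q m y s yi; first by rewrite ys.
  have hxy : sub D q (pact (nerve 'I_n.+1) y x) by exact: sub_closed.
  rewrite -s0E -(a_pact _ _ y x hx hxy).
  have [|g gE] := @nerve_factor _ 'I_n.+1 q r' x' (pact (nerve 'I_n.+1) y x) x'i.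
    rewrite im_pact -/(im y) ys.
    have -> : x @: (s ord_max : {set _}) = x' @: (s' ord_max : {set _}).
      exact: (congr1 (fun z : sd n m => (z ord_max : {set _})) E).
    exact/imsetS/subsetT.
  have hx'g : sub D q (pact (nerve 'I_n.+1) g x') by exact: sub_closed.
  have -> : a q (exist _ _ hxy) = a q (exist _ _ hx'g) by apply: sub_app; rewrite gE.
  rewrite (a_pact _ _ g x' hx'); congr (a r' _ m _).
  apply: (sd_map_inj x'i); rewrite -E -s0E.
  apply: omorph_eq => i; apply: val_inj => /=.
  rewrite -!imset_comp; apply: eq_imset => j.
  exact: (congr1 (fun z : nerve 'I_n.+1 q => z j) gE).
pose R m (t : sd n m) (k : K m) :=
  exists r x hx (s : sd r m), sd_map x m s = t /\ a r (exist _ x hx) m s = k.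
have [|||a' a'P] := @mk_map Delta (sd n) K (sub (sdc D)) R.
- move=> m t /sdc_lift[r [x [s [xi hx sE]]]].
  by exists (a r (exist _ x hx) m s), r, x, hx, s.
- move=> m t k k' [r [x [hx [s [sE <-]]]]] [r' [x' [hx' [s' [sE' <-]]]]].
  have ht : sub (sdc D) m t by rewrite -sE; exact: sdc_map.
  have [r0 [x0 [s0 [x0i hx0 sE0]]]] := sdc_lift ht.
  rewrite (uniq _ _ _ _ hx hx0 _ s s0 x0i) ?sE //.
  by rewrite (uniq _ _ _ _ hx' hx0 _ s' s0 x0i) ?sE'.
- move=> m q f t k [r [x [hx [s [sE <-]]]]].
  by exists r, x, hx, (pact (sd r) f s); rewrite !pmap_nat sE.
- exists a' => r x hx m s h; have [r' [x' [hx' [s' [sE' <-]]]]] := a'P _ _ h.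
  have [r0 [x0 [s0 [x0i hx0 sE0]]]] := sdc_lift h.
  rewrite (uniq _ _ _ _ hx hx0 _ s s0 x0i) ?sE //.
  by rewrite (uniq _ _ _ _ hx' hx0 _ s' s0 x0i) ?sE'.
Qed.

(** By adjunction a square at [D] for Ex p is one at sd [D] for p. On the side of G everything is
    determined by the value of [b] at the identity of [n]. *)
Lemma Ex_LL (C : Site) (F G : SPsh C) (p : SPshMap F G) n (D : cplx 'I_n.+1) :
  LL p (sdc D) full -> LL (Ex_psh_map p) D full.
Proof.
move=> llp X a b ab.
have [a' a'P] := Ex_adj a.
pose id_n : sub_psh (sub full) n := exist _ (@hid Delta n : nerve 'I_n.+1 n) (full_mem _).
have bE r x h m (s : sd r m) : b r (exist _ x h) m s = b n id_n m (sd_map x m s).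
  have hx : sub full r (pact (nerve 'I_n.+1) (x : @Hom Delta r n) (@hid Delta n : nerve 'I_n.+1 n)) by [].
  transitivity (b r (exist _ _ hx) m s).
    by congr (pmap (b r _) s); apply: sig_eq; exact: omorph_eq.
  by rewrite (sub_nat b (full_mem (@hid Delta n : nerve 'I_n.+1 n)) hx).
have [|Z Zc ZP] := llp X a' (pcomp (b n id_n) (sub_incl _)).
  move=> m t hs ht; have [r [x [s [xi hx sE]]]] := sdc_lift hs; subst t.
  rewrite (a'P _ _ hx) /= -bE -(ab _ _ hx) //.
exists Z => // U f /ZP [l' [l'1 l'2]].
pose l0 : sMap (sd n) (F U) := pcomp l' (sub_total (@full_mem _ (nesub n))).
pose l r (x : sub_psh (sub full) r) : Ex (F U) r := pcomp l0 (sd_map (proj1_sig x)).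
have lN r q (g : @Hom Delta q r) x : l q (pact (sub_psh (sub full)) g x) = pact (Ex (F U)) g (l r x).
  rewrite /= -pcompA; congr pcomp; apply: PshMap_eq => m s.
  by apply: omorph_eq => i; apply: val_inj => /=; exact: imset_comp.
exists (Build_PshMap lN); split=> [r x hs ht|r [x hx]].
- apply: PshMap_eq => m s /=.
  by rewrite (l'1 _ _ (sdc_map s hs)) (a'P _ _ hs).
- apply: PshMap_eq => m s /=; rewrite l'2 /=; congr (spact G f m _).
  exact: esym (bE r x hx m s).
Qed.

End Extension.

(** * Horns in Ex K are filled in Ex^2 K *)

Section KanCondition.
Variables (n : nat) (k : 'I_n.+1).
Implicit Types B : nesub n.

(** A vertex of sd^2 Delta^n is a nonempty chain of faces; it is sent to the set of the
    [horn_vertex] of its members. This gives a map from sd^2 Delta^n to sd of the horn which, on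
    sd^2 of the horn, is the subdivided last vertex map. Faces outside the horn contribute k. *)
Definition horn_vertex B : 'I_n.+1 := if hn k (B : {set _}) then nesub_max B else k.

Lemma horn_vertices_nonempty m (t : sd n m) (A : nesub m) :
  (fun j => horn_vertex (t j)) @: (A : {set _}) != set0.
Proof. by rewrite imset_eq0 nesubP. Qed.

Lemma horn_vertices_le m (t : sd n m) q (u : sd m q) :
  {homo (fun i => NeSub (horn_vertices_nonempty t (u i))) : i j / (i <= j)%O}.
Proof. by move=> i j ij; apply: imsetS; exact: (omorph_le u ij). Qed.

Definition horn_retract m (t : sd n m) q (u : sd m q) : sd n q :=
  omorph_mk (horn_vertices_le t u).

(* If every j != k were some horn_vertex (t i), it would be the maximum of a
   face t i of the horn; the largest of these faces would contain every j != k. *)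
Lemma horn_retract_mem m (t : sd n m) q (u : sd m q) : 0 < n ->
  sub (sdc (hn k)) q (horn_retract t u).
Proof.
move=> n0; apply/forall_inP => _ /imsetP[i _ ->] /=; apply/orP; right.
apply: contraT => /existsPn miss.
have hit j : j != k -> exists l : 'I_m.+1,
    [/\ l \in (u i : {set _}), hn k (t l : {set _}) & j \in (t l : {set _})].
  move=> jk; have := miss j; rewrite jk negbK => /imsetP[l lu E]; exists l.
  rewrite /horn_vertex in E; case: ifP E => h E; last by rewrite E eqxx in jk.
  by split=> //; rewrite E nesub_max_mem.
have [j0 j0k] : exists j : 'I_n.+1, j != k.
  have [->|k0] := eqVneq k ord0; last by exists ord0; rewrite eq_sym.
  by exists ord_max; rewrite -(inj_eq val_inj) /= -lt0n.
have [l0 [_ hl0 _]] := hit _ j0k.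
pose l := [arg max_(l > l0 | hn k (t l : {set _})) (l : nat)].
have [hl lmax] : hn k (t l : {set _}) /\ forall l', hn k (t l' : {set _}) -> l' <= l.
  by rewrite /l; case: arg_maxnP.
move: (hl); rewrite /= (negbTE (nesubP _)) /= => /existsP[j /andP[jk /negP[]]].
have [l' [_ hl' jl']] := hit _ jk.
have tle : (t l' <= t l)%O by apply: (omorph_le t); exact: lmax.
exact: (subsetP tle).
Qed.

(** The filler is the adjoint of [a] composed with [horn_retract]. Over a simplex of the horn the
    retraction is the subdivided last vertex map, and composition with that map is [Ex_unit]. *)
Lemma Ex_kan (K : sSet) (a : sMap (sub_psh (sub (hn k))) (Ex K)) : 0 < n ->
  exists l : Ex (Ex K) n, forall m (x : nerve 'I_n.+1 m) h,
    pact (Ex (Ex K)) (x : @Hom Delta m n) l = Ex_unit (Ex K) m (a m (exist _ x h)).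
Proof.
move=> n0; have [a' a'P] := Ex_adj a.
pose l0 m (t : sd n m) q (u : sd m q) : K q := a' q (exist _ _ (horn_retract_mem t u n0)).
have l0N m t q r (g : @Hom Delta r q) (u : sd m q) :
    l0 m t r (pact (sd m) g u) = pact K g (l0 m t q u).
  by rewrite /l0 -pmap_nat; apply: sub_app; exact: omorph_eq.
pose l1 m (t : sd n m) : Ex K m := Build_PshMap (l0N m t).
have l1N m r (g : @Hom Delta r m) t : l1 r (pact (sd n) g t) = pact (Ex K) g (l1 m t).
  apply: PshMap_eq => q u; apply: sub_app; apply: omorph_eq => i; apply: val_inj.
  by rewrite /= -imset_comp.
exists (Build_PshMap l1N) => m x h.
apply: PshMap_eq => q t; apply: PshMap_eq => r u /=.
rewrite -(a'P _ x h _ _ (sdc_map _ h)); apply: sub_app.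
apply: omorph_eq => i; apply: val_inj => /=.
rewrite -imset_comp; apply: eq_imset => j /=.
rewrite /horn_vertex; have -> : hn k (nesub_image x (t j) : {set _}).
  by apply: face_sub h; exact/imsetS/subsetT.
by rewrite -/(nesub_max (nesub_image x (t j))) nesub_max_image.
Qed.

End KanCondition.

(** * Sequential colimits along injections and maps from finite complexes *)

Section Stages.
Variables (C : Category) (P : nat -> Psh C) (u : forall i, PshMap (P i) (P i.+1)).

Lemma seq_incl_step i U (x : P i U) : seq_incl u i.+1 U (u i U x) = seq_incl u i U x.
Proof. by apply/eq_class/rst_sym/rst_step. Qed.

Lemma seq_incl_surj U (z : seq_colim u U) : exists i x, seq_incl u i U x = z.
Proof. by elim/quotW: z => -[i x]; exists i, x. Qed.

Lemma seq_incl_le i j U (x : P i U) : i <= j ->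
  exists y : P j U, seq_incl u j U y = seq_incl u i U x.
Proof.
move=> ij; rewrite -(subnK ij); elim: (j - i) => [|k [y yE]]; first by exists x.
by exists (u _ U y); rewrite seq_incl_step.
Qed.

Hypothesis u_inj : forall i U, injective (u i U).

Definition seq_shift U (a : {i : nat & P i U}) : {i : nat & P i U} :=
  existT (fun i => P i U) (tag a).+1 (u (tag a) U (tagged a)).

Lemma seq_shift_inj U : injective (@seq_shift U).
Proof.
move=> [i x] [j y] E; have ij : i = j by apply: succn_inj; exact: (congr1 (@tag _ _) E).
by subst j; congr existT; apply: u_inj; exact: (eq_from_Tagged E).
Qed.

Lemma seq_equivP U a b : gen_equiv (@seq_step C P u U) a b ->
  exists k l, iter k (@seq_shift U) a = iter l (@seq_shift U) b.
Proof.
elim=> {a b} [a b ->|a|a b _ [k [l E]]|a b c _ [k [l E]] _ [k' [l' E']]].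
- by exists 1, 0.
- by exists 0, 0.
- by exists l, k.
- by exists (k' + k), (l + l'); rewrite iterD E -iterD addnC iterD E' -iterD.
Qed.

Lemma seq_incl_inj i U : injective (seq_incl u i U).
Proof.
move=> x y E; have [k [l E']] := seq_equivP (class_eq E).
have tag_iter j (a : {i : nat & P i U}) : tag (iter j (@seq_shift U) a) = tag a + j.
  by elim: j => [|j IH] /=; rewrite ?addn0 // IH addnS.
have kl : k = l by apply: (@addnI i); have := congr1 (@tag _ _) E'; rewrite !tag_iter.
have iter_inj j : injective (iter j (@seq_shift U)).
  by elim: j => [|j IH] a b //= /seq_shift_inj /IH.
by subst l; exact: (eq_from_Tagged (iter_inj _ _ _ E')).
Qed.

End Stages.

(** Each of the finitely many chains has a value that lives at some stage; the maximum serves for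
    all. Injectivity of the transition maps makes the representatives at a given stage unique, so
    they form a simplicial map. *)
Lemma map_stage d (Q : finPOrderType d) (D : cplx Q) (P : nat -> sSet)
    (u : forall i, sMap (P i) (P i.+1)) (a : sMap (sub_psh (sub D)) (seq_colim u)) :
  (forall i m, injective (u i m)) ->
  exists i, forall j, i <= j -> exists a' : sMap (sub_psh (sub D)) (P j),
    forall m x, seq_incl u j m (a' m x) = a m x.
Proof.
move=> u_inj.
have stage (c : {set Q}) : exists i, forall m (x : nerve Q m) h, im x = c ->
    exists z, seq_incl u i m z = a m (exist _ x h).
  case: (boolP [&& is_chain c, c != set0 & D c]) => [/and3P[cc c0 Dc]|nc]; last first.
    exists 0 => m x h xc; case/negP: nc; apply/and3P; rewrite -xc; split=> //.
    - exact: im_chain.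
    - exact: im_neq0.
  have [r [y [yi yc]]] := chain_simplex cc c0.
  have hy : sub D r y by rewrite /= yc.
  have [i [z zE]] := seq_incl_surj (a r (exist _ y hy)).
  exists i => m x h xc; have [|g gE] := @nerve_factor _ _ m r y x yi; first by rewrite xc yc.
  exists (pact (P i) g z); rewrite (pmap_nat (seq_incl u i)) zE; subst x.
  by rewrite (sub_nat a hy h).
pose st (c : {set Q}) := projT1 (cid (stage c)).
exists (\max_c st c) => j le_j.
pose R m (x : nerve Q m) (z : P j m) := exists h, seq_incl u j m z = a m (exist _ x h).
have [|||a' a'P] := @mk_map Delta (nerve Q) (P j) (sub D) R.
- move=> m x h; have : exists z, seq_incl u (st (im x)) m z = a m (exist _ x h).
    by rewrite /st; case: cid => i /= iP; exact: iP.
  move=> [z zE]; have [|z' z'E] := @seq_incl_le _ _ u (st (im x)) j m z.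
    by apply: leq_trans le_j; exact: leq_bigmax.
  by exists z', h; rewrite z'E.
- move=> m x z z' [h E] [h' E']; apply: (seq_incl_inj u_inj); rewrite E E'; exact: sub_app.
- move=> m q f x z [h E]; exists (sub_closed f h).
  by rewrite (pmap_nat (seq_incl u j)) E; symmetry; exact: sub_nat.
- exists a' => m [x h]; have [h' ->] := a'P m x h; exact: sub_app.
Qed.

Section ExInf.

(** The chain of initial segments is a section of the last vertex map, so evaluating there recovers
    the simplex. *)
Lemma Ex_unit_inj (K : sSet) n : injective (Ex_unit K n).
Proof.
move=> x x' E; pose s : sd n n := omorph_mk (@init_seg_le n).
have sE : omorph_comp (last_vertex n) s = @hid Delta n.
  by apply: omorph_eq => i; exact: init_seg_max.
have := congr1 (fun c : sMap _ _ => c n s) E.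
by rewrite /= sE !pact1.
Qed.

Definition Ex_iter_psh (C : Category) (i : nat) (F : SPsh C) : SPsh C.
Proof.
exists (fun U => Ex_iter i (F U)) (fun U V f => Ex_iter_map i (spact F f)).
- by move=> U; rewrite spact1 Ex_iter_map1.
- by move=> U V W f g; rewrite spactM Ex_iter_mapM.
Defined.

Definition Ex_iter_psh_map (C : Category) (i : nat) (F G : SPsh C) (p : SPshMap F G) :
  SPshMap (Ex_iter_psh i F) (Ex_iter_psh i G).
Proof.
by exists (fun U => Ex_iter_map i (p U)) => U V f; rewrite /= -!Ex_iter_mapM spmap_nat.
Defined.

Notation stage K := (seq_incl (fun i => Ex_unit (Ex_iter i K))).

Lemma ExInf_map_stage (K L : sSet) (f : sMap K L) i n x :
  ExInf_map f n (stage K i n x) = stage L i n (Ex_iter_map i f n x).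
Proof. by rewrite /= quot_mapE. Qed.

Lemma stage_inj K i n : injective (stage K i n).
Proof. by apply: seq_incl_inj => j m; exact: Ex_unit_inj. Qed.

Lemma ExInf_stage d (Q : finPOrderType d) (D : cplx Q) K
    (a : sMap (sub_psh (sub D)) (ExInf K)) :
  exists i, forall j, i <= j -> exists a' : sMap (sub_psh (sub D)) (Ex_iter j K),
    forall m x, stage K j m (a' m x) = a m x.
Proof. by apply: map_stage => i m; exact: Ex_unit_inj. Qed.

Variables (C : Site) (F G : SPsh C) (p : SPshMap F G).

(** Both maps of the square come from a common finite stage, and the square commutes there already
    because stages embed in the colimit. *)
Lemma ExInf_LL d (Q : finPOrderType d) (S T : cplx Q) :
  (forall i, LL (Ex_iter_psh_map i p) S T) -> LL (ExInf_psh_map p) S T.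
Proof.
move=> llp X a b ab.
have [ia iaP] := ExInf_stage a; have [ib ibP] := ExInf_stage b.
have [a' a'P] := iaP (maxn ia ib) (leq_maxl _ _).
have [b' b'P] := ibP (maxn ia ib) (leq_maxr _ _).
set j := maxn ia ib in a' a'P b' b'P.
have [|Z Zc ZP] := llp j X a' b'.
  move=> m x hs ht; apply: (@stage_inj _ j); rewrite b'P -(ab _ _ hs) -a'P.
  exact: esym (ExInf_map_stage (p X) _).
exists Z => // U f /ZP [l' [l'1 l'2]].
exists (pcomp (stage (F U) j) l'); split=> [m x hs ht|m y].
- rewrite -a'P; apply: etrans (esym (ExInf_map_stage (spact F f) _)).
  exact: (congr1 (stage (F U) j m) (l'1 m x hs ht)).
- rewrite -b'P; apply: etrans (ExInf_map_stage (p U) _) _.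
  apply: etrans (esym (ExInf_map_stage (spact G f) _)).
  exact: (congr1 (stage (G U) j m) (l'2 m y)).
Qed.

Lemma Ex_iter_LL : (forall n k, 0 < n -> LL p (@hn n k) full) ->
  forall i n k, 0 < n -> LL (Ex_iter_psh_map i p) (@hn n k) full.
Proof.
move=> llh; elim=> [|i IH] n k n0; first exact: llh.
exact: (Ex_LL (LL_sd_horn n0 IH)).
Qed.

Lemma Ex_iter_LL_bd : (forall n, LL p (bd n) full) ->
  forall i n, LL (Ex_iter_psh_map i p) (bd n) full.
Proof.
move=> llb; elim=> [|i IH] n; first exact: llb.
have llS : LL (Ex_iter_psh_map i p) (sdc (bd n)) full by exact: LL_cells.
exact: (Ex_LL llS).
Qed.

End ExInf.

Definition pt_psh (C : Category) : SPsh C.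
Proof. by exists (fun U => pconst Delta unit) (fun U V f => pid _). Defined.

(** Horn filling in F becomes local lifting along the map to the point, so that the results on [LL]
    apply to it. *)
Definition to_pt (C : Category) (F : SPsh C) : SPshMap F (pt_psh C).
Proof.
exists (fun U => @Build_PshMap _ (F U) (pconst Delta unit) (fun n x => tt) (fun _ _ _ _ => erefl)).
by move=> U V f; apply: PshMap_eq.
Defined.

Lemma ExInf_kan (C : Site) (F : SPsh C) n (k : 'I_n.+1) : 0 < n ->
  LL (to_pt (ExInf_psh F)) (hn k) full.
Proof.
move=> n0 X a b _; apply: locallyT => U f.
(* The stage is moved to [i.+1], which has the form Ex K required by [Ex_kan]; the filler then lives
   at stage [i.+2]. *)
have [i iP] := ExInf_stage a; have [a' a'P] := iP _ (leqnSn i).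
have [l lP] := Ex_kan (K := Ex_iter i (F U)) (pcomp (Ex_map (Ex_iter_map i (spact F f))) a') n0.
pose l' := seq_incl (fun i => Ex_unit (Ex_iter i (F U))) i.+2 n l.
pose g m (x : sub_psh (sub full) m) : ExInf (F U) m :=
  pact (ExInf (F U)) (proj1_sig x : @Hom Delta m n) l'.
have gN m q (h : @Hom Delta q m) x : g q (pact (sub_psh (sub full)) h x) = pact (ExInf (F U)) h (g m x).
  by rewrite /g -pactM.
exists (Build_PshMap gN); split=> [m x hs ht|m y]; last first.
  by case: (spact (pt_psh C) f m (b m y) : unit).
rewrite -a'P; apply: etrans (esym (ExInf_map_stage (spact F f) _)).
rewrite /= /g /l' -(pmap_nat (seq_incl _ _)) (lP _ _ hs).
exact: seq_incl_step.
Qed.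

(** * Boundary liftings imply acyclicity *)

Section TensorMaps.
Variables (C : Category) (K : sSet) (X : C) (F : SPsh C).

Definition tensor_out (a : sMap K (F X)) : SPshMap (tensor K X) F.
Proof.
unshelve eexists.
- move=> U; exists (fun n (x : tensor K X U n) => spact F x.2 n (a n x.1)).
  by move=> n m f [x h] /=; rewrite !pmap_nat.
- by move=> U V f; apply: PshMap_eq => n [x h] /=; rewrite spactM.
Defined.

Definition tensor_at (c : SPshMap (tensor K X) F) : sMap K (F X).
Proof.
exists (fun n x => c X n (x, hid X)) => n m f x.
by rewrite -pmap_nat.
Defined.

Lemma tensor_atE (c : SPshMap (tensor K X) F) U n x (h : Hom U X) :
  c U n (x, h) = spact F h n (tensor_at c n x).
Proof.
have := congr1 (fun a : sMap (tensor K X X) (F U) => a n (x, hid X)) (spmap_nat c h).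
by rewrite /= hcomp1r.
Qed.

End TensorMaps.

Lemma lifts_locallyP (C : Site) (F G : SPsh C) (p : SPshMap F G) n (S : cplx 'I_n.+1) :
  lifts_locally (sub_incl (sub S : SubPsh (simplex n))) p <-> LL p S full.
Proof.
split=> [llp X a b ab|llp X a b ab].
- pose b' : sMap (simplex n) (G X) := pcomp b (sub_total (@full_mem _ 'I_n.+1)).
  have [|Z Zc ZP] := llp X (tensor_out a) (tensor_out b').
    apply: SPshMap_eq => U; apply: PshMap_eq => m [[x hs] h] /=.
    by rewrite hcomp1r spmap_act (ab _ _ hs (full_mem _)).
  exists Z => // U f /ZP [l [l1 l2]].
  exists (pcomp (tensor_at l) (sub_incl (sub full))); split=> [m x hs ht|m [y hy]].
  + have := congr1 (fun c : SPshMap (tensor (sub_psh (sub S)) U) F =>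
      c U m (exist _ x hs, hid U)) l1.
    by rewrite /= !hcomp1.
  + have := congr1 (fun c : SPshMap (tensor (simplex n) U) G => c U m (y, hid U)) l2.
    by rewrite /= hcomp1 => ->; congr (spact G f m _); exact: sub_app.
- pose b' : sMap (sub_psh (sub full)) (G X) := pcomp (tensor_at b) (sub_incl (sub full)).
  have [|Z Zc ZP] := llp X (tensor_at a) b'.
    move=> m x hs ht.
    have := congr1 (fun c : SPshMap (tensor (sub_psh (sub S)) X) G => c X m (exist _ x hs, hid X)) ab.
    by rewrite /= hcomp1.
  exists Z => // U f /ZP [l [l1 l2]].
  exists (tensor_out (pcomp l (sub_total (@full_mem _ 'I_n.+1)))); split.
  + apply: SPshMap_eq => V; apply: PshMap_eq => m [[x hs] h] /=.
    by rewrite hcomp1r (l1 _ _ hs) tensor_atE spactM.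
  + apply: SPshMap_eq => V; apply: PshMap_eq => m [x h] /=.
    by rewrite spmap_act l2 tensor_atE spactM.
Qed.

Lemma boundary_LL (C : Site) (F G : SPsh C) (p : SPshMap F G) :
  (forall n, lifts_locally (sub_incl (boundary n)) p) <-> forall n, LL p (bd n) full.
Proof.
by split=> h n; have := h n; rewrite -bd_sub => /lifts_locallyP.
Qed.

Lemma local_fibrationP (C : Site) (F G : SPsh C) (p : SPshMap F G) :
  local_fibration p <-> forall n k, 0 < n -> LL p (@hn n k) full.
Proof.
split=> h n k n0; have := h n k n0; rewrite -hn_sub => /lifts_locallyP //.
Qed.

(** * Prisms and homotopies relative to the boundary *)

Section PrismMaps.
Variable n : nat.
Local Notation prism := ('I_n.+1 *p 'I_2)%type.

Lemma glue_total (C : Category) (P K : Psh C) (I : Type) (S : I -> SubPsh P)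
    (f : I -> PshMap P K) (T : SubPsh P) :
  (forall U x, T U x -> exists i, S i U x) ->
  (forall i j U x, S i U x -> S j U x -> f i U x = f j U x) ->
  exists g : PshMap (sub_psh T) K,
    forall i U x ht, S i U x -> g U (exist _ x ht) = f i U x.
Proof.
move=> cov agr.
have [//||g gP] := @glue C P K I S (fun i => pcomp (f i) (sub_incl (S i))) T.
  by move=> i j U x hi hj; exact: agr.
by exists g => i U x ht hi; rewrite (gP i U x hi ht).
Qed.

Definition prism_fst : sMap (nerve prism) (simplex n) :=
  nerve_map (omorph_mk (fun (x y : prism) (xy : (x <= y)%O) =>
    proj1 (andP xy) : (x.1 <= y.1)%O)).

Definition prism_snd : sMap (nerve prism) (simplex 1) :=
  nerve_map (omorph_mk (fun (x y : prism) (xy : (x <= y)%O) =>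
    proj2 (andP xy) : (x.2 <= y.2)%O)).

Lemma prism_pair_le m (s : simplex n m) (t : simplex 1 m) :
  {homo (fun i => (s i, t i) : prism) : i j / (i <= j)%O}.
Proof. by move=> i j ij; apply/andP; split; exact: omorph_le. Qed.

Definition prism_pair : sMap (pprod (simplex n) (simplex 1)) (nerve prism).
Proof.
exists (fun m x => omorph_mk (prism_pair_le x.1 x.2)) => m l f x; exact: omorph_eq.
Defined.

Lemma prism_pairK m y : prism_pair m (prism_fst m y, prism_snd m y) = y.
Proof. by apply: omorph_eq => i /=; case: (y i). Qed.

Lemma prism_fst_pair m s t : prism_fst m (prism_pair m (s, t)) = s.
Proof. exact: omorph_eq. Qed.

Lemma prism_snd_pair m s t : prism_snd m (prism_pair m (s, t)) = t.
Proof. exact: omorph_eq. Qed.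

Definition pprod_of_prism : sMap (nerve prism) (pprod (simplex n) (simplex 1)).
Proof.
exists (fun m y => (prism_fst m y, prism_snd m y)) => l m f y /=.
by congr pair; exact: omorph_eq.
Defined.

Lemma cyl_im (D : cplx 'I_n.+1) m y : sub (cyl D) m y <-> sub D m (prism_fst m y).
Proof. by rewrite /= /pr1 /im -imset_comp. Qed.

Lemma base_im (D : cplx 'I_n.+1) e m y :
  sub (base D e) m y <-> sub D m (prism_fst m y) /\ prism_snd m y = cst m e.
Proof.
rewrite -cyl_im; split=> [/andP[Dy /forall_inP h]|[Dy h]].
- split=> //; apply: omorph_eq => i; apply/eqP; exact: (h _ (mem_im y i)).
- apply/andP; split=> //; apply/forall_inP => _ /imsetP[i _ ->]; apply/eqP.
  exact: (congr1 (fun z : simplex 1 m => z i) h).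
Qed.

Lemma cst_neq m : cst m (ord0 : 'I_2) <> cst m (ord_max : 'I_2).
Proof. by move/(congr1 (fun z : simplex 1 m => z ord0)). Qed.

Lemma bdP m (x : simplex n m) : sub (bd n) m x <-> boundary n m x.
Proof. by rewrite bd_sub. Qed.

Definition prism_bd : cplx prism :=
  cplxU (cyl (bd n)) (cplxU (base full ord0) (base full ord_max)).

Definition degen_map_to (P K : sSet) (z : K 0) : sMap P K.
Proof.
exists (fun m x => degen z m) => l m f x.
by rewrite /degen -pactM; congr (pact K _ z); exact: omorph_eq.
Defined.

Lemma LL_total (C : Site) (F G : SPsh C) (p : SPshMap F G) d (P : finPOrderType d)
    (S : cplx P) X (a : sMap (sub_psh (sub S)) (F X)) (b : sMap (nerve P) (G X)) :
  LL p S full -> (forall m x h, p X m (a m (exist _ x h)) = b m x) ->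
  locally (fun U (f : Hom U X) => exists l : sMap (nerve P) (F U),
    (forall m x h, l m x = spact F f m (a m (exist _ x h))) /\
    (forall m x, p U m (l m x) = spact G f m (b m x))).
Proof.
move=> llp ab; have [|Z Zc ZP] := llp X a (pcomp b (sub_incl (sub full))).
  by move=> m x hs ht; exact: ab.
exists Z => // U f /ZP [l [l1 l2]].
exists (pcomp l (sub_total (@full_mem _ P))); split=> [m x h|m x] /=.
- exact: l1.
- exact: l2.
Qed.

End PrismMaps.

Definition pprod_fst (C : Category) (P Q : Psh C) : PshMap (pprod P Q) P.
Proof. by exists (fun U x => x.1). Defined.

Section RelativeHomotopy.
Variable n : nat.

Definition on_bd (K : sSet) (z : K 0) (s : sMap (simplex n) K) :=
  forall m x, boundary n m x -> s m x = degen z m.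

(** [rel_homotopic] for bare maps: they can be restricted and rebased without transporting proofs
    about their boundaries. [hclass] below serves the same purpose for classes in [pi]. *)
Definition hrel (K : sSet) (z : K 0) (s s' : sMap (simplex n) K) : Prop :=
  exists H : sMap (pprod (simplex n) (simplex 1)) K,
    [/\ forall m x, H m (x, cst m ord0) = s m x,
        forall m x, H m (x, cst m ord_max) = s' m x
      & forall m x t, boundary n m x -> H m (x, t) = degen z m].

(** The homotopy in G is lifted relative to the boundary of the prism, on which [s] and [s'] are
    prescribed at the two ends and the base point on the sides. *)
Lemma lift_homotopy (C : Site) (F G : SPsh C) (p : SPshMap F G) X (z : F X 0)
    (s s' : sMap (simplex n) (F X)) : LL p (prism_bd n) full ->
  on_bd z s -> on_bd z s' -> hrel (p X 0 z) (pcomp (p X) s) (pcomp (p X) s') ->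
  locally (fun U (f : Hom U X) =>
    hrel (spact F f 0 z) (pcomp (spact F f) s) (pcomp (spact F f) s')).
Proof.
move=> llp sz s'z [H [H0 H1 Hb]].
pose S (i : option bool) : SubPsh (nerve ('I_n.+1 *p 'I_2)) :=
  if i is Some e then sub (base full (if e then ord_max else ord0)) else sub (cyl (bd n)).
pose g (i : option bool) : sMap (nerve ('I_n.+1 *p 'I_2)) (F X) :=
  if i is Some e then pcomp (if e then s' else s) (prism_fst n) else degen_map_to _ z.
have gb m x e : sub (cyl (bd n)) m x -> g (Some e) m x = g None m x.
  by move=> /cyl_im /bdP xb; case: e; [exact: s'z | exact: sz].
have gH i m x : S i m x -> p X m (g i m x) = pcomp H (pprod_of_prism n) m x.
  rewrite -[RHS]/(H m (prism_fst n m x, prism_snd n m x)).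
  case: i => [e /base_im [_ ->]|/cyl_im /bdP xb]; last by rewrite Hb //= degen_map.
  by case: e; rewrite ?H0 ?H1.
have [||a aE] := @glue_total _ _ _ _ S g (sub (prism_bd n)).
- move=> m x /orP[h|/orP[h|h]]; [by exists None|by exists (Some false)|by exists (Some true)].
- move=> [e|] [e'|] m x //; last 2 first.
  + by move=> _ h; rewrite gb.
  + by move=> h _; rewrite gb.
  move=> /base_im [_ h] /base_im[_ h']; rewrite h in h'.
  by case: e e' h' {h} => -[] // h; [case: (@cst_neq m) | case: (@cst_neq m)].
have aS i m x (hx : sub (prism_bd n) m x) : S i m x -> a m (exist _ x hx) = g i m x by exact: aE.
apply: (locally_mono _ (LL_total (a := a) (b := pcomp H (pprod_of_prism n)) llp _)); last first.
  move=> m x h; have [i hi] : exists i, S i m x.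
    by case/orP: (h) => [h'|/orP[h'|h']]; [exists None|exists (Some false)|exists (Some true)].
  by rewrite (aS _ _ _ _ hi); exact: gH.
move=> U f [l [l1 _]]; exists (pcomp l (prism_pair n)).
have lS i m x : S i m x -> l m x = spact F f m (g i m x).
  move=> hi; have hx : sub (prism_bd n) m x.
    case: i hi => [[] h|h]; apply/orP; [by right; apply/orP; right|by right; apply/orP; left|by left].
  by rewrite (l1 _ _ hx) (aS _ _ _ _ hi).
have lE i m x t : S i m (prism_pair n m (x, t)) ->
    l m (prism_pair n m (x, t)) = spact F f m (g i m (prism_pair n m (x, t))) by exact: lS.
split=> [m x|m x|m x t xb].
- apply: etrans (lE (Some false) _ _ _ _) _; first by apply/base_im; rewrite prism_snd_pair.
  exact: (congr1 (fun y => spact F f m (s m y)) (prism_fst_pair x _)).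
- apply: etrans (lE (Some true) _ _ _ _) _; first by apply/base_im; rewrite prism_snd_pair.
  exact: (congr1 (fun y => spact F f m (s' m y)) (prism_fst_pair x _)).
- apply: etrans (lE None _ _ _ _) _; last by rewrite /= degen_map.
  by apply/cyl_im; rewrite prism_fst_pair; apply/bdP.
Qed.

Lemma hrel_act (K L : sSet) (f : sMap K L) z s s' :
  hrel z s s' -> hrel (f _ z) (pcomp f s) (pcomp f s').
Proof.
move=> [H [H0 H1 Hb]]; exists (pcomp f H); split=> m x /=; rewrite ?H0 ?H1 // => t xb.
by rewrite Hb // degen_map.
Qed.

Lemma hrel_refl (K : sSet) (z : K 0) s : on_bd z s -> hrel z s s.
Proof.
move=> sz; exists (pcomp s (pprod_fst _ _)); split=> // m x t; exact: sz.
Qed.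

Lemma on_bd_act (K L : sSet) (f : sMap K L) z s : on_bd z s -> on_bd (f _ z) (pcomp f s).
Proof. by move=> sz m x xb /=; rewrite sz // degen_map. Qed.

Definition hclass (K : sSet) (z : K 0) (s s' : sMap (simplex n) K) : Prop :=
  exists (h : on_bd z s) (h' : on_bd z s'),
    class (@rel_homotopic n K z) (exist _ s h) = class _ (exist _ s' h').

Lemma hclass_act (K L : sSet) (f : sMap K L) z s s' :
  hclass z s s' -> hclass (f _ z) (pcomp f s) (pcomp f s').
Proof.
move=> [h [h' E]]; exists (on_bd_act f h), (on_bd_act f h').
have := congr1 (pi_map (erefl (f 0 z))) E; rewrite /pi_map !quot_mapE => E'.
have E1 : sphere_map (erefl (f 0 z)) (exist _ s h) = exist _ (pcomp f s) (on_bd_act f h) by exact: sig_eq.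
have E2 : sphere_map (erefl (f 0 z)) (exist _ s' h') = exist _ (pcomp f s') (on_bd_act f h') by exact: sig_eq.
by rewrite -E1 -E2.
Qed.

Lemma hclass_trans (K : sSet) (z : K 0) s s' s'' :
  hclass z s s' -> hclass z s' s'' -> hclass z s s''.
Proof.
move=> [h [h' E]] [k [k' E']]; exists h, k'; rewrite E -E'; congr class; exact: sig_eq.
Qed.

Lemma hclass_hrel (K : sSet) (z : K 0) s s' :
  on_bd z s -> on_bd z s' -> hrel z s s' -> hclass z s s'.
Proof. by move=> h h' [H HP]; exists h, h'; apply/eq_class/rst_step; exists H. Qed.

End RelativeHomotopy.

Section SliceSite.
Variables (C : Site) (X : C).

Lemma locally_slice (a : slice_site X) (phi : forall b : slice_site X, Hom b a -> Prop) :
  locally (fun U (f : Hom U (dom a)) => phi (Over (arr a ∘ f)) (over_lift f)) ->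
  locally phi.
Proof.
move=> [S Sc SP].
have Rcl (b b' : slice_site X) (g : Hom b' b) (h : yoneda a b) :
    S (dom b) (proj1_sig h) -> S (dom b') (proj1_sig (pact (yoneda a) g h)).
  exact: sub_closed.
exists (Build_SubPsh Rcl) => [|[V g] [h hg] Sh]; last first.
  by rewrite /= in h hg Sh *; subst g; exact: SP.
rewrite /=; suff -> : @under_sieve C X a (Build_SubPsh Rcl) = S by [].
exact: SubPsh_eq.
Qed.

Lemma locally_dom (a : slice_site X) (phi : forall b : slice_site X, Hom b a -> Prop) :
  locally phi ->
  locally (fun U (f : Hom U (dom a)) => phi (Over (arr a ∘ f)) (over_lift f)).
Proof. by move=> [S Sc SP]; exists (under_sieve S) => // U f; exact: SP. Qed.

End SliceSite.

Definition yo (K : sSet) n (k : K n) : sMap (simplex n) K.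
Proof. by exists (fun m x => pact K (x : @Hom Delta m n) k) => m l f x; rewrite -pactM. Defined.

(** * Boundary lifting and homotopy sets *)

Section LocalTrivialFibration.
Variables (C : Site) (F G : SPsh C) (p : SPshMap F G).
Hypothesis llb : forall n, LL p (bd n) full.

Lemma vertex_lift X (v : G X 0) :
  locally (fun U (f : Hom U X) => exists x, p U 0 x = spact G f 0 v).
Proof.
have bd0 m (x : nerve 'I_1 m) : ~ sub (bd 0) m x.
  move=> /= /eqP; apply; apply/eqP; rewrite -subTset; apply/subsetP => j _.
  by rewrite (ord1 j) -(ord1 (x ord0)) mem_im.
have [|//|a _] := @glue_total _ (nerve 'I_1) (F X) False (fun=> sub full)
    (fun i => match i with end) (sub (bd 0)); first by move=> m x /bd0.
apply: (locally_mono _ (LL_total (a := a) (b := yo v) (@llb 0) _)) => [U f [l [_ l2]]|m x h]; last first.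
  by case: (bd0 m x).
by exists (l 0 (@hid Delta 0)); rewrite l2 /= pact1.
Qed.

Lemma path_lift X (x x' : F X 0) (e : G X 1) :
  pact (G X) (cst 0 (ord0 : 'I_2)) e = p X 0 x ->
  pact (G X) (cst 0 (ord_max : 'I_2)) e = p X 0 x' ->
  locally (fun U (f : Hom U X) => pi0_rel (spact F f 0 x) (spact F f 0 x')).
Proof.
move=> e0 e1.
pose S (i : bool) := sub (pow [set (if i then ord_max else ord0) : 'I_2]).
pose g (i : bool) : sMap (nerve 'I_2) (F X) := degen_map_to _ (if i then x' else x).
have Scst i m (y : nerve 'I_2 m) : S i m y -> y = cst m (if i then ord_max else ord0).
  move=> /subsetP h; apply: omorph_eq => j; apply/eqP; rewrite -in_set1.
  by apply: h; exact: mem_im.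
have Sbd m (y : nerve 'I_2 m) : sub (bd 1) m y -> exists i, S i m y.
  rewrite /= -subTset => /subsetPn[j _ jy]; exists (j == ord0).
  apply/subsetP => l ly; rewrite inE.
  have jl : j != l by apply: contraNneq jy => ->.
  by case: (ord2P j) (ord2P l) jl => -> [] ->.
have [||a aE] := @glue_total _ (nerve 'I_2) (F X) bool S g (sub (bd 1)) => //.
  move=> i j m y /Scst -> /Scst h; congr (g _ m _).
  by case: i j h => -[] // h; [case: (@cst_neq m) | case: (@cst_neq m)].
have bdS i m : sub (bd 1) m (cst m (if i then ord_max else ord0 : 'I_2)).
  rewrite /= -subTset; apply/subsetPn; exists (if i then ord0 else ord_max) => //.
  by apply/imsetP => -[j _]; case: i.
have SS i m : S i m (cst m (if i then ord_max else ord0)).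
  by apply/subsetP => _ /imsetP[j _ ->]; rewrite inE.
apply: (locally_mono _ (LL_total (a := a) (b := yo e) (@llb 1) _)) => [U f [l [l1 l2]]|m y h]; last first.
  have [i hi] := Sbd _ _ h; rewrite (aE _ _ _ _ hi) (Scst _ _ _ hi) /= degen_map.
  rewrite /degen; case: i {hi} => /=; rewrite -?e0 -?e1 -pactM; congr (pact _ _ e); exact: omorph_eq.
have lE i : l 0 (cst 0 (if i then ord_max else ord0)) = spact F f 0 (if i then x' else x).
  rewrite (l1 _ _ (bdS i 0)) (aE i _ _ _ (SS i 0)); apply: congr1.
  by rewrite -[RHS]pact1; congr (pact _ _ _); apply: omorph_eq => j; rewrite [LHS]ord1 [RHS]ord1.
exists (l 1 (@hid Delta 1)); rewrite -!pmap_nat; split.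
- by rewrite -(lE false); congr (l 0 _); exact: omorph_eq.
- by rewrite -(lE true); congr (l 0 _); exact: omorph_eq.
Qed.

Lemma pi0_loc_surj : loc_surj (pi0_psh_map p).
Proof.
move=> X; apply: quotW => v; apply: (locally_mono _ (vertex_lift v)) => U f [x E].
by exists (class _ x); rewrite /= /pi0_map !quot_mapE E.
Qed.

(** The inner vertices of a zigzag in G(X) lift only after restriction. The induction is therefore
    stated for lifts of the two ends over an arbitrary [V] -> [X], and transitivity lifts the middle
    vertex before splitting. *)
Lemma pi0_lift X (y y' : G X 0) : gen_equiv (@pi0_rel (G X)) y y' ->
  forall V (g : Hom V X) (x x' : F V 0), p V 0 x = spact G g 0 y -> p V 0 x' = spact G g 0 y' ->
  locally (fun W (h : Hom W V) => class (@pi0_rel (F W)) (spact F h 0 x) =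
                                  class (@pi0_rel (F W)) (spact F h 0 x')).
Proof.
elim=> {y y'} [y y' [e [e0 e1]]|y|y y' _ IH|y y' y'' _ IH _ IH'] V g x x' xE x'E.
- have := @path_lift V x x' (spact G g 1 e); rewrite xE x'E -!pmap_nat e0 e1.
  move=> /(_ erefl erefl); apply: locally_mono => W h r.
  by apply/eq_class/rst_step.
(* Two lifts of the same vertex are joined by lifting the degenerate edge. *)
- have := @path_lift V x x' (pact (G V) (omorph_const _ ord0 : @Hom Delta 1 0) (spact G g 0 y)).
  have idE (f : @Hom Delta 0 0) : f = @hid Delta 0 by apply: omorph_eq => i; rewrite [LHS]ord1 [RHS]ord1.
  rewrite -!pactM !(idE (_ ∘ _)) !pact1 xE x'E => /(_ erefl erefl).
  by apply: locally_mono => W h r; apply/eq_class/rst_step.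
- by apply: locally_mono (IH V g x' x x'E xE).
- apply: (locally_bind (vertex_lift (spact G g 0 y'))) => W h [z zE].
  have IH1 := IH W (g ∘ h) (spact F h 0 x) z; rewrite spmap_act xE zE !spactMx in IH1.
  have IH2 := IH' W (g ∘ h) z (spact F h 0 x'); rewrite spmap_act x'E zE !spactMx in IH2.
  apply: (locally_bind (IH1 erefl erefl)) => T t E.
  apply: (locally_mono _ (locally_pull t (IH2 erefl erefl))) => R r E'.
  rewrite !spactMx in E' *.
  have := congr1 (pi0_map (spact F r)) E; rewrite /pi0_map !quot_mapE => ->.
  by rewrite E'.
Qed.

Lemma pi0_loc_inj : loc_inj (pi0_psh_map p).
Proof.
move=> X x x'; elim/quotW: x => x; elim/quotW: x' => x'.
rewrite /= /pi0_map !quot_mapE => E0; have E := class_eq E0.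
have := @pi0_lift X _ _ E X (hid X) x x'; rewrite spact1 => /(_ erefl erefl).
by apply: locally_mono => U f E'; rewrite !quot_mapE.
Qed.

Lemma sphere_lift n X (z : F X 0) (b : sMap (simplex n) (G X)) : on_bd (p X 0 z) b ->
  locally (fun U (f : Hom U X) => exists2 s : sMap (simplex n) (F U),
    on_bd (spact F f 0 z) s & pcomp (p U) s = pcomp (spact G f) b).
Proof.
move=> bz; pose a : sMap (sub_psh (sub (bd n))) (F X) := degen_map_to _ z.
apply: (locally_mono _ (LL_total (a := a) (b := b) (@llb n) _)) => [U f [l [l1 l2]]|m x h]; last first.
  by rewrite /= degen_map bz //; exact/bdP.
exists l => [m x /bdP xb|]; first by rewrite (l1 _ _ xb) /= degen_map.
by apply: PshMap_eq => m x; rewrite /= l2.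
Qed.

(** The pattern of [pi0_lift] one level up: spheres and homotopies replace vertices and edges, and
    the middle sphere of a zigzag comes from [sphere_lift]. *)
Lemma hclass_lift n X (z : F X 0) (b b' : sphere n (p X 0 z)) :
  gen_equiv (@rel_homotopic n (G X) (p X 0 z)) b b' ->
  forall V (g : Hom V X) (s s' : sMap (simplex n) (F V)),
    on_bd (spact F g 0 z) s -> on_bd (spact F g 0 z) s' ->
    pcomp (p V) s = pcomp (spact G g) (proj1_sig b) ->
    pcomp (p V) s' = pcomp (spact G g) (proj1_sig b') ->
  locally (fun W (h : Hom W V) =>
    hclass (spact F h 0 (spact F g 0 z)) (pcomp (spact F h) s) (pcomp (spact F h) s')).
Proof.
have llP : LL p (prism_bd n) full by exact: LL_cells.
have hrelG V (g : Hom V X) (s s' : sMap (simplex n) (F V)) :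
    on_bd (spact F g 0 z) s -> on_bd (spact F g 0 z) s' ->
    hrel (spact G g 0 (p X 0 z)) (pcomp (p V) s) (pcomp (p V) s') ->
    locally (fun W (h : Hom W V) =>
      hclass (spact F h 0 (spact F g 0 z)) (pcomp (spact F h) s) (pcomp (spact F h) s')).
  rewrite -spmap_act => sz s'z /(lift_homotopy llP sz s'z); apply: locally_mono => W h.
  by apply: hclass_hrel; exact: on_bd_act.
elim=> {b b'} [b b' bb'|b|b b' _ IH|b b' b'' _ IH _ IH'] V g s s' sz s'z sE s'E.
- apply: hrelG => //; rewrite sE s'E; exact: hrel_act.
- apply: hrelG => //; rewrite sE s'E; apply/hrel_act/hrel_refl; exact: (proj2_sig b).
- apply: (locally_mono _ (IH V g s' s s'z sz s'E sE)) => W h [k [k' E]].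
  by exists k', k.
- have bz : on_bd (p V 0 (spact F g 0 z)) (pcomp (spact G g) (proj1_sig b')).
    rewrite spmap_act; apply: on_bd_act; exact: (proj2_sig b').
  apply: (locally_bind (sphere_lift bz)) => W h [t tz tE].
  rewrite -spactMx in tz.
  have sz' := on_bd_act (spact F h) sz; rewrite -spactMx in sz'.
  have s'z' := on_bd_act (spact F h) s'z; rewrite -spactMx in s'z'.
  have E1 r r' : pcomp (p V) r = pcomp (spact G g) r' ->
      pcomp (p W) (pcomp (spact F h) r) = pcomp (spact G (g ∘ h)) r' :> sMap (simplex n) _.
    by move=> E; rewrite pcompA spmap_nat -pcompA E spactM pcompA.
  have E2 : pcomp (p W) t = pcomp (spact G (g ∘ h)) (proj1_sig b').
    by rewrite tE spactM pcompA.
  apply: (locally_bind (IH W (g ∘ h) _ t sz' tz (E1 _ _ sE) E2)) => T k cl.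
  apply: (locally_mono _ (locally_pull k (IH' W (g ∘ h) t _ tz s'z' E2 (E1 _ _ s'E)))) => R r cl'.
  have cl2 := hclass_act (spact F r) cl.
  move: cl2 cl'; rewrite !pcompA -!spactM -!spactMx !hcompA; exact: hclass_trans.
Qed.

Lemma pi_loc_surj n X (x : F X 0) (y : G X 0) (px : p X 0 x = y) :
  loc_surj (pi_psh_map n px : @PshMap (slice_site X) _ _).
Proof.
move=> a; apply: quotW => -[b bb]; apply: locally_slice.
have bz : on_bd (p _ 0 (spact F (arr a) 0 x)) b by rewrite (spmap_base px a).
apply: (locally_mono _ (sphere_lift bz)) => U f [s sz sE].
have sz' : on_bd (spact F (arr a ∘ f) 0 x) s by rewrite spactMx.
exists (class (@rel_homotopic n _ (spact F (arr a ∘ f) 0 x)) (exist _ s sz')).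
rewrite /= /pi_map !quot_mapE; congr class; exact: sig_eq.
Qed.

Lemma pi_loc_inj n X (x : F X 0) (y : G X 0) (px : p X 0 x = y) :
  loc_inj (pi_psh_map n px : @PshMap (slice_site X) _ _).
Proof.
move=> a; apply: quotW => -[s sz]; apply: quotW => -[s' s'z].
rewrite /= /pi_map !quot_mapE => E0; have E := class_eq E0; clear E0; apply: locally_slice.
(* The base point in G is generalized and replaced by the image of the one in F, so that both kinds
   of spheres have the same type. *)
move: E; move: (spmap_base px a); move: (spact G (arr a) 0 y) => w pw; subst w => E.
have zE : spact F (hid _) 0 (spact F (arr a) 0 x) = spact F (arr a) 0 x by rewrite spact1.
have e1 : on_bd (spact F (hid (dom a)) 0 (spact F (arr a) 0 x)) s by rewrite zE.
have e2 : on_bd (spact F (hid (dom a)) 0 (spact F (arr a) 0 x)) s' by rewrite zE.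
have e3 (t : sMap (simplex n) (F (dom a))) :
    pcomp (p (dom a)) t = pcomp (spact G (hid (dom a))) (pcomp (p (dom a)) t).
  by rewrite spact1 pcomp1r.
apply: (locally_mono _ (hclass_lift E e1 e2 (e3 s) (e3 s'))) => U f.
rewrite zE => -[h [h' cl]]; rewrite /= !quot_mapE.
move: (spact_over _ _) => /=; move: (spact F (arr a ∘ f) 0 x) => w' fw; subst w'.
apply: etrans (etrans _ cl) _; congr class; exact: sig_eq.
Qed.

End LocalTrivialFibration.

Lemma local_acyclic_fibration_of_LL (C : Site) (F G : SPsh C) (p : SPshMap F G) :
  (forall n, LL p (bd n) full) -> local_acyclic_fibration p.
Proof.
move=> llb; split; last first.
  by apply/local_fibrationP => n k _; exact: LL_cells.
have llq n : LL (ExInf_psh_map p) (bd n) full by apply: ExInf_LL => i; exact: Ex_iter_LL_bd.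
split=> [|X x n _]; apply/iso_on_sheafificationP; split.
- exact: pi0_loc_inj.
- exact: pi0_loc_surj.
- exact: pi_loc_inj.
- exact: pi_loc_surj.
Qed.

(** * Acyclic fibrations have boundary liftings *)

Definition pprod_map (C : Category) (P P' Q Q' : Psh C) (f : PshMap P P') (g : PshMap Q Q') :
  PshMap (pprod P Q) (pprod P' Q').
Proof.
by exists (fun U x => (f U x.1, g U x.2)) => U V h x; rewrite /= !pmap_nat.
Defined.

Definition pprod_cst n (e : 'I_2) : sMap (simplex n) (pprod (simplex n) (simplex 1)).
Proof.
exists (fun m t => (t, cst m e)) => m l f t.
by rewrite /=; congr pair; exact: omorph_eq.
Defined.

Lemma glue3 (C : Category) (P K : Psh C) (S0 S1 S2 T : SubPsh P) (f0 f1 f2 : PshMap P K) :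
  (forall U x, T U x -> [\/ S0 U x, S1 U x | S2 U x]) ->
  (forall U x, S0 U x -> S1 U x -> f0 U x = f1 U x) ->
  (forall U x, S0 U x -> S2 U x -> f0 U x = f2 U x) ->
  (forall U x, S1 U x -> S2 U x -> f1 U x = f2 U x) ->
  exists g : PshMap (sub_psh T) K, forall U x h,
    [/\ S0 U x -> g U (exist _ x h) = f0 U x,
        S1 U x -> g U (exist _ x h) = f1 U x
      & S2 U x -> g U (exist _ x h) = f2 U x].
Proof.
move=> cov f01 f02 f12.
pose S (i : option bool) := match i with None => S0 | Some false => S1 | _ => S2 end.
pose f (i : option bool) := match i with None => f0 | Some false => f1 | _ => f2 end.
have [||g gP] := @glue_total C P K _ S f T.
- by move=> U x /cov [h|h|h]; [exists None | exists (Some false) | exists (Some true)].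
- case=> [[]|] [[]|] U x //= h h'; try by [exact: f01|exact: f02|exact: f12].
  + by rewrite f12.
  + by rewrite f02.
  + by rewrite f01.
- exists g => U x h; split=> h'; [exact: (gP None)|exact: (gP (Some false))|exact: (gP (Some true))].
Qed.

(** The union of the faces opposite to the vertices in [D]: boundary, horn and single face are the
    cases [predT], [predC1 k] and [pred1 j]. *)
Definition miss n (D : pred 'I_n.+1) : SubPsh (simplex n).
Proof.
exists (fun m (t : simplex n m) => exists2 j, D j & forall i, t i != j).
by move=> m l f t [j Dj tj]; exists j => // i; exact: tj.
Defined.

Lemma miss_bd n m (t : simplex n m) : sub (bd n) m t <-> miss predT m t.
Proof.
rewrite bdP; split=> [[j tj]|[j _ tj]]; [by exists j|by exists j].
Qed.

Lemma miss_hn n (k : 'I_n.+1) m (t : simplex n m) : sub (hn k) m t <-> miss (predC1 k) m t.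
Proof. by rewrite hn_sub; split=> [[j jk tj]|[j jk tj]]; exists j. Qed.

Lemma missW n (D : pred 'I_n.+1) m (t : simplex n m) : miss D m t -> boundary n m t.
Proof. by move=> [j _ tj]; exists j. Qed.

Lemma LL_prism_full (C : Site) (F G : SPsh C) (p : SPshMap F G) n (T : cplx 'I_n.+1) e :
  (forall n k, 0 < n -> LL p (@hn n k) full) -> LL p (box T full e) full.
Proof.
move=> llh; apply: (@LL_trans _ _ _ _ _ _ _ (cyl full)) => //; first exact: LL_prism.
by apply: LL_same.
Qed.

Lemma prism_level n (D : cplx 'I_n.+1) e m (y : nerve ('I_n.+1 *p 'I_2) m) :
  sub (base D e) m y -> y = prism_pair n m (prism_fst n m y, cst m e).
Proof. by move=> /base_im [_ <-]; rewrite prism_pairK. Qed.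

Lemma LL_pt_total (C : Site) (E : SPsh C) d (P : finPOrderType d) (S : cplx P)
    X (a : sMap (sub_psh (sub S)) (E X)) :
  LL (to_pt E) S full ->
  locally (fun U (f : Hom U X) => exists l : sMap (nerve P) (E U),
    forall m x h, l m x = spact E f m (a m (exist _ x h))).
Proof.
move=> llp; pose b : sMap (nerve P) (pt_psh C X) := @Build_PshMap _ (nerve P) (pconst Delta unit)
  (fun _ _ => tt) (fun _ _ _ _ => erefl).
apply: (locally_mono _ (LL_total (a := a) (b := b) llp _)) => // U f [l [l1 _]].
by exists l.
Qed.

Section FaceDegeneracy.
Variables (N : nat) (i : 'I_N.+1).

Lemma sdeg_lt (j : 'I_N.+2) : unbump i j < N.+1.
Proof. rewrite /unbump; have := ltn_ord i; have := ltn_ord j; case: (ltnP i j) => /=; lia. Qed.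

Lemma sdeg_le : {homo (fun j => Ordinal (sdeg_lt j)) : j l / (j <= l)%O}.
Proof.
move=> j l; rewrite !leEord /= => jl.
rewrite /unbump; case: (ltnP i j) => /=; case: (ltnP i l) => /=; lia.
Qed.

(** The codegeneracy that identifies i and i + 1. *)
Definition sdeg : {omorphism 'I_N.+2 -> 'I_N.+1} := omorph_mk sdeg_le.

Lemma last_face_le : {homo @widen_ord N.+1 N.+2 (leqnSn _) : j l / (j <= l)%O}.
Proof. by []. Qed.

Definition last_face : {omorphism 'I_N.+1 -> 'I_N.+2} := omorph_mk last_face_le.

End FaceDegeneracy.

Arguments last_face {N}.

Definition post n l (f : {omorphism 'I_n.+1 -> 'I_l.+1}) : sMap (simplex n) (simplex l) :=
  nerve_map f.

(** * Spheres that bound a simplex *)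

Section Bounds.
Variables (C : Site) (E : SPsh C).
Hypothesis E_kan : forall n k, 0 < n -> LL (to_pt E) (@hn n k) full.
Variable m : nat.

(** The face of [b] opposite to the last vertex is [s] and the other faces are constant. On
    simplices that miss the last vertex, [sdeg ord_max] inverts the inclusion of that face. *)
Definition bounds (K : sSet) (x : K 0) (s : sMap (simplex m) K) : Prop :=
  exists b : sMap (simplex m.+1) K,
    (forall k t, miss (pred1 ord_max) k t -> b k t = s k (post (sdeg ord_max) k t)) /\
    (forall k t, miss (predC1 ord_max) k t -> b k t = degen x k).

Lemma bounds_const (K : sSet) (x : K 0) : bounds x (degen_map_to (simplex m) x).
Proof. by exists (degen_map_to (simplex m.+1) x). Qed.

Lemma miss_sdeg_last k (t : simplex m.+1 k) :
  miss (pred1 ord_max) k t -> miss (predC1 ord_max) k t ->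
  boundary m k (post (sdeg ord_max) k t).
Proof.
move=> [_ /eqP -> tm] [j /= jm tj].
have jlt : j < m.+1 by move: jm (ltn_ord j); rewrite -(inj_eq val_inj) /=; lia.
exists (Ordinal jlt) => i; have := tj i; have := tm i; rewrite -!(inj_eq val_inj) /= /unbump.
have := ltn_ord (t i); move: (nat_of_ord (t i)) (nat_of_ord j) jlt.
lia.
Qed.

(** On the box, take [b] at the end [e], the homotopy over the last face and the constant elsewhere.
    The Kan condition extends this to the prism, whose end [e'] bounds [s']. *)
Lemma bounds_step X (x : E X 0) (s s' : sMap (simplex m) (E X)) e e' :
  (exists H : sMap (pprod (simplex m) (simplex 1)) (E X),
    [/\ forall k t, H k (t, cst k e) = s k t,
        forall k t, H k (t, cst k e') = s' k t
      & forall k t u, boundary m k t -> H k (t, u) = degen x k]) ->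
  bounds x s ->
  locally (fun U (f : Hom U X) => bounds (spact E f 0 x) (pcomp (spact E f) s')).
Proof.
move=> [H [He He' Hb]] [b [b1 b2]].
pose n := m.+1.
pose H' : sMap (nerve ('I_n.+1 *p 'I_2)) (E X) :=
  pcomp H (pcomp (pprod_map (post (sdeg ord_max)) (pid _)) (pprod_of_prism n)).
pose S0 := sub (base (@full _ 'I_n.+1) e).
pose S1 := sub (cyl (pow [set~ (ord_max : 'I_n.+1)])).
pose S2 := sub (cyl (hn (ord_max : 'I_n.+1))).
have S1P k y : S1 k y <-> miss (pred1 ord_max) k (prism_fst n k y).
  rewrite /S1 cyl_im; split=> [/subsetP h|[_ /eqP -> h]].
    by exists ord_max => /= [|i]; [exact: eqxx|have := h _ (mem_im _ i); rewrite !inE].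
  by apply/subsetP => _ /imsetP[i _ ->]; rewrite !inE.
have S2P k y : S2 k y <-> miss (predC1 ord_max) k (prism_fst n k y).
  by rewrite /S2 cyl_im miss_hn.
have H'E k y : H' k y = H k (post (sdeg ord_max) k (prism_fst n k y), prism_snd n k y) by [].
have [||||a aP] := @glue3 _ _ _ S0 S1 S2 (sub (box (bd n) full e))
    (pcomp b (prism_fst n)) H' (degen_map_to _ x).
- move=> k y /orP[/cyl_im/miss_bd[j _ yj]|h]; last by apply: Or31.
  have [jm|jm] := eqVneq j ord_max; [apply: Or32; apply/S1P|apply: Or33; apply/S2P]; exists j => //.
  exact/eqP.
- move=> k y /base_im [_ ye] /S1P h; rewrite H'E ye He; exact: b1.
- by move=> k y _ /S2P h; exact: b2.
- by move=> k y /S1P h /S2P h'; rewrite H'E Hb //; exact: miss_sdeg_last.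
have llb : LL (to_pt E) (box (bd n) full e) full by exact: LL_prism_full.
apply: (locally_mono _ (LL_pt_total a llb)) => U f [l lP].
have lE k y : sub (box (bd n) full e) k y ->
    [/\ S0 k y -> l k y = spact E f k (b k (prism_fst n k y)),
        S1 k y -> l k y = spact E f k (H' k y)
      & S2 k y -> l k y = spact E f k (degen x k)].
  by move=> h; rewrite (lP _ _ h); have [h0 h1 h2] := aP k y h; split=> [/h0->|/h1->|/h2->].
have pairS k t : miss predT k t -> sub (box (bd n) full e) k (prism_pair n k (t, cst k e')).
  by move=> h; apply/orP; left; apply/cyl_im; rewrite prism_fst_pair; apply/miss_bd.
exists (pcomp l (pcomp (prism_pair n) (pprod_cst n e'))); split=> k t h.
- have [|_ l1 _] := lE k (prism_pair n k (t, cst k e')).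
    by apply: pairS; case: h => j _ tj; exists j.
  apply: etrans (l1 _) _; first by apply/S1P; rewrite prism_fst_pair.
  by rewrite H'E prism_fst_pair prism_snd_pair He'.
- have [|_ _ l2] := lE k (prism_pair n k (t, cst k e')).
    by apply: pairS; case: h => j _ tj; exists j.
  apply: etrans (l2 _) _; last by rewrite degen_map.
  by apply/S2P; rewrite prism_fst_pair.
Qed.

(** An equivalence, since the steps of a zigzag are traversed in both directions; likewise
    [vertex_chain] and [over_chain]. *)
Lemma bounds_chain X (x : E X 0) (s s' : sMap (simplex m) (E X)) :
  gen_equiv (@hrel m (E X) x) s s' ->
  locally (fun U (f : Hom U X) => bounds (spact E f 0 x) (pcomp (spact E f) s)) <->
  locally (fun U (f : Hom U X) => bounds (spact E f 0 x) (pcomp (spact E f) s')).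
Proof.
elim=> {s s'} [s s' ss'|s|s s' _ IH|s s' s'' _ IH _ IH'].
- split=> h; apply: (locally_bind h) => U f hf.
  + have [H [H0 H1 Hb]] := hrel_act (spact E f) ss'.
    have := @bounds_step U _ _ (pcomp (spact E f) s') ord0 ord_max (ex_intro _ H (And3 H0 H1 Hb)) hf.
    by apply: locally_mono => V g; rewrite spactM pcompA.
  + have [H [H0 H1 Hb]] := hrel_act (spact E f) ss'.
    have := @bounds_step U _ _ (pcomp (spact E f) s) ord_max ord0 (ex_intro _ H (And3 H1 H0 Hb)) hf.
    by apply: locally_mono => V g; rewrite spactM pcompA.
- by [].
- by rewrite IH.
- by rewrite IH.
Qed.

End Bounds.

Definition pprod_snd (C : Category) (P Q : Psh C) : PshMap (pprod P Q) Q.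
Proof. by exists (fun U x => x.2). Defined.

(** * Homotopy lifting along a local fibration *)

Section FibrationLifts.
Variables (C : Site) (E B : SPsh C) (q : SPshMap E B).
Hypothesis q_fib : forall n k, 0 < n -> LL q (@hn n k) full.

Lemma edge_lift X (x : E X 0) (e : B X 1) (k k' : 'I_2) :
  pact (B X) (cst 0 k) e = q X 0 x ->
  locally (fun U (f : Hom U X) => exists x', q U 0 x' = spact B f 0 (pact (B X) (cst 0 k') e)).
Proof.
move=> ex; pose a : sMap (sub_psh (sub (hn k))) (E X) := degen_map_to _ x.
(* The horn of Delta^1 at k is the vertex k. *)
have bE m y : sub (hn k) m y -> y = cst m k.
  move=> /miss_hn[j /= jk yj]; apply: omorph_eq => i.
  by have := yj i; case: (ord2P k) (ord2P j) (ord2P (y i)) jk => -> [] -> [] ->.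
apply: (locally_mono _ (LL_total (a := a) (b := yo e) (@q_fib 1 k isT) _)) => [U f [l [_ l2]]|m y h].
  by exists (l 0 (cst 0 k')); rewrite l2.
rewrite /= degen_map -ex (bE _ _ h) /degen -pactM; congr (pact _ _ e); exact: omorph_eq.
Qed.

Lemma vertex_chain X (y y' : B X 0) : gen_equiv (@pi0_rel (B X)) y y' ->
  locally (fun U (f : Hom U X) => exists x, q U 0 x = spact B f 0 y) <->
  locally (fun U (f : Hom U X) => exists x, q U 0 x = spact B f 0 y').
Proof.
elim=> {y y'} [y y' [e [e0 e1]]|y|y y' _ IH|y y' y'' _ IH _ IH'].
- have step k k' : locally (fun U (f : Hom U X) => exists x, q U 0 x = spact B f 0 (pact (B X) (cst 0 k) e)) ->
      locally (fun U (f : Hom U X) => exists x, q U 0 x = spact B f 0 (pact (B X) (cst 0 k') e)).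
    move=> h; apply: (locally_bind h) => U f [x xE].
    have := @edge_lift U x (spact B f 1 e) k k'; rewrite -pmap_nat -xE => /(_ erefl).
    by apply: locally_mono => V g; rewrite -pmap_nat spactMx.
  by rewrite -e0 -e1; split; exact: step.
- by [].
- by rewrite IH.
- by rewrite IH.
Qed.

Variable n : nat.

(** The lift [be] is prescribed at the end [e] and, independently of the second coordinate, over the
    boundary; there [H] is constant, so the square commutes. The other end of the lifted prism is
    [be']. *)
Lemma over_step X (y : B X 0) (b b' : sMap (simplex n) (B X)) (be : sMap (simplex n) (E X)) e e' :
  (exists H : sMap (pprod (simplex n) (simplex 1)) (B X),
    [/\ forall k t, H k (t, cst k e) = b k t,
        forall k t, H k (t, cst k e') = b' k t
      & forall k t u, boundary n k t -> H k (t, u) = degen y k]) ->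
  pcomp (q X) be = b ->
  locally (fun U (f : Hom U X) => exists be' : sMap (simplex n) (E U),
    (forall k t, boundary n k t -> be' k t = spact E f k (be k t)) /\
    pcomp (q U) be' = pcomp (spact B f) b').
Proof.
move=> [H [He He' Hb]] qbe.
have qbeE k t : q X k (be k t) = b k t by rewrite -qbe.
pose a : sMap (sub_psh (sub (box (bd n) full e))) (E X) :=
  pcomp (pcomp be (prism_fst n)) (sub_incl _).
have llb : LL q (box (bd n) full e) full by exact: LL_prism_full.
apply: (locally_mono _ (LL_total (a := a) (b := pcomp H (pprod_of_prism n)) llb _)); last first.
  move=> k z h; rewrite [LHS]qbeE.
  rewrite -[RHS]/(H k (prism_fst n k z, prism_snd n k z)).
  case/orP: (h) => [/cyl_im /bdP h'|/base_im[_ ->]]; last by rewrite He.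
  by rewrite Hb // -He Hb.
move=> U f [l [l1 l2]].
exists (pcomp l (pcomp (prism_pair n) (pprod_cst n e'))); split=> [k t tb|].
- have h : sub (box (bd n) full e) k (prism_pair n k (t, cst k e')).
    by apply/orP; left; apply/cyl_im; rewrite prism_fst_pair; apply/bdP.
  apply: etrans (l1 _ _ h) _.
  exact: (congr1 (fun z => spact E f k (be k z)) (prism_fst_pair t _)).
- apply: PshMap_eq => k t; apply: etrans (l2 _ _) _.
  rewrite -[LHS]/(spact B f k (H k (prism_fst n k (prism_pair n k (t, cst k e')),
    prism_snd n k (prism_pair n k (t, cst k e'))))).
  by rewrite prism_fst_pair prism_snd_pair He'.
Qed.

Definition over X (a : sMap (sub_psh (sub (bd n))) (E X)) (b : sMap (simplex n) (B X)) : Prop :=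
  locally (fun U (f : Hom U X) => exists be : sMap (simplex n) (E U),
    (forall k t h, be k t = spact E f k (a k (exist _ t h))) /\
    pcomp (q U) be = pcomp (spact B f) b).

Lemma over_chain X (a : sMap (sub_psh (sub (bd n))) (E X)) (y : B X 0) b b' :
  gen_equiv (@hrel n (B X) y) b b' -> over a b <-> over a b'.
Proof.
elim=> {b b'} [b b' bb'|b|b b' _ IH|b b' b'' _ IH _ IH'].
- split=> h; apply: (locally_bind h) => U f [be [be1 be2]];
    have [H [H0 H1 Hb]] := hrel_act (spact B f) bb'.
  + have := over_step (ex_intro _ H (And3 H0 H1 Hb)) be2.
    apply: locally_mono => V g [be' [be'1 be'2]]; exists be'; split=> [k t tb|].
      by rewrite be'1 ?(be1 _ _ tb) ?spactMx //; exact/bdP.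
    by rewrite be'2 spactM pcompA.
  + have := over_step (ex_intro _ H (And3 H1 H0 Hb)) be2.
    apply: locally_mono => V g [be' [be'1 be'2]]; exists be'; split=> [k t tb|].
      by rewrite be'1 ?(be1 _ _ tb) ?spactMx //; exact/bdP.
    by rewrite be'2 spactM pcompA.
- by [].
- by rewrite IH.
- by rewrite IH.
Qed.

End FibrationLifts.

(** * Subtracting a sphere by filling a horn *)

Section FaceSwap.
Variables (C : Site) (E B : SPsh C) (q : SPshMap E B).
Hypothesis q_fib : forall n k, 0 < n -> LL q (@hn n k) full.
Variable m : nat.

Let top : 'I_m.+2 := ord_max.
Let mid : 'I_m.+2 := inord m.
(** The codegeneracy identifying m and m + 1. The faces m and m + 1 of Delta^(m+2) both map
    isomorphically to Delta^(m+1), so [be] and [de] fit side by side over the degenerate simplex as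
    soon as they have the same image in B. *)
Let dg := post (sdeg mid).

Lemma mid_val : mid = m :> nat.
Proof. by rewrite inordK. Qed.

Definition low : pred 'I_m.+3 := fun j => (j < m)%N.

Lemma inord_m : (inord m : 'I_m.+3) = m :> nat.
Proof. by rewrite inordK //; lia. Qed.

Lemma inord_mS : (inord m.+1 : 'I_m.+3) = m.+1 :> nat.
Proof. by rewrite inordK //; lia. Qed.

Lemma miss_dg k (t : simplex m.+2 k) :
  [/\ miss (pred1 (inord m.+1)) k t -> miss (pred1 (inord m)) k t -> miss (predC1 top) k (dg k t)
    & miss low k t -> miss (predC1 top) k (dg k t)].
Proof.
split=> [[j1 /eqP -> h1] [j2 /eqP -> h2]|[j jm h]].
- exists mid => [|i]; rewrite /= -(inj_eq val_inj) /= mid_val; first by lia.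
  have := h1 i; have := h2 i; rewrite -!(inj_eq val_inj) /= inord_m inord_mS.
  by rewrite /unbump; move: (nat_of_ord (t i)); lia.
- have jlt : j < m.+2 by move: jm; rewrite /low; lia.
  exists (Ordinal jlt) => [|i]; rewrite /= -(inj_eq val_inj) /=.
    by move: jm; rewrite /low; lia.
  have := h i; rewrite -!(inj_eq val_inj) /= mid_val.
  by move: jm; rewrite /low /unbump; move: (nat_of_ord (t i)) (nat_of_ord j); lia.
Qed.

(* A horn of dimension m.+2 with faces be (at m.+1), de (at m) and x, over the
   degeneracy at m of q be = q de; the face filled in is over q x. *)
Lemma face_swap X (x : E X 0) (be de : sMap (simplex m.+1) (E X)) :
  pcomp (q X) be = pcomp (q X) de -> on_bd x de ->
  (forall k t, miss (predC1 top) k t -> be k t = degen x k) ->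
  locally (fun U (f : Hom U X) => exists ga : sMap (simplex m.+1) (E U),
    (forall k t, boundary m.+1 k t -> ga k t = spact E f k (be k t)) /\
    (forall k t, q U k (ga k t) = degen (spact B f 0 (q X 0 x)) k)).
Proof.
move=> qbd dex bex.
pose S0 := miss (pred1 (inord m.+1 : 'I_m.+3)).
pose S1 := miss (pred1 (inord m : 'I_m.+3)).
pose S2 := miss low.
have qE k t : q X k (be k t) = q X k (de k t).
  exact: (congr1 (fun c : sMap _ _ => c k t) qbd).
have [||||a aP] := @glue3 _ _ _ S0 S1 S2 (sub (hn (ord_max : 'I_m.+3)))
    (pcomp be dg) (pcomp de dg) (degen_map_to _ x).
- move=> k t /miss_hn[j /= jm tj].
  have [jl|jl] := boolP (low j); first by apply: Or33; exists j.
  have [jE|jE] := eqVneq j (inord m); first by apply: Or32; exists j => //; exact/eqP.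
  apply: Or31; exists j => //=; move: jm jl jE; rewrite /low -!(inj_eq val_inj) /= inord_m inord_mS.
  by have := ltn_ord j; lia.
- move=> k t h h'; have [d01 d2] := miss_dg t.
  rewrite [LHS]bex ?[RHS]dex //; [exact: missW (d01 h h') | exact: d01].
- move=> k t _ h; have [_ d2] := miss_dg t; rewrite [LHS]bex //; exact: d2.
- move=> k t _ h; have [_ d2] := miss_dg t; rewrite [LHS]dex //; exact: missW (d2 h).
apply: (locally_mono _ (LL_total (a := a) (b := pcomp (pcomp (q X) be) dg)
   (@q_fib m.+2 ord_max isT) _)); last first.
  move=> k t h; have [a0 a1 a2] := aP k t h; have [d01 d2] := miss_dg t.
  case: (pselect (S0 k t)) => [h0|n0]; first by rewrite a0.
  case: (pselect (S1 k t)) => [h1|n1]; first by rewrite a1 //= qE.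
  have h2 : S2 k t.
    case/miss_hn: (h) => j /= jm tj; exists j => //; apply: contraT => jl.
    have [jE|jE] := eqVneq j (inord m); first by case: n1; exists j => //; exact/eqP.
    case: n0; exists j => //=; move: jm jl jE; rewrite /low -!(inj_eq val_inj) /= inord_m inord_mS.
    by have := ltn_ord j; lia.
  by rewrite a2 //= bex //; exact: d2.
move=> U f [l [l1 l2]].
pose fc := post (@last_face m.+1).
exists (pcomp l fc); split=> k t.
- move=> [j tj].
  have h : sub (hn (ord_max : 'I_m.+3)) k (fc k t).
    apply/miss_hn; exists (last_face j) => [|i]; rewrite /= -(inj_eq val_inj) /=.
      by have := ltn_ord j; lia.
    exact: tj.
  have [a0 a1 a2] := aP _ _ h.
  apply: etrans (l1 _ _ h) _; congr (spact E f k _).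
  have mis (D : pred 'I_m.+3) : D (last_face j) -> miss D k (fc k t).
    by move=> Dj; exists (last_face j) => // i; rewrite -(inj_eq val_inj); exact: tj.
  have [jt|jt] := eqVneq j top.
    rewrite a0; last by apply: mis; rewrite /= jt -(inj_eq val_inj) /= inord_mS.
    rewrite /=; congr (be k _); apply: omorph_eq => i; apply: val_inj; rewrite /= mid_val.
    by have := tj i; rewrite jt -(inj_eq val_inj) /= /unbump; have := ltn_ord (t i);
       move: (nat_of_ord (t i)); lia.
  rewrite (bex _ t); last by exists j.
  have [jm|jm] := eqVneq (nat_of_ord j) m.
    rewrite a1; last by apply: mis; rewrite /= -(inj_eq val_inj) /= inord_m jm.
    rewrite /= dex //; exists top => i; rewrite -(inj_eq val_inj) /= mid_val.
    by have := tj i; rewrite -(inj_eq val_inj) /= jm /unbump; have := ltn_ord (t i);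
       move: (nat_of_ord (t i)); lia.
  rewrite a2 //; apply: mis; rewrite /low /=.
  by move: jt jm; rewrite -(inj_eq val_inj) /=; have := ltn_ord j; lia.
(* The last face followed by [dg] misses the top vertex; there q [be] = q [de] is constant because
   [de] is constant on the boundary. *)
- apply: etrans (l2 _ _) _; rewrite /= qE dex ?degen_map //.
  exists top => i; rewrite -(inj_eq val_inj) /= mid_val /unbump.
  by have := ltn_ord (t i); move: (nat_of_ord (t i)); lia.
Qed.

End FaceSwap.

(** * Contraction of a square to its last vertex *)

Section Contraction.
Variable n : nat.

Lemma contract_le : {homo (fun x : 'I_n.+1 *p 'I_2 => if x.2 == ord0 then x.1 else ord_max) :
  x y / (x <= y)%O}.
Proof.
move=> [i e] [j f]; rewrite leEprod => /andP[/= ij ef].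
case: (ord2P e) (ord2P f) ef => -> [] -> //= _; exact: leq_ord.
Qed.

(** The homotopy from the identity of Delta^n, at level 0, to the constant map at the last
    vertex. *)
Definition contract : sMap (nerve ('I_n.+1 *p 'I_2)) (simplex n) := nerve_map (omorph_mk contract_le).

Lemma contract0 m t : contract m (prism_pair n m (t, cst m ord0)) = t.
Proof. exact: omorph_eq. Qed.

Lemma contract1 m t : contract m (prism_pair n m (t, cst m ord_max)) = cst m ord_max.
Proof. exact: omorph_eq. Qed.

(** A face containing the last vertex is preserved by the contraction, so horn x Delta^1 stays in
    the boundary. The face opposite to the last vertex does not, which is why the lift over it has
    to be constructed. *)
Lemma contract_miss m y : miss (predC1 ord_max) m (prism_fst n m y) -> boundary n m (contract m y).
Proof.
move=> [j /= jm yj]; exists j => i /=; case: ifP => _; last by rewrite eq_sym.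
exact: yj.
Qed.

End Contraction.

Section Acyclicity.
Variables (C : Site) (E B : SPsh C) (q : SPshMap E B).
Hypothesis q_fib : forall n k, 0 < n -> LL q (@hn n k) full.

(* The given square is contracted to its last vertex, and the lift found there is
   carried back along the contraction. *)
Lemma LL_bd_contract m :
  (forall X (x : E X 0) (a : sMap (sub_psh (sub (bd m.+1))) (E X)),
     (forall k t h, q X k (a k (exist _ t h)) = degen (q X 0 x) k) ->
     (forall k t h, miss (predC1 ord_max) k t -> a k (exist _ t h) = degen x k) ->
     over q a (degen_map_to _ (q X 0 x))) ->
  LL q (bd m.+1) full.
Proof.
pose n := m.+1; move=> main X al b' ab.
pose b : sMap (simplex n) (B X) := pcomp b' (sub_total (@full_mem _ 'I_n.+1)).
have {ab} ab k t h : q X k (al k (exist _ t h)) = b k t by rewrite /= (ab _ _ h (full_mem t)).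
pose top : 'I_n.+1 := ord_max.
have hnbd (D : {set 'I_n.+1}) : hn top D -> bd n D.
  move=> /= /orP[/eqP->|/existsP[j /andP[_ jD]]]; first exact: (face0 (bd n)).
  by apply: contra jD => /eqP ->; rewrite inE.
have hS k y : sub (box (hn top) (bd n) ord0) k y -> sub (bd n) k (contract n k y).
  move=> /orP[/cyl_im/miss_hn/contract_miss/bdP //|h].
  rewrite (prism_level h) contract0; by case/base_im: h.
have a0N k l (f : @Hom Delta l k) (y : sub_psh (sub (box (hn top) (bd n) ord0)) k) :
    al l (exist _ _ (hS l _ (proj2_sig (pact (sub_psh (sub (box (hn top) (bd n) ord0))) f y)))) =
    pact (E X) f (al k (exist _ _ (hS k _ (proj2_sig y)))).
  by rewrite -pmap_nat; apply: sub_app; rewrite -pmap_nat.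
(* The map [al] composed with the contraction is defined over the horn and at level 0; homotopy
   lifting extends it to all of the boundary x Delta^1, over the contracted [b]. *)
have llc : LL q (box (hn top) (bd n) ord0) (cyl (bd n)) by exact: LL_prism.
have [|Z Zc ZP] := llc X (Build_PshMap a0N) (pcomp (pcomp b (contract n)) (sub_incl _)).
  by move=> k y hs ht; rewrite /= ab.
suff : locally (fun U (f : Hom U X) => exists l : sMap (simplex n) (E U),
    (forall k t h, l k t = spact E f k (al k (exist _ t h))) /\
    pcomp (q U) l = pcomp (spact B f) b).
  apply: locally_mono => U f [l [l1 l2]]; exists (pcomp l (sub_incl _)).
  split=> [k t hs ht|k [t ht]]; first exact: l1.
  apply: etrans (congr1 (fun c : sMap _ _ => c k t) l2) _.
  by rewrite /=; congr (spact B f k _); exact: sub_app.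
have Zl : locally (fun U (f : Hom U X) => Z U f) by exists Z.
apply: (locally_bind Zl) => U f /ZP [A [A1 A2]].
have cylP k t e : sub (bd n) k t -> sub (cyl (bd n)) k (prism_pair n k (t, cst k e)).
  by move=> h; apply/cyl_im; rewrite prism_fst_pair.
(* The restriction to level 1: a boundary over a constant simplex, itself constant on the horn, as
   the hypothesis requires. *)
have ApN k l (g : @Hom Delta l k) (t : sub_psh (sub (bd n)) k) :
   A l (exist _ _ (cylP l _ ord_max (proj2_sig (pact (sub_psh (sub (bd n))) g t)))) =
   pact (E U) g (A k (exist _ _ (cylP k _ ord_max (proj2_sig t)))).
  rewrite -pmap_nat; apply: sub_app; exact: omorph_eq.
pose al' := Build_PshMap ApN.
have topbd k : sub (bd n) k (cst k top).
  by apply/miss_bd; exists ord0 => // i; rewrite -(inj_eq val_inj).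
pose x : E U 0 := spact E f 0 (al 0 (exist _ _ (topbd 0))).
have degen_top (K : sSet) (c : sMap (simplex n) K) k : c k (cst k top) = degen (c 0 (cst 0 top)) k.
  by rewrite -[RHS]pmap_nat; congr (c k _); exact: omorph_eq.
have xE k h : spact E f k (al k (exist _ (cst k top) h)) = degen x k.
  rewrite /x -degen_map /degen -[pact _ _ (al _ _)]pmap_nat; congr (spact E f k _).
  by apply: sub_app; exact: omorph_eq.
have qx k : spact B f k (b k (cst k top)) = degen (q U 0 x) k.
  by rewrite -degen_map -(xE k (topbd k)) spmap_act ab.
have main' := main U x al'.
apply: (locally_bind (main' _ _)).
- move=> k t h; rewrite [LHS]A2 -qx; congr (spact B f k (b k _)); exact: contract1.
- move=> k t h tm.
  have hb : sub (box (hn top) (bd n) ord0) k (prism_pair n k (t, cst k ord_max)).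
    by apply/orP; left; apply/cyl_im; rewrite prism_fst_pair; apply/miss_hn.
  apply: etrans (A1 _ _ hb _) _; rewrite -(xE k (topbd k)).
  congr (spact E f k _); exact: (sub_app al _ _ (contract1 t)).
move=> V g [ga [ga1 ga2]].
have qx' k : spact B g k (spact B f k (b k (cst k top))) = degen (spact B g 0 (q U 0 x)) k.
  by rewrite qx degen_map.
have qga k t : q V k (ga k t) = degen (spact B g 0 (q U 0 x)) k.
  apply: etrans (congr1 (fun c : sMap _ _ => c k t) ga2) _.
  by rewrite /= degen_map.
(* The lift [ga] at level 1 and [A] on the sides form a box; lifting it over the contracted [b] and
   restricting to level 0 solves the original square. *)
pose S (i : bool) := if i then sub (base (@full _ 'I_n.+1) ord_max) else sub (cyl (bd n)).
pose g0 (i : bool) : sMap (sub_psh (S i)) (E V) :=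
  match i with
  | true => pcomp (pcomp ga (prism_fst n)) (sub_incl _)
  | false => pcomp (spact E g) A
  end.
have [||a aP] := @glue _ _ _ _ S g0 (sub (box (bd n) full ord_max)).
- by move=> k y /orP[h|h]; [exists false|exists true].
- have agr k y h h' : g0 true k (exist _ y h) = g0 false k (exist _ y h').
    have hy : sub (bd n) k (prism_fst n k y) by apply/cyl_im.
    rewrite /= (ga1 _ _ hy) /=; congr (spact E g k _).
    exact: (sub_app A _ _ (esym (prism_level h))).
  case=> [] [] k y h h' //; try exact: sub_app.
have llb : LL q (box (bd n) full ord_max) full by exact: LL_prism_full.
have aB k y h : q V k (a k (exist _ y h)) = spact B (f ∘ g) k (b k (contract n k y)).
  rewrite spactMx; case/orP: (h) => h'.
    rewrite (aP false _ _ h' h) /= spmap_act A2; congr (spact B g k _).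
  rewrite (aP true _ _ h' h) [LHS]qga -qx'.
  by rewrite (prism_level h') contract1.
apply: (locally_mono _ (LL_total (a := a) (b := pcomp (pcomp (spact B (f ∘ g)) b) (contract n)) llb aB)).
move=> W w [l [l1 l2]].
exists (pcomp l (pcomp (prism_pair n) (pprod_cst n ord0))); split=> [k t h|].
- have hy := cylP k t ord0 h.
  have hbox : sub (box (bd n) full ord_max) k (prism_pair n k (t, cst k ord0)) by apply/orP; left.
  apply: etrans (l1 _ _ hbox) _; rewrite (aP false _ _ hy hbox) hcompA !spactMx.
  congr (spact E w k (spact E g k _)).
  have h0 : sub (box (hn top) (bd n) ord0) k (prism_pair n k (t, cst k ord0)).
    by apply/orP; right; apply/base_im; rewrite prism_fst_pair prism_snd_pair.
  apply: etrans (A1 _ _ h0 _) _; congr (spact E f k _).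
  exact: (sub_app al _ _ (contract0 t)).
- apply: PshMap_eq => k t; apply: etrans (l2 _ _) _; rewrite /= hcompA -spactMx.
  congr (spact B _ k (b k _)); exact: contract0.
Qed.

(** The hypotheses are a weak equivalence of Kan complexes written elementwise. In positive
    dimension injectivity is asked only for spheres with constant image, since the one sphere to be
    killed is the last face of the contracted boundary. *)
Lemma LL_bd_of_pi :
  (forall n k, 0 < n -> LL (to_pt E) (@hn n k) full) ->
  (forall X (y : B X 0), locally (fun U (f : Hom U X) =>
     exists x, gen_equiv (@pi0_rel (B U)) (q U 0 x) (spact B f 0 y))) ->
  (forall X (x x' : E X 0), q X 0 x = q X 0 x' -> locally (fun U (f : Hom U X) =>
     gen_equiv (@pi0_rel (E U)) (spact E f 0 x) (spact E f 0 x'))) ->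
  (forall n X (x : E X 0) (b : sMap (simplex n) (B X)), 0 < n -> on_bd (q X 0 x) b ->
     locally (fun U (f : Hom U X) => exists2 s : sMap (simplex n) (E U), on_bd (spact E f 0 x) s &
       gen_equiv (@hrel n (B U) (spact B f 0 (q X 0 x))) (pcomp (q U) s) (pcomp (spact B f) b))) ->
  (forall n X (x : E X 0) (s : sMap (simplex n) (E X)), 0 < n -> on_bd x s ->
     pcomp (q X) s = degen_map_to _ (q X 0 x) ->
     locally (fun U (f : Hom U X) =>
       gen_equiv (@hrel n (E U) (spact E f 0 x)) (pcomp (spact E f) s)
         (degen_map_to _ (spact E f 0 x)))) ->
  forall n, LL q (bd n) full.
Proof.
move=> E_kan pi0s pi0i pis pii [|m].
  (* Dimension 0: surjectivity on components gives a vertex whose image is joined to [y], and path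
     lifting moves it over [y]. *)
  move=> X a b _.
  pose y : B X 0 := b 0 (exist _ (@hid Delta 0 : nerve 'I_1 0) (full_mem _)).
  have : locally (fun U (f : Hom U X) => exists x, q U 0 x = spact B f 0 y).
    apply: (locally_bind (pi0s X y)) => U f [x /(vertex_chain q_fib) [+ _]].
    have xl : locally (fun V (g : Hom V U) => exists x', q V 0 x' = spact B g 0 (q U 0 x)).
      by apply: locallyT => V g; exists (spact E g 0 x); rewrite spmap_act.
    move=> /(_ xl); apply: locally_mono => V g [x' E']; exists x'.
    by rewrite E' spactMx.
  apply: locally_mono => U f [x xE].
  exists (pcomp (yo x) (sub_incl (sub full))); split=> [k t hs|k [t ht]].
    case/miss_bd: (hs) => j _ /(_ ord0); by rewrite [t ord0]ord1 [j]ord1.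
  rewrite [LHS]pmap_nat xE /y -!pmap_nat; congr (spact B f k _); apply: sub_app.
  exact: omorph_eq.
apply: LL_bd_contract => X x a qa ahn.
pose n := m.+1; pose top : 'I_n.+1 := ord_max.
have miss_face k t : miss (pred1 top) k (post last_face k t).
  exists ord_max => /= [|i]; first exact: eqxx.
  by rewrite -(inj_eq val_inj) /=; have := ltn_ord (t i); move: (nat_of_ord _); lia.
have facebd k t : sub (bd n) k (post last_face k t).
  by apply/bdP; exact: missW (miss_face k t).
have sN k l (g : @Hom Delta l k) (t : simplex m k) :
   a l (exist _ _ (facebd l (pact (simplex m) g t))) = pact (E X) g (a k (exist _ _ (facebd k t))).
  by rewrite -pmap_nat; apply: sub_app; rewrite -pmap_nat.
pose s : sMap (simplex m) (E X) := Build_PshMap sN.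
have facedg k t : miss (pred1 top) k t -> post last_face k (post (sdeg ord_max) k t) = t.
  move=> [_ /eqP -> tm]; apply: omorph_eq => i; apply: val_inj => /=.
  have := tm i; rewrite -(inj_eq val_inj) /= /unbump; have := ltn_ord (t i).
  by move: (nat_of_ord (t i)); lia.
have sbd : on_bd x s.
  move=> k t [j tj]; apply: ahn; exists (last_face j) => [|i].
    by rewrite /= -(inj_eq val_inj) /=; have := ltn_ord j; lia.
  by rewrite /= -(inj_eq val_inj) /=; exact: tj.
have qs : pcomp (q X) s = degen_map_to _ (q X 0 x).
  by apply: PshMap_eq => k t; exact: qa.
have bnd : locally (fun U (f : Hom U X) => bounds (spact E f 0 x) (pcomp (spact E f) s)).
  have : locally (fun U (f : Hom U X) => gen_equiv (@hrel m (E U) (spact E f 0 x))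
      (pcomp (spact E f) s) (degen_map_to _ (spact E f 0 x))).
    (* For m = 0 the last face is a vertex, and injectivity on components replaces that on [pi];
       [key] reads a zigzag of edges as one of homotopies of maps on Delta^0. *)
    case: (posnP m) => [m0|m_gt0]; last exact: pii.
    pose v : 'I_m.+1 := ord0.
    have cstE k (t : simplex m k) : t = cst k v.
      apply: omorph_eq => i; apply: val_inj; have := ltn_ord (t i); rewrite /=; move: m0 (nat_of_ord (t i)); lia.
    have vx : q X 0 (s 0 (cst 0 v)) = q X 0 x.
      rewrite [LHS](congr1 (fun c : sMap _ _ => c 0 (cst 0 v)) qs) /= /degen -[RHS]pact1.
      by congr (pact _ _ _); apply: omorph_eq => i; rewrite [LHS]ord1 [RHS]ord1.
    apply: (locally_mono _ (pi0i X _ _ vx)) => U f.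
    have sE : pcomp (spact E f) s = degen_map_to _ (spact E f 0 (s 0 (cst 0 v))).
      apply: PshMap_eq => k t; rewrite (cstE _ t) /= -degen_map /degen -sN /=.
      congr (spact E f k _); apply: sub_app; exact: omorph_eq.
    have key z u w : gen_equiv (@pi0_rel (E U)) u w ->
        gen_equiv (@hrel m (E U) z) (degen_map_to _ u) (degen_map_to _ w).
      elim=> {u w} [u w [e [<- <-]]|u|u w _ IH|u w t _ IH1 _ IH2].
      - apply: rst_step; exists (pcomp (yo e) (pprod_snd _ _)); split=> k t.
        + by rewrite /= /degen -pactM; congr (pact _ _ e); exact: omorph_eq.
        + by rewrite /= /degen -pactM; congr (pact _ _ e); exact: omorph_eq.
        + move=> r [j tj]; have := tj ord0; rewrite (cstE _ t) /= -(inj_eq val_inj) /=.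
          by have := ltn_ord j; move: m0 (nat_of_ord j); lia.
      - exact: rst_refl.
      - exact: rst_sym IH.
      - exact: rst_trans IH1 IH2.
    by rewrite sE => /key.
  move=> h; apply: (locally_bind h) => U f /(bounds_chain E_kan) [_].
  have bc : locally (fun V (g : Hom V U) => bounds (spact E g 0 (spact E f 0 x))
      (pcomp (spact E g) (degen_map_to (simplex m) (spact E f 0 x)))).
    apply: locallyT => V g.
    have -> : pcomp (spact E g) (degen_map_to (simplex m) (spact E f 0 x)) =
        degen_map_to (simplex m) (spact E g 0 (spact E f 0 x)).
      by apply: PshMap_eq => k t; exact: degen_map.
    exact: bounds_const.
  by move=> /(_ bc); apply: locally_mono => V g; rewrite spactMx spactM pcompA.
apply: (locally_bind bnd) => U f [be [be1 be2]].
(* The bounding simplex has boundary [a], so it lifts the right boundary over the wrong simplex; its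
   image in B is a sphere. *)
have bea k t h : be k t = spact E f k (a k (exist _ t h)).
  have [j _ tj] := (@miss_bd n k t).1 h.
  have [jt|jt] := eqVneq j top.
    have tm : miss (pred1 top) k t by exists j => //; exact/eqP.
    rewrite be1 //=; congr (spact E f k _); apply: sub_app; exact: facedg.
  have tm : miss (predC1 top) k t by exists j.
  by rewrite be2 // ahn // degen_map.
have qbe : on_bd (q U 0 (spact E f 0 x)) (pcomp (q U) be).
  move=> k t /bdP h; rewrite /= (bea _ _ h) spmap_act qa degen_map -spmap_act //.
apply: (locally_bind (pis n U _ _ isT qbe)) => V g [de dex chain].
(* Since q [de] is homotopic to q [be] relative to the boundary, [be] can be moved so that the two
   images become equal, as [face_swap] demands. *)
have ov : over q (pcomp (spact E (f ∘ g)) a) (pcomp (q V) de).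
  apply/(over_chain q_fib _ chain); apply: locallyT => W w.
  exists (pcomp (spact E (g ∘ w)) be); split=> [k t h|].
    by rewrite /= (bea _ _ h) !spactMx.
  by apply: PshMap_eq => k t; rewrite /= spmap_act spactMx.
apply: (locally_bind ov) => W w [be' [be'1 be'2]].
have xw : spact E w 0 (spact E g 0 (spact E f 0 x)) = spact E (f ∘ (g ∘ w)) 0 x.
  by rewrite !spactMx.
have qbd : pcomp (q W) be' = pcomp (q W) (pcomp (spact E w) de).
  by rewrite be'2 !pcompA spmap_nat.
have dew : on_bd (spact E (f ∘ (g ∘ w)) 0 x) (pcomp (spact E w) de).
  by rewrite -xw; exact: on_bd_act.
have bew k t : miss (predC1 ord_max) k t -> be' k t = degen (spact E (f ∘ (g ∘ w)) 0 x) k.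
  move=> tm; have h : sub (bd n) k t by apply/bdP; exact: missW tm.
  by rewrite (be'1 _ _ h) /= ahn // !degen_map -!spactMx hcompA.
apply: (locally_mono _ (face_swap q_fib qbd dew bew)) => T t [ga [ga1 ga2]].
exists ga; split=> [k z h|].
- rewrite ga1; last exact/bdP.
  by rewrite (be'1 _ _ h) /= -!spactMx !hcompA.
- apply: PshMap_eq => k z; rewrite [LHS]ga2 /= degen_map; congr (degen _ k).
  by rewrite spmap_act -spactMx !hcompA.
Qed.

End Acyclicity.

(** * From Ex p back to p *)

Section Descent.
Variable n : nat.

Definition lv_map : sMap (sd n) (simplex n) := nerve_map (last_vertex n).

Lemma lv_bd k (t : sd n k) : sub (sdc (bd n)) k t -> sub (bd n) k (lv_map k t).
Proof.
move=> /forall_inP /(_ _ (mem_im t ord_max)) /=; apply: contra.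
rewrite -!subTset => h; apply: (subset_trans h); apply/subsetP => _ /imsetP[i _ ->].
have ti : (t i : {set _}) \subset t ord_max by apply: (omorph_le t); exact: leq_ord.
by apply: (subsetP ti); exact: nesub_max_mem.
Qed.

Definition cone_max : {omorphism nesub n *p 'I_2 -> 'I_n.+1} :=
  omorph_mk (fun (x y : nesub n *p 'I_2) (xy : (x <= y)%O) =>
    omorph_le (last_vertex n) (proj1 (andP xy)) : (nesub_max x.1 <= nesub_max y.1)%O).

Definition cone_fst : {omorphism nesub n *p 'I_2 -> nesub n} :=
  omorph_mk (fun (x y : nesub n *p 'I_2) (xy : (x <= y)%O) =>
    proj1 (andP xy) : (x.1 <= y.1)%O).

Lemma cone_top_le : {homo (fun i : 'I_n.+1 => (init_seg i, ord_max) : nesub n *p 'I_2) :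
  i j / (i <= j)%O}.
Proof. by move=> i j ij; apply/andP; split=> //; exact: init_seg_le. Qed.

Definition cone_top : {omorphism 'I_n.+1 -> nesub n *p 'I_2} := omorph_mk cone_top_le.

(** On the mapping cylinder, take [l] on the end sd Delta^n and [a] composed with the projection
    [cone_max] over the boundary. [LL_mcyl] extends this locally, and restriction to the end Delta^n
    along [cone_top] is the required lift. *)
Lemma descend (C : Site) (F G : SPsh C) (p : SPshMap F G) X
    (a : sMap (sub_psh (sub (bd n))) (F X)) (b : sMap (simplex n) (G X)) (l : sMap (sd n) (F X)) :
  (forall n k, 0 < n -> LL p (@hn n k) full) ->
  (forall k t h, p X k (a k (exist _ t h)) = b k t) ->
  (forall k t (h : sub (sdc (bd n)) k t), l k t = a k (exist _ _ (lv_bd h))) ->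
  (forall k t, p X k (l k t) = b k (lv_map k t)) ->
  over p a b.
Proof.
move=> llh ab la lb.
have bdP' k y : sub (mcyl_bd n) k y -> sub (bd n) k (nerve_map cone_max k y).
  move=> /andP[_] /=; apply: contra; rewrite -!subTset => h; apply: (subset_trans h).
  apply/subsetP => _ /imsetP[i _ ->]; apply/bigcupP; exists (y i); first exact: mem_im.
  by rewrite /supp_of /=; case: ifP => _; [exact: nesub_max_mem | rewrite inE].
pose f1 : sMap (sub_psh (sub (mcyl_end n))) (F X) := pcomp (pcomp l (nerve_map cone_fst)) (sub_incl _).
have f2N k r (g : @Hom Delta r k) (y : sub_psh (sub (mcyl_bd n)) k) :
    a r (exist _ _ (bdP' r _ (proj2_sig (pact (sub_psh (sub (mcyl_bd n))) g y)))) =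
    pact (F X) g (a k (exist _ _ (bdP' k _ (proj2_sig y)))).
  by rewrite -pmap_nat; apply: sub_app; rewrite -pmap_nat.
pose S (i : bool) := if i then sub (mcyl_bd n) else sub (mcyl_end n).
pose f0 (i : bool) : sMap (sub_psh (S i)) (F X) :=
  match i with true => Build_PshMap f2N | false => f1 end.
have agr k y h h' : f0 true k (exist _ y h) = f0 false k (exist _ y h').
  have hs : sub (sdc (bd n)) k (nerve_map cone_fst k y).
    apply/forall_inP => _ /imsetP[i _ ->] /=; case/andP: h => _; apply: contra.
    rewrite -!subTset => hi; apply: (subset_trans hi).
    have := forall_inP h' _ (mem_im y i) => /eqP yi.
    by apply: (bigcup_max (y i)); [exact: mem_im | rewrite /supp_of yi eqxx].
  by rewrite /= (la _ _ hs); apply: sub_app; exact: omorph_eq.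
have [||c cP] := @glue _ _ _ _ S f0 (sub (cplxU (mcyl_end n) (mcyl_bd n))).
- by move=> k y /orP[h|h]; [exists false|exists true].
- case=> [] [] k y h h' //; try exact: sub_app.
have cb k y hs ht : p X k (c k (exist _ y hs)) =
    pcomp (pcomp b (nerve_map cone_max)) (sub_incl (sub (mcyl n))) k (exist _ y ht).
  case/orP: (hs) => h; last by rewrite (cP true _ _ h hs) /= ab.
  rewrite (cP false _ _ h hs) /= lb; congr (b k _); exact: omorph_eq.
apply: (locally_mono _ (LL_mcyl llh cb)) => U f [la' [l1 l2]].
have topP k (t : simplex n k) : sub (mcyl n) k (nerve_map cone_top k t).
  by apply/forall_inP => _ /imsetP[i _ ->] /=; rewrite init_seg_max.
have lN k r (g : @Hom Delta r k) (t : simplex n k) :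
    la' r (exist _ _ (topP r (pact (simplex n) g t))) = pact (F U) g (la' k (exist _ _ (topP k t))).
  by rewrite -pmap_nat; apply: sub_app; rewrite -pmap_nat.
exists (Build_PshMap lN); split=> [k t h|].
- have hb : sub (mcyl_bd n) k (nerve_map cone_top k t).
    apply/andP; split; first exact: topP.
    apply: contra h => /eqP sT; rewrite -subTset -sT; apply/bigcupsP => _ /imsetP[i _ ->].
    by rewrite /supp_of /= sub1set init_seg_max mem_im.
  have hs : sub (cplxU (mcyl_end n) (mcyl_bd n)) k (nerve_map cone_top k t) by apply/orP; right.
  rewrite [LHS](l1 _ _ hs) (cP true _ _ hb hs); congr (spact F f k _).
  apply: (sub_app a); apply: omorph_eq => i; exact: init_seg_max.
- apply: PshMap_eq => k t; rewrite [LHS]l2 /=; congr (spact G f k (b k _)).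
  apply: omorph_eq => i; exact: init_seg_max.
Qed.

(** A lift along Ex p is determined by its value at the identity of [n], a map sd Delta^n -> F. As
    the square was composed with [Ex_unit], the boundary of this map factors through the last vertex
    map. *)
Lemma descend_Ex (C : Site) (F G : SPsh C) (p : SPshMap F G) X
    (a : sMap (sub_psh (sub (bd n))) (F X)) (b : sMap (simplex n) (G X)) :
  (forall n k, 0 < n -> LL p (@hn n k) full) ->
  (forall k t h, p X k (a k (exist _ t h)) = b k t) ->
  over (Ex_psh_map p) (pcomp (Ex_unit (F X)) a : sMap _ (Ex_psh F X))
    (pcomp (Ex_unit (G X)) b : sMap _ (Ex_psh G X)) ->
  over p a b.
Proof.
move=> llh ab ov; apply: (locally_bind ov) => U f [la [la1 la2]].
pose l : sMap (sd n) (F U) := la n (@hid Delta n).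
have laE r (x : simplex n r) m (s : sd r m) : la r x m s = l m (sd_map x m s).
  have -> : la r x = pact (Ex (F U)) (x : @Hom Delta r n) l.
    by rewrite -pmap_nat; congr (la r _); exact: omorph_eq.
  by [].
have d := @descend C F G p U (pcomp (spact F f) a) (pcomp (spact G f) b) l llh.
have d1 k t h : p U k (pcomp (spact F f) a k (exist _ t h)) = pcomp (spact G f) b k t.
  by rewrite /= spmap_act ab.
have d2 k t (h : sub (sdc (bd n)) k t) : l k t = pcomp (spact F f) a k (exist _ _ (lv_bd h)).
  have [r [x [s [xi hx sE]]]] := sdc_lift h.
  rewrite -{1}sE -laE (la1 _ _ hx) /= -pmap_nat; congr (spact F f k _).
  apply: sub_app; rewrite -sE; apply: omorph_eq => i.
  by rewrite [RHS](nesub_max_image x (s i)).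
have d3 k t : p U k (l k t) = pcomp (spact G f) b k (lv_map k t).
  have := congr1 (fun c : sMap (simplex n) (Ex (G U)) => c n (@hid Delta n) k t) la2.
  rewrite /= => ->; rewrite -pmap_nat; congr (spact G f k (b k _)); exact: omorph_eq.
by apply: (locally_mono _ (d d1 d2 d3)) => V g [be]; rewrite !pcompA -!spactM => -[be1 be2];
  exists be; split=> // k t h; rewrite be1 /= spactMx.
Qed.

End Descent.

Section Stage0.

Fixpoint Ex_iter_unit (i : nat) (K : sSet) : sMap K (Ex_iter i K) :=
  if i is j.+1 then pcomp (Ex_unit (Ex_iter j K)) (Ex_iter_unit j K) else pid K.

Lemma Ex_iter_unit_nat (i : nat) (K L : sSet) (f : sMap K L) :
  pcomp (Ex_iter_map i f) (Ex_iter_unit i K) = pcomp (Ex_iter_unit i L) f.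
Proof.
elim: i => [|i IH] /=; first exact: PshMap_eq.
by rewrite pcompA Ex_unit_nat -pcompA IH pcompA.
Qed.

Lemma stage_unit (i : nat) (K : sSet) n (x : K n) :
  seq_incl (fun i => Ex_unit (Ex_iter i K)) i n (Ex_iter_unit i K n x) = ExInf_unit K n x.
Proof. by elim: i => [//|i IH]; rewrite [LHS]seq_incl_step. Qed.

Lemma ExInf_unit_inj (K : sSet) n : injective (ExInf_unit K n).
Proof. exact: (@stage_inj K 0 n). Qed.

(** sd Delta^0 is a point, so Ex adds no vertices. *)
Lemma Ex_vertex (K : sSet) (z : Ex K 0) : exists x, Ex_unit K 0 x = z.
Proof.
exists (z 0 (omorph_const _ (init_seg ord0) : sd 0 0)).
apply: PshMap_eq => m s /=; rewrite -pmap_nat; congr (z m _); apply: omorph_eq => i.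
apply: val_inj; apply/setP => j; rewrite /= inE (ord1 j) lexx; symmetry.
by have /set0Pn[l] := nesubP (s i); rewrite (ord1 l).
Qed.

Lemma ExInf_vertex (K : sSet) (z : ExInf K 0) : exists x, ExInf_unit K 0 x = z.
Proof.
have [i [x <-]] := seq_incl_surj z; elim: i x => [|i IH] x; first by exists x.
have [y <-] := Ex_vertex x; rewrite seq_incl_step; exact: IH.
Qed.

End Stage0.

(** * Acyclic local fibrations have boundary liftings *)

Section Main.
Variables (C : Site) (F G : SPsh C) (p : SPshMap F G).
Hypothesis p_fib : forall n k, 0 < n -> LL p (@hn n k) full.

(** A lift into Ex^oo F lives at a finite stage, from which [descend_Ex] removes one Ex at a time;
    each intermediate map is still a local fibration. *)
Lemma LL_bd_of_ExInf n : LL (ExInf_psh_map p) (bd n) full -> LL p (bd n) full.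
Proof.
move=> llq X a b' ab'.
pose b : sMap (simplex n) (G X) := pcomp b' (sub_total (@full_mem _ 'I_n.+1)).
have ab k t h : p X k (a k (exist _ t h)) = b k t by rewrite /= (ab' _ _ h (full_mem t)).
suff : over p a b.
  apply: locally_mono => U f [l [l1 l2]]; exists (pcomp l (sub_incl _)).
  split=> [k t hs ht|k [t ht]]; first exact: l1.
  apply: etrans (congr1 (fun c : sMap (simplex n) (G U) => c k t) l2) _.
  by rewrite /=; congr (spact G f k _); exact: sub_app.
have down i U (f : Hom U X) :
    over (Ex_iter_psh_map i p) (pcomp (Ex_iter_unit i (F U)) (pcomp (spact F f) a) : sMap _ (Ex_iter_psh i F U))
      (pcomp (Ex_iter_unit i (G U)) (pcomp (spact G f) b) : sMap _ (Ex_iter_psh i G U)) ->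
    over p (pcomp (spact F f) a) (pcomp (spact G f) b).
  elim: i => [|i IH] ov.
    by move: ov; rewrite /= !pcomp1r.
  have fib_i : forall n k, 0 < n -> LL (Ex_iter_psh_map i p) (@hn n k) full by exact: Ex_iter_LL.
  apply: IH; apply: (descend_Ex fib_i).
    move=> k t h.
    have e := congr1 (fun c : sMap (F U) (Ex_iter i (G U)) => c k (spact F f k (a k (exist _ t h))))
      (Ex_iter_unit_nat i (p U)).
    by apply: etrans e _; rewrite /= spmap_act ab.
  by move: ov; rewrite -!pcompA.
pose ea : sMap (sub_psh (sub (bd n))) (ExInf (F X)) := pcomp (ExInf_unit (F X)) a.
pose eb : sMap (simplex n) (ExInf (G X)) := pcomp (ExInf_unit (G X)) b.
have eab k t h : ExInf_psh_map p X k (ea k (exist _ t h)) = eb k t.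
  by rewrite [LHS]ExInf_map_stage /= ab.
apply: (locally_bind (LL_total llq eab)) => U f [la [la1 la2]].
have [i iP] := ExInf_stage (pcomp la (sub_incl (sub (@full _ 'I_n.+1)))).
have [la' la'E] := iP i (leqnn i).
pose l : sMap (simplex n) (Ex_iter i (F U)) := pcomp la' (sub_total (@full_mem _ 'I_n.+1)).
have lE k t : seq_incl (fun i => Ex_unit (Ex_iter i (F U))) i k (l k t) = la k t.
  by rewrite [LHS]la'E.
have : over p (pcomp (spact F f) a) (pcomp (spact G f) b).
  apply: (down i); apply: locallyT => V g.
  exists (pcomp (Ex_iter_map i (spact F g)) l); split=> [k t h|].
    rewrite /=; congr (Ex_iter_map i (spact F g) k _); apply: (@stage_inj _ i).
    rewrite lE (la1 _ _ h) stage_unit [LHS]ExInf_map_stage //.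
  apply: PshMap_eq => k t; apply: etrans (spmap_act (Ex_iter_psh_map i p) g (l k t)) _.
  apply: (congr1 (Ex_iter_map i (spact G g) k)); apply: (@stage_inj _ i).
  rewrite stage_unit -[LHS](ExInf_map_stage (p U)) lE.
  apply: etrans (la2 _ _) _; exact: ExInf_map_stage.
by apply: locally_mono => V g [be]; rewrite !pcompA -!spactM => -[be1 be2];
  exists be; split=> // k t h; rewrite be1 /= spactMx.
Qed.

Lemma gen_pi0_map (K L : sSet) (f : sMap K L) u w :
  gen_equiv (@pi0_rel K) u w -> gen_equiv (@pi0_rel L) (f 0 u) (f 0 w).
Proof.
elim=> {u w} [u w uw|u|u w _ IH|u w t _ IH1 _ IH2].
- exact: pi0_rel_map.
- exact: rst_refl.
- exact: rst_sym IH.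
- exact: rst_trans IH1 IH2.
Qed.

Lemma gen_hrel n (K : sSet) (z : K 0) (s s' : sphere n z) :
  gen_equiv (@rel_homotopic n K z) s s' -> gen_equiv (@hrel n K z) (proj1_sig s) (proj1_sig s').
Proof.
elim=> {s s'} [s s' h|s|s s' _ IH|s s' s'' _ IH1 _ IH2].
- exact: rst_step.
- exact: rst_refl.
- exact: rst_sym IH.
- exact: rst_trans IH1 IH2.
Qed.

(** A weak equivalence speaks of base points in F, while [LL_bd_of_pi] needs all those of Ex^oo F;
    by [ExInf_vertex] these are the same. Homotopy sets over X are read off at the identity of X in
    the slice. *)
Lemma LL_bd_of_weak_equivalence : local_weak_equivalence p -> forall n, LL p (bd n) full.
Proof.
move=> [/iso_on_sheafificationP [pi0i pi0s] piP] n.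
apply: LL_bd_of_ExInf; move: n.
have baseE (H : SPsh C) U V (f : Hom V U) x :
    spact (ExInf_psh H) f 0 (ExInf_unit (H U) 0 x) = ExInf_unit (H V) 0 (spact H f 0 x).
  exact: ExInf_map_stage.
apply: LL_bd_of_pi.
- move=> n k n0; apply: ExInf_LL => i; exact: Ex_iter_LL.
- move=> n k n0; exact: ExInf_kan.
- move=> X y; have [v <-] := ExInf_vertex y.
  apply: (locally_mono _ (pi0s X (class _ v))) => U f [c].
  elim/quotW: c => x E; rewrite /= /pi0_map !quot_mapE in E.
  exists (ExInf_unit (F U) 0 x); rewrite ExInf_base baseE.
  exact: (gen_pi0_map (ExInf_unit (G U)) (class_eq E)).
- move=> X x x'; have [u <-] := ExInf_vertex x; have [u' <-] := ExInf_vertex x'.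
  rewrite !ExInf_base => /ExInf_unit_inj E.
  have uu' : pi0_psh_map p X (class _ u) = pi0_psh_map p X (class _ u').
    by rewrite /= /pi0_map !quot_mapE E.
  apply: (locally_mono _ (pi0i X _ _ uu')) => U f E'; rewrite /= /pi0_map !quot_mapE in E'.
  by rewrite !baseE; exact: (gen_pi0_map (ExInf_unit (F U)) (class_eq E')).
- move=> n X x b n0; have [u <-] := ExInf_vertex x => bz.
  have /iso_on_sheafificationP [_ pis] := piP X u n n0.
  pose a : slice_site X := Over (hid X).
  have bz' : on_bd (spact (ExInf_psh G) (arr a) 0 (ExInf_unit (G X) 0 (p X 0 u))) b.
    by rewrite spact1 -ExInf_base.
  have := locally_dom (pis a (class _ (exist _ b bz'))).
  apply: locally_mono => U f [c]; elim/quotW: c => -[s sz] E.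
  rewrite /pi_psh_map [LHS]quot_mapE [RHS]quot_mapE in E.
  have e : arr a ∘ f = f by exact: hcomp1r.
  have sz' : on_bd (spact (ExInf_psh F) (arr a ∘ f) 0 (ExInf_unit (F X) 0 u)) s := sz.
  exists s; first by rewrite -{1}e.
  have h : gen_equiv
      (@hrel n _ (spact (ExInf_psh G) (arr a ∘ f) 0 (ExInf_unit (G X) 0 (p X 0 u))))
      (pcomp (ExInf_psh_map p U) s) (pcomp (spact (ExInf_psh G) f) b) := gen_hrel (class_eq E).
  by rewrite ExInf_base -{1}e.
- move=> n X x s n0; have [u <-] := ExInf_vertex x => sz qs.
  have /iso_on_sheafificationP [pii _] := piP X u n n0.
  pose a : slice_site X := Over (hid X).
  have sz' : on_bd (spact (ExInf_psh F) (arr a) 0 (ExInf_unit (F X) 0 u)) s by rewrite spact1.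
  pose k := degen_map_to (simplex n) (spact (ExInf_psh F) (arr a) 0 (ExInf_unit (F X) 0 u)).
  have kz : on_bd (spact (ExInf_psh F) (arr a) 0 (ExInf_unit (F X) 0 u)) k by [].
  have sk : pi_psh_map n (ExInf_base p u) a (class _ (exist _ s sz')) =
      pi_psh_map n (ExInf_base p u) a (class _ (exist _ k kz)).
    rewrite [LHS]quot_mapE [RHS]quot_mapE; congr class; apply: sig_eq; rewrite [LHS]qs.
    by apply: PshMap_eq => l t; rewrite [RHS]degen_map spact1.
  apply: (locally_mono _ (locally_dom (pii a _ _ sk))) => U f E.
  rewrite [LHS]quot_mapE [RHS]quot_mapE in E.
  have e : arr a ∘ f = f by exact: hcomp1r.
  have : gen_equiv (@hrel n _ (spact (ExInf_psh F) (arr a ∘ f) 0 (ExInf_unit (F X) 0 u)))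
      (pcomp (spact (ExInf_psh F) f) s) (pcomp (spact (ExInf_psh F) f) k) := gen_hrel (class_eq E).
  rewrite e; congr gen_equiv; apply: PshMap_eq => l t.
  by rewrite [LHS]degen_map spact1.
Qed.

End Main.

Theorem proposition7p2 (C : Site) (F G : SPsh C) (p : SPshMap F G) :
  (forall n : nat, lifts_locally (sub_incl (boundary n)) p) <->
  local_acyclic_fibration p.
Proof.
split=> [/boundary_LL /local_acyclic_fibration_of_LL //|[pw /local_fibrationP p_fib]].
by apply/boundary_LL; exact: LL_bd_of_weak_equivalence.
Qed.
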